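(* Let $x\in(0,1)$ be fixed and let $A_\varepsilon$ be the parameterized, independent, uniformly elliptic medium described in the context, with $g$, $Z_\varepsilon$, $\mathbf H(s)$, $V_\alpha$ as defined there. Define, for $\lambda\in\mathbb R^4$, $$\Lambda(\lambda):=\int_0^1\Lambda\left(V_{a(s,\xi)},\lambda\cdot\mathbf H(s)\right)ds .$$ Then $\Lambda\in C^\infty(\mathbb R^4)$ is a convex function such that $$\lim_{\varepsilon\to0}\varepsilon\log\mathbb E_\xi e^{\varepsilon^{-1}\lambda\cdot Z_\varepsilon}=\Lambda(\lambda).$$ Moreover, for fixed $\xi$, $Z_\varepsilon$ satisfies a large deviation principle with good convex rate function $$\Lambda^\ast(\ell):=\sup_{\lambda\in\mathbb R^4}\left[\lambda\cdot\ell-\Lambda(\lambda)\right],$$ and $u_\varepsilon=u_\varepsilon(x)$ satisfies a large deviation principle with good rate function $$I_{u_\varepsilon}(\ell):=\inf_{z\in g^{-1}\{\ell\}}\Lambda^\ast(z).$$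
   Context: $\xi$ is a random vector, $P_\xi=P[\,\cdot\mid\xi]$, $\mathbb E_\xi\{X\}=\mathbb E\{X\mid\xi\}$; all statements are for fixed $\xi$, under $P_\xi$. Medium: $A_\varepsilon(x)=A(x,x/\varepsilon)$ with $A(x,y)=a(x,\xi)+b(y,\theta)$, where every realization of $x\mapsto a(x,\xi)$ is continuous on $[0,1]$, $$b(y,\theta)=\nu_b\sum_{j=1}^\infty\theta_j\mathbf 1_{[j-1,j)}(y),$$ $\nu_b>0$ is a constant, the $\theta_j$ are (conditionally on $\xi$) i.i.d. with law $\pi_\theta$, $|\theta_j|\le1$, and $0<\nu_1\le A(x,y)\le\nu_2$ with constants $\nu_1,\nu_2$. $V_\alpha:=\dfrac1{\alpha+\nu_b\theta}$ with $\theta\sim\pi_\theta$. For a random variable $Y$, $\Lambda(Y,t):=\log\mathbb E\{e^{tY}\}$; thus $\Lambda(V_{a(s,\xi)},t)=\log\mathbb E\{e^{tV_\alpha}\}\big|_{\alpha=a(s,\xi)}$. Equation: $f\in L^2([0,1])$ is deterministic, $F(s):=\int_0^sf(t)\,dt$, and $u_\varepsilon$ solves $-\frac{d}{dx}\left(A_\varepsilon\frac{d}{dx}u_\varepsilon\right)=f$ on $(0,1)$ with $u_\varepsilon(0)=u_\varepsilon(1)=0$. For the fixed $x\in(0,1)$, $$u_\varepsilon(x)=g(Z_\varepsilon),\quad g:\mathbb R^2\times(0,\infty)^2\to\mathbb R,\quad g(z_1,z_2,z_3,z_4)=-z_1+z_2\frac{z_3}{z_4},$$ where $Z_\varepsilon=(Z_{\varepsilon,1},\dots,Z_{\varepsilon,4})$,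 $Z_{\varepsilon,i}=\int_0^1\frac{H_i(s)}{A_\varepsilon(s)}\,ds$, and $$\mathbf H=(H_1,H_2,H_3,H_4)=(F\mathbf 1_{(0,x)},\,F,\,\mathbf 1_{(0,x)},\,1).$$ Large deviations: a rate function is a lower semicontinuous $I:\mathbb R^n\to[0,\infty]$; it is good if all sublevel sets $\{y: I(y)\le\alpha\}$, $\alpha\in[0,\infty)$, are compact. A family of random vectors $Y_\varepsilon\in\mathbb R^n$ satisfies a large deviation principle with rate function $I$ (here with respect to $P_\xi$) if for all (Borel) $\Gamma\subset\mathbb R^n$ $$-\inf_{y\in\Gamma^\circ}I(y)\le\liminf_{\varepsilon\to0}\varepsilon\log P_\xi[Y_\varepsilon\in\Gamma]\le\limsup_{\varepsilon\to0}\varepsilon\log P_\xi[Y_\varepsilon\in\Gamma]\le-\inf_{y\in\bar\Gamma}I(y).$$ *)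

(* Defs.v *)
From HB Require Import structures.
From mathcomp Require Import all_boot all_order all_algebra.
From mathcomp Require Import all_classical all_reals all_analysis measurable_realfun.

Set Implicit Arguments.
Unset Strict Implicit.
Unset Printing Implicit Defensive.
Import Order.TTheory GRing.Theory Num.Theory.
Import numFieldNormedType.Exports.

Local Open Scope classical_set_scope.
Local Open Scope ring_scope.

Section LargeDeviations.
Context {R : realType}.

Definition is_rate_function {E : topologicalType} (I : E -> \bar R) : Prop :=
  lower_semicontinuous I /\ forall y, (0 <= I y)%E.

Definition is_good_rate_function {E : topologicalType} (I : E -> \bar R) : Prop :=
  is_rate_function I /\
  forall alpha : R, 0 <= alpha -> compact [set y | (I y <= alpha%:E)%E].

(* [convex_function] only covers real-valued functions; the right-hand side is
   never of the form +oo - oo when [I] is nonnegative. *)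
Definition is_convex_ereal {E : lmodType R} (I : E -> \bar R) : Prop :=
  forall (t : R) (y z : E), 0 <= t <= 1 ->
    (I (t *: y + (1 - t) *: z)%R <= t%:E * I y + (1 - t)%:E * I z)%E.

(* [<<s open >>] is the Borel sigma-algebra of [E]; [lne 0 = -oo]. *)
Definition satisfies_LDP d {T : measurableType d} (Q : probability T R)
    {E : topologicalType} (Y : R -> T -> E) (I : E -> \bar R) : Prop :=
  forall Gamma : set E, <<s [set U | open U] >> Gamma ->
    let rate eps := (eps%:E * lne (Q (Y eps @^-1` Gamma)))%E in
    [/\ (- ereal_inf [set I y | y in interior Gamma]
           <= limf_einf rate (0^'+))%E,
        (limf_einf rate (0^'+) <= limf_esup rate (0^'+))%E
      & (limf_esup rate (0^'+)
           <= - ereal_inf [set I y | y in closure Gamma])%E].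

Definition log_mgf d {T : measurableType d} (Q : probability T R)
    (Y : T -> R) (t : R) : \bar R := lne ('M_Q Y t).

End LargeDeviations.

Section Analysis.
Context {R : realType}.

Definition dotv n (u w : 'rV[R]_n) : R := \sum_(i < n) u 0 i * w 0 i.

Definition fenchel_legendre n (L : 'rV[R]_n -> R) (l : 'rV[R]_n) : \bar R :=
  ereal_sup [set (dotv lam l - L lam)%:E | lam in [set: 'rV[R]_n]].

Fixpoint class_C n (k : nat) (h : 'rV[R]_n.+1 -> R) : Prop :=
  continuous h /\
  if k is k'.+1 then
    forall i : 'I_n.+1, let e : 'rV[R]_n.+1 := delta_mx 0 i in
      (forall z, derivable h z e) /\ class_C k' (fun z => 'D_e h z)
  else True.

Definition class_Coo n (h : 'rV[R]_n.+1 -> R) : Prop := forall k, class_C k h.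

Local Notation mu := (@lebesgue_measure R).

Definition is_L2_01 (f : R -> R) : Prop :=
  measurable_fun `[0 : R, 1] f /\
  mu.-integrable `[0, 1] (fun s => (f s ^+ 2)%:E).

(* [u] is (the absolutely continuous representative of) an element of H^1(0,1)
   and [v] is its weak derivative. *)
Definition has_L2_derivative (u v : R -> R) : Prop :=
  is_L2_01 v /\
  forall s : R, s \in `[0, 1] -> u s = u 0 + \int[mu]_(r in `[0, s]) v r.

(* Weak formulation of - (A u')' = f on (0,1), u(0) = u(1) = 0, tested against
   H^1_0(0,1). *)
Definition is_weak_solution (A f u : R -> R) : Prop :=
  [/\ u 0 = 0, u 1 = 0 &
    exists2 v, has_L2_derivative u v &
      forall phi psi : R -> R, has_L2_derivative phi psi ->
        phi 0 = 0 -> phi 1 = 0 ->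
        \int[mu]_(s in `[0, 1]) (A s * v s * psi s) =
        \int[mu]_(s in `[0, 1]) (f s * phi s)].

End Analysis.

Section Probability.
Context {R : realType} d {T : measurableType d}.

(* [Pxi] is a regular version of the conditional probability P[ . | xi]. *)
Definition is_conditional_probability (P : probability T R)
    d' {X : measurableType d'} (xi : T -> X) (Pxi : X -> probability T R) : Prop :=
  (forall B, measurable B -> measurable_fun [set: X] (fun v => Pxi v B)) /\
  (forall B C, measurable B -> measurable C ->
    P (B `&` xi @^-1` C) = \int[P]_(w in xi @^-1` C) Pxi (xi w) B)%E.

Definition mutually_independent (Q : probability T R) (X : nat -> T -> R) : Prop :=
  forall (J : seq nat) (B : nat -> set R), uniq J ->
    (forall j, measurable (B j)) ->
    Q (\bigcap_(j in [set` J]) (X j @^-1` B j)) =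
    (\prod_(j <- J) fine (Q (X j @^-1` B j)))%:E.

Definition is_iid (Q : probability T R) (X : nat -> T -> R)
    (law : probability (measurableTypeR R) R) : Prop :=
  mutually_independent Q X /\
  forall j (B : set R), measurable B -> Q (X j @^-1` B) = law B.

End Probability.

Section Medium.
Context {R : realType}.
Local Notation mu := (@lebesgue_measure R).

(* The sequence is indexed from 0: [theta j] is the value of the medium on the
   cell [j, j+1). *)
Definition b_medium (nub : R) (theta : nat -> R) (y : R) : R :=
  nub * limn (series (fun j => theta j * \1_(`[j%:R, j.+1%:R[%classic : set R) y)).

Definition A_medium (a : R -> R) (nub : R) (theta : nat -> R) (s y : R) : R :=
  a s + b_medium nub theta y.

Definition A_eps (a : R -> R) (nub : R) (theta : nat -> R) (eps s : R) : R :=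
  A_medium a nub theta s (s / eps).

Definition primitive (f : R -> R) (s : R) : R := \int[mu]_(t in `[0, s]) f t.

Definition H_vec (f : R -> R) (x s : R) : 'rV[R]_4 :=
  let ind : R := \1_(`]0, x[%classic : set R) s in
  \row_(i < 4) nth 0 [:: primitive f s * ind; primitive f s; ind; 1] i.

Definition Z_vec (a : R -> R) (nub : R) (theta : nat -> R) (f : R -> R)
    (x eps : R) : 'rV[R]_4 :=
  \row_(i < 4)
    \int[mu]_(s in `[0, 1]) (H_vec f x s 0 i / A_eps a nub theta eps s).

(* A random variable on the probability space (R, pi_theta). *)
Definition V_var (nub alpha : R) (t : R) : R := (alpha + nub * t)^-1.

(* [fine] is harmless here: V_(a(s)) is bounded under uniform ellipticity. *)
Definition Lambda (pitheta : probability (measurableTypeR R) R)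
    (a : R -> R) (nub : R) (f : R -> R) (x : R) (lam : 'rV[R]_4) : R :=
  \int[mu]_(s in `[0, 1])
    fine (log_mgf pitheta (V_var nub (a s)) (dotv lam (H_vec f x s))).

Definition g_dom : set 'rV[R]_4 := [set z | 0 < z 0 2 /\ 0 < z 0 3].

Definition g_fun (z : 'rV[R]_4) : R := - z 0 0 + z 0 1 * (z 0 2 / z 0 3).

Definition rate_u (L : 'rV[R]_4 -> R) (l : R) : \bar R :=
  ereal_inf [set fenchel_legendre L z | z in [set z | g_dom z /\ g_fun z = l]].

End Medium.

(* Main.v *)
Require Import Defs.
From HB Require Import structures.
From mathcomp Require Import all_boot all_order all_algebra.
From mathcomp Require Import finmap.
From mathcomp Require Import all_classical all_reals all_analysis measurable_realfun.
From mathcomp Require Import ring lra.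
Import Order.TTheory GRing.Theory Num.Theory.
Import numFieldNormedType.Exports.
Set Implicit Arguments.
Unset Strict Implicit.
Unset Printing Implicit Defensive.
Local Open Scope classical_set_scope.
Local Open Scope ring_scope.

(** The medium is constant in its random argument on each cell
   [[j eps, (j+1) eps[], so [lam . Z_eps] is a sum of independent cell integrals
   of [lam . H(s) W(s, theta_j)], where [W(s, t) = 1 / (a(s) + nub t)]
   ([dotv_Z]). Its exponential moment at [1 / eps] is therefore a product of
   one-cell moments ([independent_integral_prod], [mgf_cells]), and
   [eps log E exp (lam . Z_eps / eps)] is a sum over cells of
   [eps log E exp (cell integral / eps)]. As [lam . H] and [a] are uniformly
   continuous on either side of [x], each term is the integral over the cell of
   the cumulant of [W(s, .)] at [lam . H(s)], up to [o(eps)], except for at most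
   three cells that contribute [O(eps)] each ([cell_sum_cvg]). This is the
   limit [Lambda(lam)] ([Z_mgf_cvg]). To have bounds for every value of [t], the
   denominator of [W] is clamped to [[nu1, nu2]], which changes nothing almost
   surely ([ae_clamped_inv]).

   The derivatives in [z] of the cumulant [log E e^(zW)] are polynomials in the
   ratios [r_k = E (W^k e^(zW)) / E e^(zW)], which satisfy
   [r_k' = r_(k+1) - r_k r_1] and are bounded by the powers of the bound on [W].
   Differentiation under the integral then gives smoothness
   ([integrated_cumulant_smooth]); convexity is that of each cumulant.

   The large deviation principle for [Z_eps] is the Gartner-Ellis theorem for a
   differentiable limit, in the case of vectors bounded almost surely. The upper
   bound covers a compact set by finitely many half-spaces and applies the
   Chernoff bound to each ([ldp_upper_gartner_ellis]). The lower bound holds at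
   the gradient points [grad Lambda(eta)], because the law tilted by [eta]
   concentrates there ([ldp_lower_gradient]); every point [y] of finite rate is
   approached by gradient points of no greater rate, obtained by maximizing
   [lam . y - Lambda(lam) - delta / 2 |lam|^2] ([gradient_approximation]).

   Testing the weak formulation against the primitive of
   [(1_(0,x) - Z_3 / Z_4) / A_eps] gives [u_eps(x) = g(Z_eps)]
   ([weak_solution_formula]). Ellipticity confines [Z_eps] almost surely to a
   compact box inside the domain of [g] ([Z_in_box]); the rate is infinite
   outside this box ([fenchel_legendre_domain]), so the contraction principle
   applies although [g] is not defined everywhere ([contraction_principle]). *)

(** * Large deviation bounds in exponential form *)

Section ExponentialForm.
Context {R : realType} d {T : measurableType d} (Q : probability T R).

(** Exponential form of the upper bound, for closed sets. *)
Definition ldp_upper {E : topologicalType} (Y : R -> T -> E) (I : E -> \bar R) :=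
  forall F : set E, closed F -> forall alpha delta : R, 0 < delta ->
    (forall y, F y -> (alpha%:E < I y)%E) ->
    \forall eps \near 0^'+,
      (Q (Y eps @^-1` F) <= (expR (- (alpha - delta) / eps))%:E)%E.

(** Exponential form of the lower bound, around a point of an open set. *)
Definition ldp_lower {E : topologicalType} (Y : R -> T -> E) (I : E -> \bar R) :=
  forall G : set E, open G -> forall (y : E) (beta delta : R), 0 < delta ->
    G y -> (I y <= beta%:E)%E ->
    \forall eps \near 0^'+,
      ((expR (- (beta + delta) / eps))%:E <= Q (Y eps @^-1` G))%E.

(** Measurability with respect to the Borel sigma-algebra of [E]. *)
Definition borel_measurable {E : topologicalType} (Y : T -> E) :=
  forall Gamma : set E, <<s [set U | open U] >> Gamma -> measurable (Y @^-1` Gamma).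

Lemma borel_measurable_open {E : topologicalType} (Y : T -> E) (U : set E) :
  borel_measurable Y -> open U -> measurable (Y @^-1` U).
Proof. by move=> mY oU; apply: mY; exact: sub_sigma_algebra. Qed.

Lemma borel_measurable_closed {E : topologicalType} (Y : T -> E) (F : set E) :
  borel_measurable Y -> closed F -> measurable (Y @^-1` F).
Proof.
move=> mY cF; rewrite -[Y @^-1` F]setCK; apply: measurableC.
exact: (borel_measurable_open mY (closed_openC cF)).
Qed.

Lemma limf_esup_le_near (h : R -> \bar R) (c : \bar R) :
  (\forall eps \near 0^'+, (h eps <= c)%E) -> (limf_esup h (0^'+) <= c)%E.
Proof.
move=> hc; rewrite limf_esupE; apply: ge_ereal_inf.
exists (ereal_sup (h @` [set e | (h e <= c)%E])).
  by exists [set e | (h e <= c)%E].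
by apply: ge_ereal_sup => _ [e /= he <-].
Qed.

Lemma limf_einf_ge_near (h : R -> \bar R) (c : \bar R) :
  (\forall eps \near 0^'+, (c <= h eps)%E) -> (c <= limf_einf h (0^'+))%E.
Proof.
move=> hc; rewrite /limf_einf leeNr; apply: limf_esup_le_near.
by near=> e; rewrite leeN2; near: e.
Unshelve. all: by end_near. Qed.

Lemma limf_einf_le_esup (h : R -> \bar R) :
  (limf_einf h (0^'+) <= limf_esup h (0^'+))%E.
Proof.
rewrite limf_einfE limf_esupE; apply: ge_ereal_sup => _ [V FV <-].
apply: le_ereal_inf_tmp => _ [W FW <-].
have [e [Ve We]] := filter_ex (filterI FV FW).
apply: (@le_trans _ _ (h e)).
  by apply: ereal_inf_lbound; exists e.
by apply: ereal_sup_ubound; exists e.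
Qed.

Lemma lee_Nreal (A B : \bar R) :
  (forall alpha : R, (alpha%:E < B)%E -> (A <= (- alpha)%:E)%E) -> (A <= - B)%E.
Proof.
case: B => [r| |] h.
- apply/lee_addgt0Pr => e e0.
  have := h (r - e); rewrite lte_fin gtrBl e0 => /(_ isT).
  by rewrite opprB addrC EFinD.
- case: A h => [a| |] h //.
  + have := h (- a + 1) (ltry _); rewrite lee_fin => h1; exfalso; move: h1; lra.
  + by have := h 0 (ltry _).
- by rewrite /= leey.
Qed.

Lemma leNe_real (A B : \bar R) :
  (forall beta : R, (B <= beta%:E)%E -> ((- beta)%:E <= A)%E) -> (- B <= A)%E.
Proof.
move=> h; rewrite -[A]oppeK leeNl oppeK.
case: B h => [r| |] h.
- by rewrite leeNl -EFinN; exact: h.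
- by rewrite leey.
- case: A h => [a| |] h //.
  + have := h (- a - 1) (leNye _); rewrite lee_fin => h1; exfalso; move: h1; lra.
  + by have := h 0 (leNye _).
Qed.

Lemma lee_eps_lne (eps c : R) (q : \bar R) : 0 < eps -> (0 <= q)%E ->
  (q <= (expR (c / eps))%:E)%E -> (eps%:E * lne q <= c%:E)%E.
Proof.
move=> e0 q0 qc; have : (lne q <= (c / eps)%:E)%E.
  rewrite -[leRHS](expeRK) lee_lne// in_itv/= ?q0 ?leey//.
  by rewrite lee_fin expR_ge0.
move=> /(@lee_wpmul2l _ eps%:E); rewrite lee_fin ltW// => /(_ isT) /le_trans; apply.
by rewrite -EFinM lee_fin mulrC divfK// gt_eqF.
Qed.

Lemma gee_eps_lne (eps c : R) (q : \bar R) : 0 < eps ->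
  ((expR (c / eps))%:E <= q)%E -> (c%:E <= eps%:E * lne q)%E.
Proof.
move=> e0 qc; have q0 : (0 <= q)%E by apply: le_trans qc; rewrite lee_fin expR_ge0.
have : ((c / eps)%:E <= lne q)%E.
  rewrite -[leLHS](expeRK) lee_lne// in_itv/= ?q0 ?leey//.
  by rewrite lee_fin expR_ge0.
move=> /(@lee_wpmul2l _ eps%:E); rewrite lee_fin ltW// => /(_ isT); apply: le_trans.
by rewrite -EFinM lee_fin [leRHS]mulrC divfK// gt_eqF.
Qed.

(** For a Borel set, apply the upper bound to the closure and the lower bound to
   the interior, then let [delta] tend to [0]. *)
Lemma ldp_of_bounds {E : topologicalType} (Y : R -> T -> E) (I : E -> \bar R) :
  (forall eps, 0 < eps -> borel_measurable (Y eps)) ->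
  ldp_upper Y I -> ldp_lower Y I -> satisfies_LDP Q Y I.
Proof.
move=> mY ub lb Gamma bG rate.
have mo eps (U : set E) : 0 < eps -> open U -> measurable (Y eps @^-1` U).
  by move=> e0; apply: borel_measurable_open; exact: mY.
have mc eps (U : set E) : 0 < eps -> closed U -> measurable (Y eps @^-1` U).
  by move=> e0; apply: borel_measurable_closed; exact: mY.
have sub eps : 0 < eps -> (Q (Y eps @^-1` interior Gamma) <= Q (Y eps @^-1` Gamma)
    /\ Q (Y eps @^-1` Gamma) <= Q (Y eps @^-1` closure Gamma))%E.
  move=> e0; split; apply: le_measure; rewrite ?inE.
  - exact: (mo _ _ e0 (open_interior _)).
  - exact: mY.
  - by move=> w /=; exact: interior_subset.
  - exact: mY.
  - exact: (mc _ _ e0 (@closed_closure _ Gamma)).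
  - by move=> w /=; exact: subset_closure.
split; [|exact: limf_einf_le_esup|].
- rewrite leeNl; apply: le_ereal_inf_tmp => _ [y Gy <-].
  rewrite leeNl; apply: leNe_real => beta Ib.
  apply/lee_addgt0Pr => delta d0; rewrite -leeBlDr// -EFinB.
  apply: limf_einf_ge_near.
  have e0 : \forall eps \near (0:R)^'+, 0 < eps by exact: nbhs_right_gt.
  near=> eps; apply: gee_eps_lne; first by near: eps.
  have /sub[+ _] : 0 < eps by near: eps.
  apply: le_trans; rewrite -opprD.
  by near: eps; apply: lb Gy _ => //; exact: open_interior.
- apply: lee_Nreal => alpha aI.
  apply/lee_addgt0Pr => delta d0; rewrite -EFinD.
  apply: limf_esup_le_near.
  have Ia y : closure Gamma y -> (alpha%:E < I y)%E.
    by move=> Gy; apply: (lt_le_trans aI); apply: ereal_inf_lbound; exists y.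
  have e0 : \forall eps \near (0:R)^'+, 0 < eps by exact: nbhs_right_gt.
  near=> eps; apply: lee_eps_lne => //.
  have /sub[_ /le_trans] : 0 < eps by near: eps.
  apply.
  rewrite (_ : - alpha + delta = - (alpha - delta)); last by ring.
  by near: eps; exact: (ub _ (@closed_closure _ Gamma)).
Unshelve. all: by end_near. Qed.

End ExponentialForm.

(** * Exponential moments *)

Section ExpMoments.
Context {R : realType} d {T : measurableType d} (Q : probability T R).

Lemma le_measure_ae (A B : set T) : measurable A -> measurable B ->
  {ae Q, forall w, A w -> B w} -> (Q A <= Q B)%E.
Proof.
move=> mA mB [N [mN N0 AB]]; apply: (@le_trans _ _ (Q (B `|` N))).
  apply: le_measure; rewrite ?inE//; first exact: measurableU.
  move=> w Aw; have [Bw|nBw] := pselect (B w); [by left|right].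
  by apply: AB => /= h; exact/nBw/h.
by apply: (le_trans (measureU2 _ mB mN)); move: N0 => /= N0; rewrite -[leRHS]adde0 leeD2l// -N0.
Qed.

Lemma integral_probability_cst (c : R) : (\int[Q]_w c%:E)%E = c%:E.
Proof.
rewrite integral_cst// -[RHS]mule1; congr (_ * _)%E; exact: probability_setT.
Qed.

Lemma borel_measurable_comp {E : topologicalType} (Y : T -> E) (h : E -> R) :
  borel_measurable Y -> continuous h -> measurable_fun [set: T] (h \o Y).
Proof.
move=> mY ch; apply: (measurability _ (RGenOInfty.measurableE R)).
move=> _ [_ [r ->] <-]; rewrite setTI comp_preimage; apply: mY.
apply: sub_sigma_algebra => /=; move/continuousP : ch; apply.
exact: interval_open.
Qed.

Lemma dotv_continuous n (lam : 'rV[R]_n) : continuous (dotv lam).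
Proof.
move=> z; have c i : {for z, continuous (fun w : 'rV[R]_n => lam 0 i * w 0 i)}.
  by apply: continuousM; [exact: cst_continuous|exact: coord_continuous].
apply: cvg_big; [exact: add_continuous|exact: (nbhs_filter z)|move=> i _].
exact: c.
Qed.

Lemma open_halfspace n (lam : 'rV[R]_n) (c : R) : open [set z | c < dotv lam z].
Proof.
by move/continuousP: (@dotv_continuous _ lam) => /(_ _ (@open_gt _ c)).
Qed.

Lemma dotvC n (u v : 'rV[R]_n) : dotv u v = dotv v u.
Proof. by apply: eq_bigr => i _; rewrite mulrC. Qed.

Lemma dotvDl n (u v w : 'rV[R]_n) : dotv (u + v) w = dotv u w + dotv v w.
Proof. by rewrite /dotv -big_split; apply: eq_bigr => i _; rewrite !mxE mulrDl. Qed.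

Lemma dotvZl n (t : R) (u w : 'rV[R]_n) : dotv (t *: u) w = t * dotv u w.
Proof. by rewrite /dotv mulr_sumr; apply: eq_bigr => i _; rewrite !mxE mulrA. Qed.

Lemma dotv_deltal n (i : 'I_n) (w : 'rV[R]_n) : dotv (delta_mx 0 i) w = w 0 i.
Proof.
rewrite /dotv (bigD1 i)//= mxE !eqxx mul1r big1 ?addr0// => j ji.
by rewrite mxE (negbTE ji) andbF mul0r.
Qed.

Lemma dotv0l n (w : 'rV[R]_n) : dotv 0 w = 0.
Proof. by rewrite /dotv big1// => i _; rewrite mxE mul0r. Qed.

(** The moment generating function of [Y] at [lam / eps]. *)
Definition scaled_mgf n (Y : T -> 'rV[R]_n) (eps : R) (lam : 'rV[R]_n) : \bar R :=
  (\int[Q]_w (expR (dotv lam (Y w) / eps))%:E)%E.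

Lemma scaled_mgfE n (Y : T -> 'rV[R]_n) (eps : R) (lam : 'rV[R]_n) :
  log_mgf Q (fun w => dotv lam (Y w)) eps^-1 = lne (scaled_mgf Y eps lam).
Proof. by rewrite /log_mgf /mmt_gen_fun unlock. Qed.

Lemma scaled_mgf_ge0 n (Y : T -> 'rV[R]_n) (eps : R) (lam : 'rV[R]_n) :
  (0 <= scaled_mgf Y eps lam)%E.
Proof. by apply: integral_ge0 => w _; rewrite lee_fin expR_ge0. Qed.

Lemma le_expR_of_lne (q : \bar R) (c : R) :
  (0 <= q)%E -> (lne q <= c%:E)%E -> (q <= (expR c)%:E)%E.
Proof.
move=> q0 qc; have /eqP <- : expeR (lne q) == q by rewrite lneK_eq.
by rewrite -/(expeR c%:E) lee_expeR.
Qed.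

Lemma ge_expR_of_lne (q : \bar R) (c : R) :
  (0 <= q)%E -> (c%:E <= lne q)%E -> ((expR c)%:E <= q)%E.
Proof.
move=> q0 qc; have /eqP <- : expeR (lne q) == q by rewrite lneK_eq.
by rewrite -/(expeR c%:E) lee_expeR.
Qed.

Lemma expR_eventually_ge (c M : R) : 0 < c ->
  \forall eps \near 0^'+, M <= expR (c / eps).
Proof.
move=> c0; near=> eps.
have e0 : 0 < eps by near: eps; exact: nbhs_right_gt.
have : eps < c / (`|M| + 1) by near: eps; apply: nbhs_right_lt; rewrite divr_gt0.
rewrite ltr_pdivlMr// mulrC -ltr_pdivlMr// => h.
apply: le_trans (expR_ge1Dx _); have := ler_norm M; lra.
Unshelve. all: by end_near. Qed.

(** Chernoff bound for the half-space [c < lam . z]. *)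
Lemma chernoff_dotv n (Y : T -> 'rV[R]_n) (eps c : R) (lam : 'rV[R]_n) : 0 < eps ->
  borel_measurable Y ->
  (Q (Y @^-1` [set z | (c < dotv lam z)%R])
    <= scaled_mgf Y eps lam * (expR (- (c / eps)))%:E)%E.
Proof.
move=> e0 mY.
have mX := borel_measurable_comp mY (@dotv_continuous _ lam).
pose X : {RV Q >-> R} := mfun_Sub (mem_set mX).
have /(@chernoff _ _ _ Q X _ c) : 0 < eps^-1 by rewrite invr_gt0.
rewrite /mmt_gen_fun unlock mulrC; apply: le_trans; apply: le_measure; rewrite ?inE.
- by apply: borel_measurable_open => //; exact: open_halfspace.
- rewrite -[X in measurable X]setTI; exact: measurable_fun_le.
- by move=> w /= /ltW.
Qed.

End ExpMoments.

(** * The Gartner-Ellis upper bound *)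

Section GartnerEllis.
Context {R : realType} d {T : measurableType d} (Q : probability T R).
Context {n : nat} (Y : R -> T -> 'rV[R]_n.+1) (L : 'rV[R]_n.+1 -> R).
Hypothesis mY : forall eps, 0 < eps -> borel_measurable (Y eps).
Hypothesis mgf_cvg : forall lam,
  (eps%:E * log_mgf Q (fun w => dotv lam (Y eps w)) eps^-1)%E @[eps --> 0^'+]
    --> (L lam)%:E.

(** The limit hypothesis in exponential form. *)
Lemma scaled_mgf_near lam delta : 0 < delta -> \forall eps \near 0^'+,
  ((expR ((L lam - delta) / eps))%:E <= scaled_mgf Q (Y eps) eps lam
    <= (expR ((L lam + delta) / eps))%:E)%E.
Proof.
move=> d0; have e0 : \forall eps \near (0:R)^'+, 0 < eps by exact: nbhs_right_gt.
have mgf_cvg' : (eps%:E * lne (scaled_mgf Q (Y eps) eps lam))%E @[eps --> 0^'+]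
    --> (L lam)%:E.
  by under eq_fun do rewrite -scaled_mgfE; exact: mgf_cvg.
have up : \forall eps \near (0:R)^'+,
    (eps%:E * lne (scaled_mgf Q (Y eps) eps lam) < (L lam + delta)%:E)%E.
  apply: (mgf_cvg' [set q | (q < (L lam + delta)%:E)%E]).
  apply: open_nbhs_nbhs; split; first exact: open_ereal_lt_ereal.
  by rewrite /= lte_fin ltrDl.
have lo : \forall eps \near (0:R)^'+,
    ((L lam - delta)%:E < eps%:E * lne (scaled_mgf Q (Y eps) eps lam))%E.
  apply: (mgf_cvg' [set q | ((L lam - delta)%:E < q)%E]).
  apply: open_nbhs_nbhs; split; first exact: open_ereal_gt_ereal.
  by rewrite /= lte_fin ltrBlDr ltrDl.
near=> eps.
have eps0 : 0 < eps by near: eps.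
apply/andP; split.
- apply: ge_expR_of_lne; first exact: scaled_mgf_ge0.
  rewrite mulrC EFinM lee_pdivrMl//; apply: ltW; near: eps; exact: lo.
- apply: le_expR_of_lne; first exact: scaled_mgf_ge0.
  rewrite mulrC EFinM lee_pdivlMl//; apply: ltW; near: eps; exact: up.
Unshelve. all: by end_near. Qed.

Lemma cumulant0 : L 0 = 0.
Proof.
have : (fun eps => (eps%:E * log_mgf Q (fun w => dotv 0 (Y eps w)) eps^-1)%E)
    = (fun=> 0%:E).
  apply/funext => eps; rewrite scaled_mgfE /scaled_mgf.
  under eq_integral do rewrite dotv0l mul0r expR0.
  by rewrite integral_probability_cst lne1 mule0.
move=> h; have := @mgf_cvg 0; rewrite h => h0; apply: EFin_inj.
move/cvg_lim : h0 => <- //; rewrite lim_cst//.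
Qed.

Lemma fenchel_legendre_ge lam z : ((dotv lam z - L lam)%:E <= fenchel_legendre L z)%E.
Proof. by apply: ereal_sup_ubound; exists lam. Qed.

Lemma ldp_upper_half_spaces (s : seq 'rV[R]_n.+1) (alpha delta : R) : 0 < delta ->
  \forall eps \near 0^'+,
    (Q (Y eps @^-1` \bigcup_(lam in [set` s]) [set z | (alpha + L lam < dotv lam z)%R])
      <= (expR (- (alpha - delta) / eps))%:E)%E.
Proof.
elim: s delta => [|lam s ih] delta d0.
  by near=> eps; rewrite set_nil bigcup_set0 preimage_set0 measure0 lee_fin expR_ge0.
have d20 : 0 < delta / 2 by lra.
have d30 : 0 < delta / 4 by lra.
have e0 : \forall eps \near (0:R)^'+, 0 < eps by exact: nbhs_right_gt.
near=> eps.
have eps0 : 0 < eps by near: eps.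
have mo (U : set 'rV[R]_n.+1) : open U -> measurable (Y eps @^-1` U).
  by apply: borel_measurable_open; exact: mY.
rewrite bigcup_seq big_cons -bigcup_seq preimage_setU.
apply: (le_trans (measureU2 _ _ _)).
- by apply: mo; exact: open_halfspace.
- by apply: mo; apply: bigcup_open => i _; exact: open_halfspace.
have h1 : (Q (Y eps @^-1` [set z | (alpha + L lam < dotv lam z)%R])
    <= (expR (- (alpha - delta / 2) / eps))%:E)%E.
  apply: (@le_trans _ _ (scaled_mgf Q (Y eps) eps lam * (expR (- ((alpha + L lam) / eps)))%:E)%E).
    by apply: chernoff_dotv => //; exact: mY.
  have /andP[_ h] : ((expR ((L lam - delta / 2) / eps))%:E
    <= scaled_mgf Q (Y eps) eps lam <= (expR ((L lam + delta / 2) / eps))%:E)%E.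
    by near: eps; exact: scaled_mgf_near.
  apply: (le_trans (lee_wpmul2r _ h)); first by rewrite lee_fin expR_ge0.
  rewrite -EFinM -expRD lee_fin ler_expR -mulNr -mulrDl ler_pM2r ?invr_gt0//; lra.
have h2 : (Q (Y eps @^-1` \bigcup_(lam in [set` s])
       [set z | (alpha + L lam < dotv lam z)%R])
    <= (expR (- (alpha - delta / 2) / eps))%:E)%E by near: eps; exact: ih.
apply: (le_trans (leeD h1 h2)).
have h3 : 2 <= expR ((delta / 2) / eps) by near: eps; exact: expR_eventually_ge.
rewrite -EFinD lee_fin; apply: (@le_trans _ _ (2 * expR (- (alpha - delta / 2) / eps))).
  by rewrite mulr_natl mulr2n.
apply: (le_trans (ler_wpM2r (expR_ge0 _) h3)).
rewrite -expRD ler_expR -mulrDl ler_pM2r ?invr_gt0//; lra.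
Unshelve. all: by end_near. Qed.

Variable C : R.
Hypothesis bY : forall eps, 0 < eps -> {ae Q, forall w, `|Y eps w| <= C}.

(** Compact sets are covered by finitely many half-spaces; as [Y eps] stays in
   a fixed ball, closed sets reduce to compact ones. *)
Lemma ldp_upper_gartner_ellis : ldp_upper Q Y (fenchel_legendre L).
Proof.
move=> F cF alpha delta d0 hF.
pose K := F `&` [set z : 'rV[R]_n.+1 | `|z| <= C].
have cK : compact K.
  apply: bounded_closed_compact.
    exists C; split; first exact: num_real.
    by move=> M CM z [_ /= zC]; exact: (le_trans zC (ltW CM)).
  apply: closedI => //; apply: (@closed_comp _ _ (fun z : 'rV[R]_n.+1 => `|z|) [set x | x <= C]).
    by move=> z _; exact: norm_continuous.
  exact: closed_le.
pose H (lam : 'rV[R]_n.+1) := [set z | (alpha + L lam < dotv lam z)%R].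
move: cK; rewrite compact_cover => /(_ _ setT H) [lam _| |D _ KD].
- exact: open_halfspace.
- move=> z [/hF + _] => /ereal_sup_gt[_ [lam _ <-]]; rewrite lte_fin => hl.
  by exists lam => //; rewrite /H /= -ltrBrDr.
have hn := ldp_upper_half_spaces (finmap.enum_fset D) alpha d0.
have e0 : \forall eps \near (0:R)^'+, 0 < eps by exact: nbhs_right_gt.
near=> eps.
have eps0 : 0 < eps by near: eps.
have mo (U : set 'rV[R]_n.+1) : open U -> measurable (Y eps @^-1` U).
  by apply: borel_measurable_open; exact: mY.
have mF : measurable (Y eps @^-1` F).
  by apply: borel_measurable_closed => //; exact: mY.
have hD : (Q (Y eps @^-1` \bigcup_(lam in [set` finmap.enum_fset D]) H lam)
    <= (expR (- (alpha - delta) / eps))%:E)%E by near: eps; exact: hn.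
apply: le_trans hD.
apply: le_measure_ae => //.
  by apply: mo; apply: bigcup_open => lam _; exact: open_halfspace.
by apply: filterS (bY eps0) => w Yw Fw; apply: KD; split.
Unshelve. all: by end_near. Qed.

End GartnerEllis.

(** * The Gartner-Ellis lower bound *)

Section LowerBound.
Context {R : realType} d {T : measurableType d} (Q : probability T R).
Context {n : nat} (Y : R -> T -> 'rV[R]_n.+1) (L : 'rV[R]_n.+1 -> R).
Hypothesis mY : forall eps, 0 < eps -> borel_measurable (Y eps).
Hypothesis mgf_cvg : forall lam,
  (eps%:E * log_mgf Q (fun w => dotv lam (Y eps w)) eps^-1)%E @[eps --> 0^'+]
    --> (L lam)%:E.
Variable D : 'rV[R]_n.+1 -> 'I_n.+1 -> R.
Hypothesis dL : forall lam i, is_derive lam (delta_mx 0 i : 'rV[R]_n.+1) L (D lam i).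
Hypothesis cL : continuous L.

Lemma is_derive_near0 (lam e : 'rV[R]_n.+1) (c kappa : R) : 0 < kappa ->
  is_derive lam e L c ->
  \forall t \near 0^', `|L (lam + t *: e) - L lam - t * c| <= kappa * `|t|.
Proof.
move=> k0 [dv <-].
have /cvgrPdist_le /(_ _ k0) : h^-1 *: ((L \o shift lam) (h *: e) - L lam) @[h --> 0^']
    --> 'D_e L lam by exact: dv.
apply: filterS2 (nbhs_dnbhs_neq 0) => t t0 /=.
set q := t^-1 *: _ => hq.
have -> : L (lam + t *: e) - L lam = t * q.
  have -> : q = t^-1 * (L (t *: e + lam) - L lam) by [].
  by rewrite mulrA divff// mul1r [t *: e + lam]addrC.
by rewrite -mulrBr normrM distrC mulrC ler_wpM2r.
Qed.

(** One-sided first-order upper bounds in both directions [e_i] and [- e_i]. *)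
Lemma directional_upper (lam : 'rV[R]_n.+1) (i : 'I_n.+1) (kappa : R) : 0 < kappa ->
  \forall t \near 0^'+, forall b : bool,
    L (lam + (if b then t else - t) *: delta_mx 0 i)
      <= L lam + (if b then t else - t) * D lam i + kappa * t.
Proof.
move=> k0; have := is_derive_near0 k0 (dL lam i).
rewrite /dnbhs /within /= => /nbhs_ballP[e /= e0 he].
have t0n : \forall t \near (0:R)^'+, 0 < t by exact: nbhs_right_gt.
have ten : \forall t \near (0:R)^'+, t < e by exact: nbhs_right_lt.
near=> t.
have t0 : 0 < t by near: t.
have te : t < e by near: t.
case.
- have := he t; rewrite /ball /= sub0r normrN gtr0_norm// => /(_ te (lt0r_neq0 t0)).
  by rewrite ler_norml; lra.
- have := he (- t); rewrite /ball /= sub0r opprK normrN gtr0_norm//.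
  rewrite oppr_eq0 => /(_ te); rewrite gt_eqF// => /(_ isT).
  by rewrite ler_norml; lra.
Unshelve. all: by end_near. Qed.

Let grad lam : 'rV[R]_n.+1 := \row_i D lam i.

Let not_ball (y z : 'rV[R]_n.+1) (r : R) : 0 < r -> ~ ball y r z ->
  exists i, r <= `|z 0 i - y 0 i|.
Proof.
move=> r0 nb; apply: contrapT => h; apply: nb; split => // i j.
rewrite ord1 /ball /= distrC ltNge; apply/negP => hj; apply: h; by exists j.
Qed.

Let in_ball (y z : 'rV[R]_n.+1) (r : R) : ball y r z ->
  forall i, `|z 0 i - y 0 i| < r.
Proof. by case=> _ h i; have := h 0 i; rewrite /ball /= distrC. Qed.

Let dotv_ball (eta y z : 'rV[R]_n.+1) (r : R) : ball y r z ->
  dotv eta z <= dotv eta y + (\sum_i `|eta 0 i|) * r.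
Proof.
move=> /in_ball h; rewrite /dotv mulr_suml -big_split /=; apply: ler_sum => i _.
rewrite -lerBlDl -mulrBr; apply: (le_trans (ler_norm _)); rewrite normrM.
by rewrite ler_wpM2l// ltW.
Qed.

(** The weight [exp (eta . z / eps)] is dominated by its value near [y] on the
   ball, and outside by one of the [2 (n + 1)] exponentials below. *)
Let exp_split (eta y z : 'rV[R]_n.+1) (r t c eps : R) : 0 < r -> 0 < t -> 0 < eps ->
  (ball y r z -> dotv eta z <= c) ->
  expR (dotv eta z / eps) <= expR (c / eps) * \1_(ball y r) z
    + \sum_(k : 'I_n.+1 * bool)
        expR (dotv (eta + (if k.2 then t else - t) *: delta_mx 0 k.1) z / eps)
        * expR (- ((if k.2 then t else - t) * y 0 k.1 + t * r) / eps).
Proof.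
move=> r0 t0 e0 hc.
have sum0 (P : pred _) : 0 <= \sum_(k : 'I_n.+1 * bool | P k)
        expR (dotv (eta + (if k.2 then t else - t) *: delta_mx 0 k.1) z / eps)
        * expR (- ((if k.2 then t else - t) * y 0 k.1 + t * r) / eps).
  by apply: sumr_ge0 => k _; rewrite mulr_ge0// expR_ge0.
have [zb|zb] := pselect (ball y r z).
  rewrite indicE mem_set//= mulr1 -[leLHS]addr0 lerD//.
  by rewrite ler_expR ler_pM2r ?invr_gt0//; exact: hc.
rewrite indicE memNset//= mulr0 add0r.
have [i hi] := not_ball r0 zb.
rewrite (bigD1 (i, y 0 i <= z 0 i))//= -[leLHS]addr0 lerD//.
rewrite -expRD ler_expR -mulrDl ler_pM2r ?invr_gt0//.
rewrite dotvDl dotvZl dotv_deltal.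
have [yz|yz] := leP (y 0 i) (z 0 i); move: hi.
  rewrite ger0_norm ?subr_ge0// => /(ler_wpM2l (ltW t0)); lra.
rewrite ltr0_norm ?subr_lt0// => /(ler_wpM2l (ltW t0)); lra.
Qed.

(** Lower bound at the gradient point [grad eta], where the rate is
   [eta . grad eta - L eta]. By [exp_split], the moment at [eta] is at most
   [exp ((eta . y + delta / 2) / eps)] times the probability of the ball, plus
   moments at [eta + t e_i] and [eta - t e_i]; since [y] is the gradient, the
   first-order terms in [t] cancel and these are exponentially smaller. *)
Lemma ldp_lower_gradient (eta : 'rV[R]_n.+1) (r delta : R) : 0 < r -> 0 < delta ->
  \forall eps \near 0^'+,
    ((expR (- (dotv eta (grad eta) - L eta + delta) / eps))%:E
      <= Q (Y eps @^-1` ball (grad eta) r))%E.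
Proof.
move=> r0 d0; set y := grad eta.
pose S := \sum_i `|eta 0 i|.
have S0 : 0 <= S by apply: sumr_ge0.
(* Shrinking the radius keeps the variation of [eta . z] on the ball below
   [delta / 2]. *)
pose r' := Num.min r (delta / 2 / (S + 1)).
have r'0 : 0 < r' by rewrite lt_min r0 !divr_gt0// ltr_wpDl.
have r'S : S * r' <= delta / 2.
  have : r' * (S + 1) <= delta / 2.
    by rewrite -ler_pdivlMr ?ltr_wpDl// ge_min lexx orbT.
  by nra.
have [t [t0 td ht]] : exists t : R, [/\ 0 < t, t * r' <= delta / 2 & forall i (b : bool),
    L (eta + (if b then t else - t) *: delta_mx 0 i)
      <= L eta + (if b then t else - t) * D eta i + (r' / 4) * t].
  have h0 : \forall t \near (0:R)^'+, 0 < t by exact: nbhs_right_gt.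
  have h1 : \forall t \near (0:R)^'+, t < delta / 2 / r'.
    by apply: nbhs_right_lt; rewrite !divr_gt0.
  have h2 : \forall t \near (0:R)^'+, forall i (b : bool),
    L (eta + (if b then t else - t) *: delta_mx 0 i)
      <= L eta + (if b then t else - t) * D eta i + (r' / 4) * t.
    by apply: filter_forall => i; apply: directional_upper; rewrite divr_gt0.
  have [t [[t0 t1] t2]] := filter_ex (filterI (filterI h0 h1) h2).
  by exists t; split => //; rewrite -ler_pdivlMr// ltW.
pose lam (k : 'I_n.+1 * bool) := eta + (if k.2 then t else - t) *: delta_mx 0 k.1.
pose cst eps (k : 'I_n.+1 * bool) :=
  expR (- ((if k.2 then t else - t) * y 0 k.1 + t * r') / eps).
(* [kap] is the margin by which the moments outside the ball are smaller. *)
pose kap := t * r' / 4.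
have k0 : 0 < kap by rewrite /kap divr_gt0// mulr_gt0.
have e0n : \forall eps \near (0:R)^'+, 0 < eps by exact: nbhs_right_gt.
have hMn := scaled_mgf_near mgf_cvg eta k0.
have hkn : \forall eps \near (0:R)^'+, forall k,
    ((expR ((L (lam k) - kap) / eps))%:E <= scaled_mgf Q (Y eps) eps (lam k)
    <= (expR ((L (lam k) + kap) / eps))%:E)%E.
  by apply: filter_forall => k; exact: scaled_mgf_near.
pose N : R := #|{: 'I_n.+1 * bool}|%:R.
have hNn : \forall eps \near (0:R)^'+, 2 * N <= expR (kap / eps).
  exact: expR_eventually_ge.
have h2n : \forall eps \near (0:R)^'+, 2 <= expR ((delta / 4) / eps).
  by apply: expR_eventually_ge; rewrite divr_gt0.
near=> eps.
have e0 : 0 < eps by near: eps.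
have hN : 2 * N <= expR (kap / eps) by near: eps.
have h2 : 2 <= expR ((delta / 4) / eps) by near: eps.
have hM : ((expR ((L eta - kap) / eps))%:E <= scaled_mgf Q (Y eps) eps eta)%E.
  by have /andP[] : ((expR ((L eta - kap) / eps))%:E <= scaled_mgf Q (Y eps) eps eta
    <= (expR ((L eta + kap) / eps))%:E)%E by near: eps.
have hk k : (scaled_mgf Q (Y eps) eps (lam k)
    <= (expR ((L (lam k) + kap) / eps))%:E)%E.
  by move: k; near: eps; apply: filterS hkn => eps hk k; have /andP[] := hk k.
pose B := Y eps @^-1` ball y r'.
have mo (U : set 'rV[R]_n.+1) : open U -> measurable (Y eps @^-1` U).
  by apply: borel_measurable_open; exact: mY.
have mB : measurable B by apply: mo; exact: ball_open.
have mexp l : measurable_fun [set: T] (fun w => (expR (dotv l (Y eps w) / eps))%:E).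
  apply/measurable_EFinP; apply: measurableT_comp => //.
  apply: measurable_funM => //.
  exact: (borel_measurable_comp (mY e0) (@dotv_continuous _ _ l)).
pose c := dotv eta y + delta / 2.
have c0 w : (0 <= (expR (c / eps))%:E * (\1_B w : R)%:E)%E.
  by rewrite -EFinM lee_fin mulr_ge0 ?expR_ge0.
have g0 (k : 'I_n.+1 * bool) w :
    (0 <= (expR (dotv (lam k) (Y eps w) / eps))%:E * (cst eps k)%:E)%E.
  by rewrite -EFinM lee_fin mulr_ge0 ?expR_ge0.
have m1B : measurable_fun [set: T] (fun w => (\1_B w : R)%:E).
  by apply/measurable_EFinP; exact: measurable_indic.
have mc : measurable_fun [set: T]
    (fun w => (expR (c / eps))%:E * (\1_B w : R)%:E)%E.
  exact: emeasurable_funM.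
have mg (k : 'I_n.+1 * bool) : measurable_fun [set: T]
    (fun w => (expR (dotv (lam k) (Y eps w) / eps))%:E * (cst eps k)%:E)%E.
  exact: emeasurable_funM.
have msg : measurable_fun [set: T] (fun w => \sum_(k : 'I_n.+1 * bool)
    (expR (dotv (lam k) (Y eps w) / eps))%:E * (cst eps k)%:E)%E.
  exact: emeasurable_sum.
have key : (scaled_mgf Q (Y eps) eps eta <= (expR (c / eps))%:E * Q B
    + \sum_(k : 'I_n.+1 * bool) scaled_mgf Q (Y eps) eps (lam k) * (cst eps k)%:E)%E.
  have -> : ((expR (c / eps))%:E * Q B
    + \sum_(k : 'I_n.+1 * bool) scaled_mgf Q (Y eps) eps (lam k) * (cst eps k)%:E)%E
   = (\int[Q]_w ((expR (c / eps))%:E * (\1_B w)%:E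
      + \sum_(k : 'I_n.+1 * bool)
        (expR (dotv (lam k) (Y eps w) / eps))%:E * (cst eps k)%:E))%E.
    rewrite ge0_integralD//=.
    2: by move=> w _; apply: sume_ge0 => k _; exact: g0.
    congr (adde _ _).
      rewrite ge0_integralZl//.
      by rewrite integral_indic// setIT.
    rewrite ge0_integral_sum//.
    apply: eq_bigr => k _; rewrite ge0_integralZr//; last by rewrite lee_fin expR_ge0.
  apply: ge0_le_integral => //; first exact: emeasurable_funD.
  move=> w _; under eq_bigr do rewrite -EFinM.
  rewrite sumEFin -EFinM -EFinD lee_fin.
  apply: (@exp_split eta y (Y eps w) r' t c eps) => // hb.
  by apply: (le_trans (dotv_ball _ hb)); rewrite /c lerD2l.
have QB_fin : Q B \is a fin_num by exact: fin_num_measure.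
have QB_le : (Q B <= Q (Y eps @^-1` ball y r))%E.
  apply: le_measure; rewrite ?inE//; first by apply: mo; exact: ball_open.
  by move=> w; apply: le_ball; rewrite ge_min lexx.
apply: le_trans QB_le; rewrite -(fineK QB_fin) lee_fin.
pose M0 := expR ((L eta - kap) / eps).
have sumle : (\sum_(k : 'I_n.+1 * bool) scaled_mgf Q (Y eps) eps (lam k) * (cst eps k)%:E
    <= (M0 / 2)%:E)%E.
  apply: (@le_trans _ _ (\sum_(k : 'I_n.+1 * bool) (M0 * expR (- (kap / eps)))%:E)%E).
    apply: lee_sum => k _.
    apply: (le_trans (lee_wpmul2r _ (hk k))); first by rewrite lee_fin expR_ge0.
    rewrite -EFinM lee_fin /M0 -!expRD ler_expR -[- (kap / eps)]mulNr -!mulrDl.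
    rewrite ler_pM2r ?invr_gt0//.
    have := ht k.1 k.2; rewrite /kap /lam /y /grad mxE.
    by set a1 := L (eta + _); set b1 := (if _ then _ else _) * _; move: a1 b1 => a1 b1; lra.
  rewrite sumEFin lee_fin sumr_const expRN.
  have -> (q : R) : q *+ #|[pred k : 'I_n.+1 * bool | true]| = N * q.
    by rewrite /N mulr_natl.
  rewrite mulrCA ler_pM2l ?expR_gt0// ler_pdivrMr ?expR_gt0//; lra.
have : M0 <= expR (c / eps) * fine (Q B) + M0 / 2.
  rewrite -lee_fin EFinD EFinM fineK//; apply: (le_trans hM); apply: (le_trans key).
  by rewrite leeD2l.
have -> : expR (- (dotv eta y - L eta + delta) / eps)
    = M0 * expR ((kap - delta / 2) / eps) / expR (c / eps).
  rewrite /M0 -expRN -!expRD; congr expR; rewrite /c; field.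
  exact: lt0r_neq0.
rewrite ler_pdivrMr ?expR_gt0//.
have : expR ((kap - delta / 2) / eps) <= 2^-1.
  rewrite -[leLHS]invrK -expRN lef_pV2 ?posrE ?expR_gt0//.
  apply: (le_trans h2); rewrite ler_expR -mulNr ler_pM2r ?invr_gt0//.
  rewrite /kap; lra.
move=> /(ler_wpM2l (expR_ge0 ((L eta - kap) / eps))); rewrite -/M0; lra.
Unshelve. all: by end_near. Qed.

Let L0 : L 0 = 0 := cumulant0 mgf_cvg.

Let sq_continuous : continuous (fun lam : 'rV[R]_n.+1 => dotv lam lam).
Proof.
move=> z; have c i : {for z, continuous (fun w : 'rV[R]_n.+1 => w 0 i * w 0 i)}.
  by apply: continuousM; exact: coord_continuous.
apply: cvg_big; [exact: add_continuous|exact: (nbhs_filter z)|move=> i _].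
exact: c.
Qed.

Let dotv_diag_ge (lam : 'rV[R]_n.+1) i : lam 0 i ^+ 2 <= dotv lam lam.
Proof.
rewrite /dotv (bigD1 i)//= expr2 lerDl; apply: sumr_ge0 => j _.
by rewrite -expr2 sqr_ge0.
Qed.

Let dotv_sq_line (lam : 'rV[R]_n.+1) (i : 'I_n.+1) (s : R) :
  dotv (lam + s *: delta_mx 0 i) (lam + s *: delta_mx 0 i)
    = dotv lam lam + 2 * s * lam 0 i + s * s.
Proof.
rewrite dotvDl dotvZl dotv_deltal dotvC dotvDl dotvZl dotv_deltal !mxE !eqxx /=.
by ring.
Qed.

(** Maximizing [lam . y - L lam - delta / 2 |lam|^2] yields gradient points
   arbitrarily close to [y] whose rate does not exceed that of [y]. *)
Lemma gradient_approximation (y : 'rV[R]_n.+1) (beta rho : R) : 0 < rho ->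
  (fenchel_legendre L y <= beta%:E)%E ->
  exists eta, ball y rho (grad eta) /\ dotv eta (grad eta) - L eta <= beta.
Proof.
move=> rho0 yb.
have yL lam : dotv lam y - L lam <= beta.
  by rewrite -lee_fin; apply: le_trans yb; exact: fenchel_legendre_ge.
have b0 : 0 <= beta by have := yL 0; rewrite dotv0l L0 subrr.
(* With this [del], the maximizer satisfies [del |eta| < rho], which is the
   distance from [y] to [grad eta]. *)
pose del := rho ^+ 2 / (2 * (beta + 1)).
have del0 : 0 < del by rewrite divr_gt0 ?exprn_gt0// mulr_gt0// ltr_wpDl.
pose psi lam := dotv lam y - L lam - del / 2 * dotv lam lam.
have psi0 : psi 0 = 0 by rewrite /psi !dotv0l L0 mulr0 !subr0.
have cpsi : continuous psi.
  have c1 : continuous (fun x : 'rV[R]_n.+1 => dotv x y).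
    have -> : (fun x : 'rV[R]_n.+1 => dotv x y) = dotv y.
      by apply/funext => x; rewrite dotvC.
    exact: dotv_continuous.
  move=> z; have c2 : {for z, continuous (fun x => del / 2 * dotv x x)}.
    by apply: continuousM; [exact: cst_continuous|exact: sq_continuous].
  exact: (continuousB (continuousB (c1 z) (@cL z)) c2).
(* Outside the box of half-width [r], [psi] is negative. *)
pose r := 1 + 2 * beta / del.
have r1 : 1 <= r by rewrite lerDl; apply: divr_ge0; [exact: mulr_ge0|exact: ltW].
pose A := [set lam : 'rV[R]_n.+1 | forall i, `[- r, r]%classic (lam ord0 i)].
have cA : compact A.
  by apply: (@rV_compact R n.+1 (fun=> `[- r, r]%classic)) => i; exact: segment_compact.
have A0 : A 0 by move=> i; rewrite /= in_itv /= mxE oppr_le0 andbb; lra.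
have [eta _ etamax] : exists2 c, c \in A & forall t, t \in A -> psi t <= psi c.
  apply: EVT_max_rV => //; first by exists 0.
  by apply: continuous_subspaceT => z; exact: cpsi.
have {}etamax lam : psi lam <= psi eta.
  have [lA|lA] := pselect (A lam); first by apply: etamax; rewrite inE.
  apply: (@le_trans _ _ 0); last by rewrite -psi0; apply: etamax; rewrite inE.
  have [i hi] : exists i, r < `|lam 0 i|.
    apply: contrapT => h; apply: lA => i; rewrite /= in_itv /= -ler_norml.
    by rewrite leNgt; apply/negP => hi; apply: h; exists i.
  have h1 : r ^+ 2 <= dotv lam lam.
    apply: le_trans (dotv_diag_ge lam i); rewrite -(real_normK (num_real (lam 0 i))).
    by rewrite !expr2; nra.
  have h2 : r <= r ^+ 2 by rewrite expr2; nra.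
  have h3 : del * (2 * beta / del) = 2 * beta by field; exact: lt0r_neq0.
  have := yL lam; rewrite /psi /r in h2 h1 *; nra.
have grad_eta i : y 0 i - D eta i - del * eta 0 i = 0.
  apply/eqP; rewrite -normr_le0; apply/ler_addgt0Pr => k k0; rewrite add0r.
  have k20 : 0 < k / 2 by rewrite divr_gt0.
  have n1 := directional_upper eta i k20.
  have n2 : \forall t \near (0:R)^'+, 0 < t by exact: nbhs_right_gt.
  have n3 : \forall t \near (0:R)^'+, t < k / del.
    by apply: nbhs_right_lt; rewrite divr_gt0.
  have [t [[t1 t2] t3]] := filter_ex (filterI (filterI n1 n2) n3).
  rewrite ltr_pdivlMr// in t3.
  have key b (s := if b then t else - t) :
      s * (y 0 i - D eta i - del * eta 0 i) <= k * t.
    have := etamax (eta + s *: delta_mx 0 i).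
    rewrite /psi dotv_sq_line dotvDl dotvZl dotv_deltal.
    have := t1 b; rewrite -/s.
    have : s * s = t * t by rewrite /s; case: (b) => //; rewrite mulrNN.
    move: (L _) (L _) => l1 l2; nra.
  have := key true; have := key false; rewrite /= mulNr => h1 h2.
  by rewrite ler_norml; apply/andP; split; nra.
exists eta; split.
- split => // i j; rewrite ord1 /ball /= /grad mxE.
  have -> : y 0 j - D eta j = del * eta 0 j by have := grad_eta j; lra.
  have h1 := dotv_diag_ge eta j.
  have h2 : del / 2 * dotv eta eta <= beta.
    have := etamax 0; rewrite psi0 /psi; have := yL eta; lra.
  rewrite -(ltr_pXn2r (n:=2)) ?nnegrE// ?ltW// (real_normK (num_real _)) exprMn.
  have h3 : del * (2 * (beta + 1)) = rho ^+ 2.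
    by rewrite /del divfK// lt0r_neq0// mulr_gt0// ltr_wpDl.
  rewrite -h3; have : del * (eta 0 j ^+ 2) <= 2 * beta by nra.
  move: (_ ^+ 2) => q; rewrite expr2; nra.
- have -> : dotv eta (grad eta) = dotv eta y - del * dotv eta eta.
    rewrite /dotv mulr_sumr -sumrB; apply: eq_bigr => i _.
    rewrite mxE; have := grad_eta i; move=> h.
    have -> : D eta i = y 0 i - del * eta 0 i by lra.
    ring.
  have : 0 <= dotv eta eta by apply: le_trans (dotv_diag_ge eta ord0); exact: sqr_ge0.
  have := yL eta; nra.
Qed.

Lemma ldp_lower_gartner_ellis : ldp_lower Q Y (fenchel_legendre L).
Proof.
move=> G oG y beta delta d0 Gy yb.
have /nbhs_ballP[rho /= rho0 rhoG] : nbhs y G by exact: open_nbhs_nbhs.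
have rho20 : 0 < rho / 2 by rewrite divr_gt0.
have [eta [yeta etab]] := gradient_approximation rho20 yb.
have h := ldp_lower_gradient eta rho20 d0.
have e0n : \forall eps \near (0:R)^'+, 0 < eps by exact: nbhs_right_gt.
near=> eps.
have e0 : 0 < eps by near: eps.
have mo (U : set 'rV[R]_n.+1) : open U -> measurable (Y eps @^-1` U).
  by apply: borel_measurable_open; exact: mY.
apply: (@le_trans _ _ (Q (Y eps @^-1` ball (grad eta) (rho / 2)))%E); last first.
  apply: le_measure; rewrite ?inE.
  - by apply: mo; exact: ball_open.
  - exact: mo.
  - move=> w /= hw; apply: rhoG; rewrite (splitr rho).
    exact: ball_triangle yeta hw.
apply: (@le_trans _ _ (expR (- (dotv eta (grad eta) - L eta + delta) / eps))%:E).
  rewrite lee_fin ler_expR ler_pM2r ?invr_gt0//; lra.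
by near: eps.
Unshelve. all: by end_near. Qed.

End LowerBound.

(** * The Fenchel-Legendre transform as a rate function *)

Section FenchelLegendre.
Context {R : realType} {n : nat} (L : 'rV[R]_n.+1 -> R).

(** A supremum of continuous functions is lower semicontinuous. *)
Lemma fenchel_legendre_lsc : lower_semicontinuous (fenchel_legendre L).
Proof.
move=> z a /ereal_sup_gt[_ [lam _ <-]]; rewrite lte_fin => alam.
exists [set y | a + L lam < dotv lam y].
  apply: open_nbhs_nbhs; split; first exact: open_halfspace.
  by rewrite /= -ltrBrDr.
move=> y /= hy; apply: lt_le_trans (fenchel_legendre_ge _ lam _).
by rewrite lte_fin ltrBrDr.
Qed.

Hypothesis L0 : L 0 = 0.

Lemma fenchel_legendre_nonneg z : (0 <= fenchel_legendre L z)%E.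
Proof.
by apply: le_trans (fenchel_legendre_ge _ 0 z); rewrite dotv0l L0 subrr.
Qed.

(** Testing the supremum against [e_i] and [- e_i] bounds the sublevel sets. *)
Lemma fenchel_legendre_good : is_good_rate_function (fenchel_legendre L).
Proof.
split; first by split; [exact: fenchel_legendre_lsc|exact: fenchel_legendre_nonneg].
move=> alpha a0.
pose e i : 'rV[R]_n.+1 := delta_mx 0 i.
pose M := alpha + \sum_i (`|L (e i)| + `|L (- e i)|).
pose A := [set v : 'rV[R]_n.+1 | forall i, `[- M, M]%classic (v ord0 i)].
have cA : compact A.
  by apply: (@rV_compact R n.+1 (fun=> `[- M, M]%classic)) => i; exact: segment_compact.
apply: (subclosed_compact _ cA).
  have -> : [set y | (fenchel_legendre L y <= alpha%:E)%E]
      = ~` [set y | (alpha%:E < fenchel_legendre L y)%E].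
    by apply/seteqP; split => y /=; rewrite leNgt => /negP.
  by apply: open_closedC; move/lower_semicontinuousP: fenchel_legendre_lsc; exact.
move=> y /= ya i; rewrite /= in_itv /=.
have yL lam : dotv lam y - L lam <= alpha.
  by rewrite -lee_fin; apply: le_trans ya; exact: fenchel_legendre_ge.
have hM : `|L (e i)| + `|L (- e i)| <= M - alpha.
  rewrite /M addrAC subrr add0r (bigD1 i)//= lerDl; apply: sumr_ge0 => j _.
  exact: addr_ge0.
have := yL (e i); have := yL (- e i).
rewrite -scaleN1r dotvZl mulN1r scaleN1r /e dotv_deltal -/(e i).
have := ler_norm (L (e i)); have := ler_norm (L (- e i)).
have := normr_ge0 (L (e i)); have := normr_ge0 (L (- e i)).
move: (`|_|) (`|_|) hM => p q hM; lra.
Qed.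

Lemma fenchel_legendre_convex : is_convex_ereal (fenchel_legendre L).
Proof.
move=> t y z /andP[t0 t1]; apply: ge_ereal_sup => _ [lam _ <-].
have -> : dotv lam (t *: y + (1 - t) *: z) - L lam
   = t * (dotv lam y - L lam) + (1 - t) * (dotv lam z - L lam).
  by rewrite dotvC dotvDl !dotvZl !(dotvC _ lam); ring.
rewrite EFinD !EFinM; apply: leeD; apply: lee_wpmul2l; rewrite ?lee_fin ?subr_ge0//;
  exact: fenchel_legendre_ge.
Qed.

End FenchelLegendre.

Section RateDomain.
Context {R : realType} d {T : measurableType d} (Q : probability T R).
Context {n : nat} (Y : R -> T -> 'rV[R]_n.+1) (L : 'rV[R]_n.+1 -> R).
Hypothesis mY : forall eps, 0 < eps -> borel_measurable (Y eps).
Hypothesis mgf_cvg : forall lam,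
  (eps%:E * log_mgf Q (fun w => dotv lam (Y eps w)) eps^-1)%E @[eps --> 0^'+]
    --> (L lam)%:E.

(** The rate is infinite outside every half-space that contains [Y eps] almost
   surely. *)
Lemma fenchel_legendre_domain (lam z : 'rV[R]_n.+1) (c : R) :
  (forall eps, 0 < eps -> {ae Q, forall w, dotv lam (Y eps w) <= c}) ->
  (fenchel_legendre L z < +oo)%E -> dotv lam z <= c.
Proof.
move=> hc zoo.
have Lt t : 0 < t -> L (t *: lam) <= t * c.
  move=> t0; apply/ler_addgt0Pr => delta d0.
  have h := scaled_mgf_near mgf_cvg (t *: lam) d0.
  have [eps [/andP[h1 _] e0]] := filter_ex (filterI h (nbhs_right_gt (0:R))).
  have : (scaled_mgf Q (Y eps) eps (t *: lam) <= (expR (t * c / eps))%:E)%E.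
    rewrite -(integral_probability_cst Q).
    apply: ae_ge0_le_integral => //.
      apply/measurable_EFinP; apply: measurableT_comp => //.
      apply: measurable_funM => //.
      exact: (borel_measurable_comp (mY e0) (@dotv_continuous _ _ _)).
    apply: filterS (hc _ e0) => w hw _; rewrite lee_fin ler_expR.
    by rewrite ler_pM2r ?invr_gt0// dotvZl ler_wpM2l// ltW.
  move=> /(le_trans h1); rewrite lee_fin ler_expR ler_pM2r ?invr_gt0//; lra.
have [M hM] : exists M, forall l, dotv l z - L l <= M.
  have := fenchel_legendre_nonneg (cumulant0 mgf_cvg) z.
  move: zoo; case E : (fenchel_legendre L z) => [r| |]// _ _.
  by exists r => l; rewrite -lee_fin -E; exact: fenchel_legendre_ge.
rewrite leNgt; apply/negP => lc.
(* Along the ray of [lam], the supremum grows at least like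
   [t (lam . z - c)]; this [t] makes it exceed the bound [M]. *)
pose t := (`|M| + 1) / (dotv lam z - c).
have dc : 0 < dotv lam z - c by rewrite subr_gt0.
have t0 : 0 < t by rewrite divr_gt0// ltr_wpDl.
have tE : t * (dotv lam z - c) = `|M| + 1 by rewrite divfK// gt_eqF.
have := hM (t *: lam); rewrite dotvZl; have := Lt _ t0; have := ler_norm M; nra.
Qed.

End RateDomain.

(** * Contraction *)

Section Contraction.
Context {R : realType} d {T : measurableType d} (Q : probability T R).
Context {n : nat}.

Lemma measurable_fun_borel (U : T -> R) :
  measurable_fun [set: T] U -> borel_measurable U.
Proof.
move=> mU Gamma bG; rewrite -[X in measurable X]setTI; apply: mU => //.
move: Gamma bG; apply: smallest_sub; first exact: sigma_algebra_measurable.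
exact: open_measurable.
Qed.

Variables (Y : R -> T -> 'rV[R]_n) (I : 'rV[R]_n -> \bar R).
Variables (Dm K : set 'rV[R]_n) (g : 'rV[R]_n -> R).
Hypothesis oD : open Dm.
Hypothesis cK : compact K.
Hypothesis KD : K `<=` Dm.
Hypothesis cg : forall z, Dm z -> {for z, continuous g}.
Hypothesis Igood : is_good_rate_function I.
Hypothesis IK : forall z, (I z < +oo)%E -> K z.

(** The infimum of [I] over the fibres of [g] within its domain [Dm]. *)
Definition contracted_rate (l : R) : \bar R :=
  ereal_inf [set I z | z in [set z | Dm z /\ g z = l]].

Let closedK : closed K.
Proof. apply: compact_closed => //; exact: norm_hausdorff. Qed.

Let closed_pre (F : set R) : closed F -> closed (K `&` g @^-1` F).
Proof.
move=> cF z hz.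
have Kz : K z by apply: closedK => B /hz[y [[Ky _] By]]; exists y.
split => //=; apply: contrapT => nF.
have : nbhs z (g @^-1` ~` F).
  by apply: (cg (KD Kz)); apply: open_nbhs_nbhs; split => //; exact: closed_openC.
by move=> /hz[y [[_ Fy] nFy]]; exact: nFy.
Qed.

Let compact_sub (a : R) : compact [set z | (I z <= a%:E)%E].
Proof.
have [[_ I0] gI] := Igood.
have [a0|a0] := leP 0 a; first exact: gI.
rewrite (_ : [set _ | _] = set0); first exact: compact0.
apply/seteqP; split => z //= hz; have := le_trans (I0 z) hz.
by rewrite lee_fin leNgt a0.
Qed.

(** The infimum is attained, by lower semicontinuity on a compact set. *)
Let sublevel_image (a : R) :
  [set l | (contracted_rate l <= a%:E)%E] = g @` [set z | (I z <= a%:E)%E].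
Proof.
apply/seteqP; split => l /=; last first.
  move=> [z /= Iza <-]; apply: ge_ereal_inf; exists (I z) => //.
  by exists z => //; split => //; apply/KD/IK/(le_lt_trans Iza)/ltry.
move=> la; apply: contrapT => hl.
have cC : compact (K `&` g @^-1` [set l]).
  apply: (subclosed_compact _ cK); last by move=> z [].
  by apply: closed_pre; exact: closed_eq.
have [[lscI _] _] := Igood.
move: cC; rewrite compact_cover => /(_ _ [set b | a < b] (fun b => [set z | (b%:E < I z)%E])).
case=> [b _| |D Dsub Dcov].
- by move/lower_semicontinuousP: lscI; exact.
- move=> z [Kz gz]; have aI : (a%:E < I z)%E.
    by rewrite ltNge; apply/negP => Iza; apply: hl; exists z.
  move: aI; case E : (I z) => [r| |] // aI.
    exists ((a + r) / 2); rewrite /= ?E ?lte_fin; move: aI; rewrite lte_fin; lra.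
  by exists (a + 1); rewrite /= ?E ?ltry//; lra.
pose b := \big[Num.min/a + 1]_(b <- finmap.enum_fset D) b.
have ab : a < b.
  rewrite /b big_seq; apply: lt_bigmin; first by rewrite ltrDl.
  by move=> i /Dsub; rewrite inE.
have : (b%:E <= contracted_rate l)%E.
  apply: le_ereal_inf_tmp => _ [z [Dz gz] <-].
  have [Iz|] := ltP (I z) +oo%E; last by rewrite leye_eq => /eqP ->; rewrite leey.
  have [c /= cD /= cI] := Dcov z (conj (IK Iz) gz).
  apply: (@le_trans _ _ c%:E); last exact: ltW.
  by rewrite lee_fin /b; exact: ge_bigmin_seq.
by move=> /le_trans/(_ la); rewrite lee_fin leNgt ab.
Qed.

Lemma contracted_rate_good : is_good_rate_function contracted_rate.
Proof.
have cS (a : R) : compact [set l | (contracted_rate l <= a%:E)%E].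
  rewrite sublevel_image; apply: continuous_compact; last exact: compact_sub.
  apply: continuous_in_subspaceT => z; rewrite inE /= => Iz.
  by apply: cg; apply/KD/IK/(le_lt_trans Iz)/ltry.
have [[lscI I0] _] := Igood.
split; last by move=> a _; exact: cS.
split; last by move=> l; apply: le_ereal_inf_tmp => _ [z _ <-]; exact: I0.
apply/lower_semicontinuousP => a.
have -> : [set l | (a%:E < contracted_rate l)%E]
    = ~` [set l | (contracted_rate l <= a%:E)%E].
  by apply/seteqP; split => y /=; rewrite ltNge => /negP.
by apply: closed_openC; apply: compact_closed => //; exact: Rhausdorff.
Qed.

Hypothesis mY : forall eps, 0 < eps -> borel_measurable (Y eps).
Hypothesis Yub : ldp_upper Q Y I.
Hypothesis Ylb : ldp_lower Q Y I.
Hypothesis YK : forall eps, 0 < eps -> {ae Q, forall w, K (Y eps w)}.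
Variable U : R -> T -> R.
Hypothesis mU : forall eps, 0 < eps -> measurable_fun [set: T] (U eps).
Hypothesis UE : forall eps, 0 < eps -> {ae Q, forall w, U eps w = g (Y eps w)}.

(** The map [g] is only continuous on the open set [Dm], so closed sets are pulled
   back inside the compact set [K] that contains [Y eps] almost surely. *)
Lemma contraction_principle : satisfies_LDP Q U contracted_rate.
Proof.
have bU eps : 0 < eps -> borel_measurable (U eps).
  by move=> e0; apply: measurable_fun_borel; exact: mU.
have e0n : \forall eps \near (0:R)^'+, 0 < eps by exact: nbhs_right_gt.
apply: ldp_of_bounds => //.
- move=> F cF alpha delta d0 hF.
  have hY := Yub (closed_pre cF) d0.
  have {}hY := hY alpha.
  near=> eps.
  have e0 : 0 < eps by near: eps.
  apply: (@le_trans _ _ (Q (Y eps @^-1` (K `&` g @^-1` F)))%E).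
    apply: le_measure_ae.
    - by apply: borel_measurable_closed => //; exact: bU.
    - by apply: borel_measurable_closed; [exact: mY|exact: closed_pre].
    - by apply: filterS2 (YK e0) (UE e0) => w Kw Uw /= Fw; rewrite -Uw; split.
  near: eps; apply: hY => z [Kz gz].
  apply: (lt_le_trans (hF _ gz)); apply: ereal_inf_lbound.
  by exists z => //; split => //; exact: KD.
- move=> G oG l beta delta d0 Gl lb.
  have d20 : 0 < delta / 2 by rewrite divr_gt0.
  have [_ [z [Dz gz] <-] Iz] : exists2 q, [set I z | z in [set z | Dm z /\ g z = l]] q
      & (q < (beta + delta / 2)%:E)%E.
    by apply: ereal_inf_lt; apply: (le_lt_trans lb); rewrite lte_fin ltrDl.
  have oG' : open (Dm `&` g @^-1` G).
    rewrite openE => y [Dy Gy]; apply: filterI.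
      by apply: open_nbhs_nbhs.
    by apply: (cg Dy); exact: open_nbhs_nbhs.
  have hY := Ylb oG' d20 (conj Dz _) (ltW Iz).
  near=> eps.
  have e0 : 0 < eps by near: eps.
  apply: (@le_trans _ _ (Q (Y eps @^-1` (Dm `&` g @^-1` G)))%E).
    have -> : beta + delta = beta + delta / 2 + delta / 2 by lra.
    by near: eps; apply: hY; rewrite /= gz.
  apply: le_measure_ae; [|by apply: borel_measurable_open => //; exact: bU|].
    by apply: borel_measurable_open => //; exact: mY.
  by apply: filterS (UE e0) => w Uw [_ /= Gw]; rewrite /= Uw.
Unshelve. all: by end_near. Qed.

End Contraction.

(** * Products of independent random variables *)

Section Independence.
Import HBNNSimple.
Context {R : realType} d {T : measurableType d} (Q : probability T R).

Let factor_sfun (W X : T -> R) (c : R) (f : {nnsfun R >-> R}) :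
  measurable_fun [set: T] W -> (forall w, 0 <= W w) ->
  measurable_fun [set: T] X ->
  (forall B, measurable B ->
    (\int[Q]_w (W w * \1_B (X w))%:E = c%:E * Q (X @^-1` B))%E) ->
  (\int[Q]_w (W w * f (X w))%:E = c%:E * \int[Q]_w (f (X w))%:E)%E.
Proof.
move=> mW W0 mX hB.
have mpre B : measurable B -> measurable (X @^-1` B).
  by move=> mB; rewrite -[X in measurable X]setTI; exact: mX.
have sum_form (V : T -> R) : measurable_fun [set: T] V -> (forall w, 0 <= V w) ->
   (\int[Q]_w (V w * f (X w))%:E = \sum_(i < size (finmap.enum_fset (fset_set (range f))))
      ((finmap.enum_fset (fset_set (range f)))`_i)%:E *
      \int[Q]_w (V w * \1_(f @^-1` [set (finmap.enum_fset (fset_set (range f)))`_i]) (X w))%:E)%E.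
  move=> mV V0; set s := finmap.enum_fset _.
  have s0 (i : 'I_(size s)) : 0 <= s`_i.
    have : s`_i \in fset_set (range f) by rewrite -[_ \in _]/(_ \in s) mem_nth.
    by rewrite in_fset_set// => /set_mem[x _ <-]; exact: fun_ge0.
  have mind (i : 'I_(size s)) : measurable_fun [set: T]
      (fun w => V w * \1_(f @^-1` [set s`_i]) (X w)).
    apply: measurable_funM => //; apply: (measurableT_comp _ mX).
    exact: measurable_indic.
  transitivity (\int[Q]_w (\sum_(i < size s)
      (s`_i)%:E * (V w * \1_(f @^-1` [set s`_i]) (X w))%:E))%E.
    apply: eq_integral => w _; rewrite fimfunEord -/s mulr_sumr -sumEFin.
    by apply: eq_bigr => i _; rewrite -EFinM mulrCA.
  rewrite ge0_integral_sum//.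
  - apply: eq_bigr => i _; rewrite ge0_integralZl//.
    + exact/measurable_EFinP.
    + by move=> w _; rewrite lee_fin mulr_ge0.
    + by rewrite lee_fin.
  - by move=> i; apply: emeasurable_funM => //; exact/measurable_EFinP.
  - by move=> i w _; rewrite -EFinM lee_fin !mulr_ge0.
rewrite sum_form//.
have -> : (\int[Q]_w (f (X w))%:E = \int[Q]_w (1 * f (X w))%:E)%E.
  by apply: eq_integral => w _; rewrite mul1r.
rewrite (sum_form (cst 1))//.
rewrite ge0_sume_distrr.
  apply: eq_bigr => i _; rewrite hB//.
  rewrite muleCA; congr (_ * (_ * _))%E.
  under eq_integral do rewrite /cst mul1r.
  rewrite -[RHS]/(\int[Q]_w (\1_(X @^-1` (f @^-1` [set _])) w)%:E)%E.
  by rewrite integral_indic ?setIT//; exact: mpre.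
move=> i _; apply: mule_ge0; last first.
  by apply: integral_ge0 => w _; rewrite lee_fin mul1r.
set s := finmap.enum_fset _.
have : s`_i \in fset_set (range f) by rewrite -[_ \in _]/(_ \in s) mem_nth.
by rewrite in_fset_set// lee_fin => /set_mem[x _ <-]; exact: fun_ge0.
Qed.

(** If [E (W 1_B(X)) = c Q(X in B)] for every [B], then
   [E (W f(X)) = c E f(X)] for every nonnegative [f], by approximation with
   simple functions. *)
Lemma integral_factor_comp (W X : T -> R) (c : R) (f : R -> R) :
  measurable_fun [set: T] W -> (forall w, 0 <= W w) ->
  measurable_fun [set: T] X ->
  (forall B, measurable B ->
    (\int[Q]_w (W w * \1_B (X w))%:E = c%:E * Q (X @^-1` B))%E) ->
  measurable_fun [set: R] f -> (forall x, 0 <= f x) ->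
  (\int[Q]_w (W w * f (X w))%:E = c%:E * \int[Q]_w (f (X w))%:E)%E.
Proof.
move=> mW W0 mX hB mf f0.
have mEf : measurable_fun [set: R] (EFin \o f) by exact/measurable_EFinP.
have Ef0 x : [set: R] x -> (0 <= (EFin \o f) x)%E by move=> _; rewrite lee_fin.
pose fn := nnsfun_approx measurableT mEf.
have fn_cvg x : (fn n x)%:E @[n --> \oo] --> (f x)%:E.
  exact: (cvg_nnsfun_approx measurableT mEf Ef0).
have fn_nd x : {homo (fun n => fn n x) : n m / (n <= m)%N >-> n <= m}.
  by move=> n m nm; have /lefP := nd_nnsfun_approx measurableT mEf nm; exact.
have key (V : T -> R) : measurable_fun [set: T] V -> (forall w, 0 <= V w) ->
   (\int[Q]_w (V w * fn n (X w))%:E)%E @[n --> \oo] --> (\int[Q]_w (V w * f (X w))%:E)%E.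
  move=> mV V0.
  have -> : (\int[Q]_w (V w * f (X w))%:E =
             \int[Q]_w limn (fun n => (V w * fn n (X w))%:E))%E.
    apply: eq_integral => w _; apply/esym/cvg_lim => //.
    under eq_fun do rewrite EFinM; rewrite EFinM.
    by apply: cvgeZl => //; exact: fn_cvg.
  apply: (@cvg_monotone_convergence _ _ _ Q _ measurableT
    (fun n w => (V w * fn n (X w))%:E)).
  - by move=> n; apply/measurable_EFinP; apply: measurable_funM => //;
      exact: measurableT_comp.
  - by move=> n w _; rewrite lee_fin mulr_ge0// fun_ge0.
  - by move=> w _ n m nm; rewrite lee_fin ler_wpM2l//; exact: fn_nd.
have k1 := key _ mW W0.
have k2 := key (cst 1) (measurable_cst _) (fun=> ler01).
have E : (fun n => (\int[Q]_w (W w * fn n (X w))%:E)%E)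
    = (fun n => (c%:E * \int[Q]_w (1 * fn n (X w))%:E)%E).
  apply/funext => n; rewrite (factor_sfun (fn n) mW W0 mX hB).
  by congr (_ * _)%E; apply: eq_integral => w _; rewrite mul1r.
rewrite E in k1.
have k3 : (c%:E * \int[Q]_w (cst 1 w * fn n (X w))%:E)%E @[n --> \oo]
   --> (c%:E * \int[Q]_w (cst 1 w * f (X w))%:E)%E by exact: cvgeZl.
have := cvg_lim (@ereal_hausdorff R) k1.
rewrite (cvg_lim (@ereal_hausdorff R) k3) => <-.
by congr (_ * _)%E; apply: eq_integral => w _; rewrite mul1r.
Qed.

(** The expectation of a product of nonnegative functions of independent
   variables factorizes. The factors are turned from indicators into arbitrary
   functions one at a time. *)
Lemma independent_integral_prod (X : nat -> T -> R) (f : nat -> R -> R) (n : nat) :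
  (forall j, measurable_fun [set: T] (X j)) -> mutually_independent Q X ->
  (forall j, measurable_fun [set: R] (f j)) -> (forall j x, 0 <= f j x) ->
  (forall j, (\int[Q]_w (f j (X j w))%:E < +oo)%E) ->
  (\int[Q]_w (\prod_(j < n) f j (X j w))%:E
     = (\prod_(j < n) fine (\int[Q]_w (f j (X j w))%:E))%:E)%E.
Proof.
move=> mX indep mf f0 foo.
have mpre j B : measurable B -> measurable (X j @^-1` B).
  by move=> mB; rewrite -[X in measurable X]setTI; exact: mX.
have int_ind j B : measurable B -> (\int[Q]_w (\1_B (X j w))%:E = Q (X j @^-1` B))%E.
  move=> mB; rewrite -[LHS]/(\int[Q]_w (\1_(X j @^-1` B) w)%:E)%E.
  by rewrite integral_indic ?setIT//; exact: mpre.
suff : forall k (g : nat -> R -> R), (k <= n)%N ->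
    (forall j, measurable_fun [set: R] (g j)) -> (forall j x, 0 <= g j x) ->
    (forall j, (\int[Q]_w (g j (X j w))%:E < +oo)%E) ->
    (forall j, (k <= j)%N -> exists2 B, measurable B & g j = \1_B) ->
    (\int[Q]_w (\prod_(j < n) g j (X j w))%:E
     = (\prod_(j < n) fine (\int[Q]_w (g j (X j w))%:E))%:E)%E.
  pose g j := if (j < n)%N then f j else \1_(setT : set R).
  move=> /(_ n g (leqnn n)) h.
  have gf (j : 'I_n) : g j = f j by rewrite /g ltn_ord.
  transitivity (\int[Q]_w (\prod_(j < n) g j (X j w))%:E)%E.
    by apply: eq_integral => w _; congr EFin; apply: eq_bigr => j _; rewrite gf.
  rewrite h; first by congr EFin; apply: eq_bigr => j _; rewrite gf.
  - by move=> j; rewrite /g; case: ifP => // _; exact: measurable_indic.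
  - by move=> j x; rewrite /g; case: ifP.
  - move=> j; rewrite /g; case: ifP => // _; rewrite int_ind//.
    by rewrite (le_lt_trans (probability_le1 _ _)) ?ltry//; exact: mpre.
  - by move=> j nj; rewrite /g ltnNge nj; exists setT.
elim=> [|k ih] g kn mg g0 goo gind.
  have /choice[B hB] : forall j, exists B, measurable B /\ g j = \1_B.
    by move=> j; have [B mB gE] := gind j (leq0n _); exists B.
  have mB j := (hB j).1; have gE j := (hB j).2.
  transitivity (Q (\bigcap_(j in [set` iota 0 n]) (X j @^-1` B j))).
    rewrite -[\bigcap_(j in _) _]setIT -integral_indic//; last first.
      by apply: fin_bigcap_measurable => // j _; exact: mpre.
    apply: eq_integral => w _; congr EFin.
    rewrite indicE; case: (boolP (w \in _)) => [/set_mem|/negP/(contra_not (@mem_set _ _ _))].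
      move=> h; apply: big1 => j _; rewrite gE indicE mem_set//.
      by apply: h; rewrite /= mem_iota/= add0n ltn_ord.
    move=> h.
    have [j hj] : exists j : 'I_n, ~ B j (X j w).
      apply: contrapT => h'; apply: h => j /=; rewrite mem_iota add0n /= => jn.
      by apply: contrapT => h''; apply: h'; exists (Ordinal jn).
    by rewrite (bigD1 j)//= gE indicE memNset// mul0r.
  rewrite indep ?iota_uniq//; congr EFin.
  rewrite -[in LHS](subn0 n) -/(index_iota 0 n) big_mkord.
  by apply: eq_bigr => j _; rewrite gE int_ind.
pose o : 'I_n := Ordinal kn.
pose W w := \prod_(j < n | j != o) g j (X j w).
pose c := \prod_(j < n | j != o) fine (\int[Q]_w (g j (X j w))%:E).
have W0 w : 0 <= W w by apply: prodr_ge0 => j _.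
have mW : measurable_fun [set: T] W.
  have -> : W = (fun w => \prod_(j < n) (if j != o then g j (X j w) else 1)).
    by apply/funext => w; rewrite /W big_mkcond.
  apply: measurable_prod => j _; case: (j != o) => //.
  exact: measurableT_comp.
rewrite (bigD1 o)//= -/c.
transitivity (\int[Q]_w (W w * g k (X k w))%:E)%E.
  by apply: eq_integral => w _; rewrite (bigD1 o)//= mulrC.
rewrite (@integral_factor_comp W (X k) c (g k))//.
  rewrite mulrC EFinM fineK// ge0_fin_numE//.
  by apply: integral_ge0 => w _; rewrite lee_fin.
move=> B mB.
pose g' j := if j == k then \1_B else g j : R -> R.
have g'k : g' k = \1_B by rewrite /g' eqxx.
have g'n (j : 'I_n) : j != o -> g' j = g j.
  by move=> jo; rewrite /g' ifN.
transitivity (\int[Q]_w (\prod_(j < n) g' j (X j w))%:E)%E.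
  apply: eq_integral => w _; congr EFin; rewrite (bigD1 o)//= g'k mulrC.
  by congr (_ * _); apply: eq_bigr => j jo; rewrite g'n.
rewrite (ih g' (ltnW kn)).
- rewrite (bigD1 o)//= g'k int_ind// mulrC EFinM fineK; last first.
    by apply: fin_num_measure; exact: mpre.
  by congr (_%:E * _)%E; apply: eq_bigr => j jo; rewrite g'n.
- by move=> j; rewrite /g'; case: ifP => // _; exact: measurable_indic.
- by move=> j x; rewrite /g'; case: ifP.
- move=> j; rewrite /g'; case: ifP => // /eqP ->; rewrite int_ind//.
  by rewrite (le_lt_trans (probability_le1 _ _)) ?ltry//; exact: mpre.
- move=> j kj; rewrite /g'; case: ifPn => [_|jk]; first by exists B.
  by apply: gind; rewrite ltn_neqAle eq_sym jk.
Qed.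

End Independence.

(** * Parametric integrals of functions with bounded derivative *)

Section ParametricIntegral.
Context {R : realType} d {X : measurableType d} (mu : {measure set X -> \bar R}).
Variable D : set X.
Hypothesis mD : measurable D.
Hypothesis Dfin : (mu D < +oo)%E.

Lemma bounded_integrable (f : X -> R) (K : R) : measurable_fun D f ->
  (forall x, D x -> `|f x| <= K) -> mu.-integrable D (EFin \o f).
Proof.
move=> mf fK; apply: measurable_bounded_integrable => //.
exists K; split; first exact: num_real.
by move=> M KM x Dx; exact: (le_trans (fK _ Dx) (ltW KM)).
Qed.

Lemma Rintegral_bound (f : X -> R) (K : R) : measurable_fun D f ->
  (forall x, D x -> `|f x| <= K) -> `|\int[mu]_(x in D) f x| <= K * fine (mu D).
Proof.
move=> mf fK; have fi := bounded_integrable mf fK.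
apply: (le_trans (le_normr_Rintegral _ fi)) => //.
rewrite -Rintegral_cst//; apply: le_Rintegral => //.
- have mf' : measurable_fun D (fun x => `|f x|) by exact: measurableT_comp.
  by apply: (bounded_integrable mf') => x Dx; rewrite normr_id; exact: fK.
- by apply: (@bounded_integrable _ `|K|).
Qed.

Lemma Rintegral_sum n (F : 'I_n -> X -> R) :
  (forall i, mu.-integrable D (EFin \o F i)) ->
  \int[mu]_(x in D) (\sum_i F i x) = \sum_i \int[mu]_(x in D) F i x.
Proof.
move=> iF; rewrite /Rintegral sum_fine; last first.
  by move=> i _; exact: (integrable_fin_num mD (iF i)).
congr fine; rewrite -integral_sum//.
by apply: eq_integral => x _; rewrite sumEFin.
Qed.

Lemma is_derive_Rintegral (f df : R -> X -> R) (a K : R) :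
  (forall z, mu.-integrable D (EFin \o f z)) ->
  (forall (z : R) x, D x -> is_derive z 1 (f ^~ x) (df z x)) ->
  (forall z x, D x -> `|z - a| < 1 -> `|df z x| <= K) ->
  is_derive a 1 (fun z => \int[mu]_(x in D) f z x) (\int[mu]_(x in D) df a x).
Proof.
move=> intf dfz dfK.
have Ia : `](a - 1), (a + 1)[%classic a by rewrite /= in_itv/=; apply/andP; split; lra.
have der z x : `](a - 1), (a + 1)[%classic z -> D x -> derivable (f ^~ x) z 1.
  by move=> _ Dx; have [] := dfz z x Dx.
have ub z x : `](a - 1), (a + 1)[%classic z -> D x ->
    `|partial1of2 f z x| <= (fun=> `|K|) x.
  rewrite /= in_itv/= => /andP[z1 z2] Dx; rewrite partial1of2E.
  have [_ ->] := dfz z x Dx; apply: le_trans (ler_norm K); apply: dfK => //.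
  by rewrite ltr_norml; apply/andP; split; lra.
have intK : mu.-integrable D (EFin \o (fun=> `|K|)).
  by apply: (@bounded_integrable _ `|K|) => // x _; rewrite normr_id.
split.
  by apply: (derivable_under_integral mD Ia (fun z _ => intf z) der _ intK ub).
rewrite -derive1E.
rewrite (differentiation_under_integral mD Ia (fun z _ => intf z) der _ intK ub)//.
apply: eq_Rintegral => x; rewrite inE => Dx.
by rewrite partial1of2E; have [_ ->] := dfz a x Dx.
Qed.

End ParametricIntegral.

Section LineDerivative.
Context {R : realType}.

Lemma lipschitz_of_derive (f df : R -> R) (B : R) :
  (forall z : R, is_derive z 1 f (df z)) -> (forall z, `|df z| <= B) ->
  forall x y, `|f x - f y| <= B * `|x - y|.
Proof.
move=> fd dB.
have wlog_le x y : x <= y -> `|f y - f x| <= B * `|y - x|.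
  move=> xy; have [c _ ->] : exists2 c, c \in `[x, y]%R & f y - f x = df c * (y - x).
    apply: MVT_segment => //.
    apply: derivable_within_continuous => z _; have [] := fd z; exact.
  by rewrite normrM ler_wpM2r.
move=> x y; have [xy|/ltW yx] := leP x y; last exact: wlog_le.
by rewrite distrC [X in _ * X]distrC; exact: wlog_le.
Qed.

(** A directional derivative is the derivative along a line. *)
Lemma is_derive_line n (F : 'rV[R]_n.+1 -> R) (lam e : 'rV[R]_n.+1) (c : R) :
  is_derive (0 : R) 1 (fun t : R => F (lam + t *: e)) c -> is_derive lam e F c.
Proof.
move=> [dv val].
have E : (fun h : R => h^-1 *: ((F \o shift lam) (h *: e) - F lam))
   = (fun h : R => h^-1 *: (((fun t : R => F (lam + t *: e)) \o shift 0) (h *: 1)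
        - F (lam + 0 *: e))).
  apply/funext => h; rewrite /= scale0r !addr0.
  by rewrite [h *: e + lam]addrC (_ : h *: 1 = h)//; exact: mulr1.
split; first by rewrite /derivable E.
by rewrite /derive E.
Qed.

End LineDerivative.

Section DirectedIntegral.
Context {R : realType} {n : nat} d {X : measurableType d} (mu : {measure set X -> \bar R}).
Variable D : set X.
Hypothesis mD : measurable D.
Hypothesis Dfin : (mu D < +oo)%E.
Variables (phi dphi : X -> R -> R) (H : X -> 'rV[R]_n.+1) (h : X -> R).
Variables (B B0 CH Ch : R).
Hypothesis phiD : forall s (z : R), is_derive z 1 (phi s) (dphi s z).
Hypothesis dphiB : forall s z, `|dphi s z| <= B.
Hypothesis phi0 : forall s, `|phi s 0| <= B0.
Hypothesis mphi : forall zz : X -> R,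
  measurable_fun D zz -> measurable_fun D (fun s => phi s (zz s)).
Hypothesis mH : forall i, measurable_fun D (fun s => H s 0 i).
Hypothesis HC : forall s i, D s -> `|H s 0 i| <= CH.
Hypothesis mh : measurable_fun D h.
Hypothesis hC : forall s, D s -> `|h s| <= Ch.

(** Integral of a function of [lam . H(s)], with a bounded weight [h]. *)
Let F lam := \int[mu]_(s in D) (h s * phi s (dotv lam (H s))).

Lemma measurable_dotv lam : measurable_fun D (fun s => dotv lam (H s)).
Proof. by apply: measurable_sum => i; apply: measurable_funM. Qed.

Lemma dotv_bound lam s : D s -> `|dotv lam (H s)| <= \sum_i `|lam 0 i| * CH.
Proof.
move=> Ds; apply: (le_trans (ler_norm_sum _ _ _)); apply: ler_sum => i _.
by rewrite normrM ler_wpM2l//; exact: HC.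
Qed.

Let mF lam : measurable_fun D (fun s => h s * phi s (dotv lam (H s))).
Proof. by apply: measurable_funM => //; apply: mphi; exact: measurable_dotv. Qed.

Let phi_lip s x y : `|phi s x - phi s y| <= B * `|x - y|.
Proof. exact: (lipschitz_of_derive (phiD s) (dphiB s)). Qed.

Let intF lam : mu.-integrable D (EFin \o (fun s => h s * phi s (dotv lam (H s)))).
Proof.
apply: (bounded_integrable mD Dfin (K := `|Ch| * (B0 + `|B| * `|\sum_i `|lam 0 i| * CH|))).
  exact: mF.
move=> s Ds; rewrite normrM; apply: ler_pM => //.
  exact: le_trans (hC Ds) (ler_norm _).
have := phi_lip s (dotv lam (H s)) 0; rewrite subr0 => h1.
set p := phi s _; have h2 : `|p| <= `|phi s 0| + `|p - phi s 0|.
  by rewrite -{1}(subrK (phi s 0) p) addrC ler_normD.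
apply: (le_trans h2); apply: lerD; first exact: phi0.
apply: (le_trans h1); apply: ler_pM => //.
- exact: le_trans (normr_ge0 _) (dphiB s 0).
- exact: ler_norm.
- exact: le_trans (dotv_bound lam Ds) (ler_norm _).
Qed.

Lemma directed_integral_is_derive lam i :
  is_derive lam (delta_mx 0 i : 'rV[R]_n.+1) F
    (\int[mu]_(s in D) (h s * H s 0 i * dphi s (dotv lam (H s)))).
Proof.
apply: is_derive_line.
have dE t s : dotv (lam + t *: delta_mx 0 i) (H s) = dotv lam (H s) + t * H s 0 i.
  by rewrite dotvDl dotvZl dotv_deltal.
have -> : \int[mu]_(s in D) (h s * H s 0 i * dphi s (dotv lam (H s)))
  = \int[mu]_(s in D) (h s * H s 0 i * dphi s (dotv (lam + 0 *: delta_mx 0 i) (H s))).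
  by apply: eq_Rintegral => s _; rewrite dE mul0r addr0.
apply: (is_derive_Rintegral mD Dfin 
  (f := fun t s => h s * phi s (dotv (lam + t *: delta_mx 0 i) (H s)))
  (df := fun t s => h s * H s 0 i * dphi s (dotv (lam + t *: delta_mx 0 i) (H s)))
  (K := `|Ch| * `|CH| * B)).
- by move=> z; exact: intF.
- move=> z s Ds.
  have -> : (fun t => h s * phi s (dotv (lam + t *: delta_mx 0 i) (H s)))
     = h s \*: (phi s \o (fun t => dotv lam (H s) + t * H s 0 i)).
    by apply/funext => t; rewrite /= dE.
  rewrite -mulrA.
  apply: is_deriveZ; rewrite dE mulrC.
  apply: is_derive1_comp.
  have -> : (fun t => dotv lam (H s) + t * H s 0 i) =
    (fun t => cst (dotv lam (H s)) t + H s 0 i *: (@id R) t).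
    by apply/funext => t /=; rewrite mulrC.
  have := is_deriveD (is_derive_cst (dotv lam (H s)) z 1)
    (is_deriveZ (H s 0 i) (is_derive_id z (1:R))).
  by rewrite add0r [_ *: 1]mulr1.
- move=> z s Ds _; rewrite !normrM; apply: ler_pM => //; apply: ler_pM => //.
    exact: le_trans (hC Ds) (ler_norm _).
  exact: le_trans (HC i Ds) (ler_norm _).
Qed.

Lemma directed_integral_continuous : continuous F.
Proof.
have lip l1 l2 : `|F l1 - F l2| <= `|Ch| * (B * (\sum_(i < n.+1) `|(l1 - l2) 0 i| * CH))
    * fine (mu D).
  rewrite /F -RintegralB//; apply: Rintegral_bound => //.
    exact: measurable_funB.
  move=> s Ds; rewrite -mulrBr normrM; apply: ler_pM => //.
    exact: le_trans (hC Ds) (ler_norm _).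
  apply: (le_trans (phi_lip _ _ _)); rewrite ler_wpM2l//.
    exact: le_trans (normr_ge0 _) (dphiB s 0).
  have -> : dotv l1 (H s) - dotv l2 (H s) = dotv (l1 - l2) (H s).
    by rewrite dotvDl -[- l2]scaleN1r dotvZl mulN1r.
  exact: dotv_bound.
have B_ge0 (s : X) : 0 <= B by exact: le_trans (normr_ge0 _) (dphiB s 0).
have [D0|/set0P[s0 _]] := eqVneq D set0.
  move=> z; rewrite (_ : F = cst 0); first exact: cst_continuous.
  by apply/funext => l; rewrite /F D0 Rintegral_set0.
have {}B_ge0 : 0 <= B by exact: B_ge0 s0.
pose M := `|Ch| * (B * (n.+1%:R * `|CH|)) * fine (mu D).
have M0 : 0 <= M by rewrite !mulr_ge0// fine_ge0.
move=> l; apply/(cvgrPdist_le (FF := nbhs_filter l)) => e e0.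
have d0 : 0 < e / (M + 1) by rewrite divr_gt0// ltr_wpDl.
apply: filterS (nbhsx_ballx l _ d0) => l' [_ hl].
apply: (le_trans (lip _ _)).
apply: (@le_trans _ _ (M * (e / (M + 1)))); last first.
  by rewrite mulrA ler_pdivrMr ?ltr_wpDl// mulrC ler_pM2l// lerDl.
have -> : M * (e / (M + 1)) =
    `|Ch| * (B * (\sum_(i < n.+1) (e / (M + 1)) * `|CH|)) * fine (mu D).
  rewrite sumr_const card_ord -mulr_natl /M; ring.
rewrite ler_wpM2r ?fine_ge0// !ler_wpM2l//; apply: ler_sum => i _.
have := hl 0 i; rewrite /ball /= !mxE => /ltW h1.
apply: (le_trans (ler_wpM2l (normr_ge0 _) (ler_norm CH))).
by rewrite ler_wpM2r.
Qed.

End DirectedIntegral.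

(** * Cumulants *)

Section MeasurableInverse.
Context {R : realType}.

(** With [0^-1 = 0], the inverse is [x exp (- 2 ln |x|)] for every [x]. *)
Lemma measurable_inv : measurable_fun [set: R] (fun x : R => x^-1).
Proof.
have -> : (fun x : R => x^-1) = (fun x => x * expR (- (2 * ln `|x|))).
  apply/funext => x; have [->|x0] := eqVneq x 0; first by rewrite invr0 mul0r.
  have nx0 : 0 < `|x| by rewrite normr_gt0.
  rewrite mulr_natl mulr2n opprD expRD !expRN lnK ?posrE//.
  by rewrite -invfM -normrM ger0_norm -?expr2 ?sqr_ge0// expr2 invfM mulrA divff// mul1r.
apply: measurable_funM => //; apply: measurableT_comp => //.
apply: measurableT_comp => //; apply: measurable_funM => //.
by apply: measurableT_comp => //; exact: measurable_ln.
Qed.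

Lemma measurable_funV d (X : measurableType d) (D : set X) (f : X -> R) :
  measurable_fun D f -> measurable_fun D (fun x => (f x)^-1).
Proof. by move=> mf; apply: measurableT_comp mf; exact: measurable_inv. Qed.

End MeasurableInverse.

Section Moments.
Context {R : realType} dX {X : measurableType dX} dT {T : measurableType dT}.
Variables (P : probability T R) (W : X -> T -> R) (C : R).
Hypothesis mW : measurable_fun [set: X * T] (fun p => W p.1 p.2).
Hypothesis W0 : forall s t, 0 <= W s t.
Hypothesis WC : forall s t, W s t <= C.

(** The moment [E (W^k e^(zW))] of [W s]. *)
Definition tilted_moment (k : nat) (s : X) (z : R) : R :=
  \int[P]_t (W s t ^+ k * expR (z * W s t)).

Let mWs s : measurable_fun [set: T] (W s).
Proof. exact: (measurable_fun_pair2 s mW). Qed.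

Let mint k s z : measurable_fun [set: T] (fun t => W s t ^+ k * expR (z * W s t)).
Proof.
apply: measurable_funM; first exact: measurable_funX.
by apply: measurableT_comp => //; exact: measurable_funM.
Qed.

Let PT : (P setT < +oo)%E.
Proof. by rewrite probability_setT ltry. Qed.

Let fPT : fine (P setT) = 1.
Proof. by rewrite probability_setT. Qed.

Let X0 s t : `|W s t| = W s t. Proof. by rewrite ger0_norm. Qed.

Let expC s t z : expR (z * W s t) <= expR (`|z| * C).
Proof.
rewrite ler_expR; apply: (le_trans (ler_norm _)); rewrite normrM X0.
by rewrite ler_wpM2l.
Qed.

Let expCn s t z : expR (- (`|z| * C)) <= expR (z * W s t).
Proof.
rewrite ler_expR lerNl; apply: (le_trans (ler_norm _)); rewrite normrN normrM X0.
by rewrite ler_wpM2l.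
Qed.

Let bint k s z t : `|W s t ^+ k * expR (z * W s t)| <= C ^+ k * expR (`|z| * C).
Proof.
rewrite ger0_norm ?mulr_ge0 ?exprn_ge0 ?expR_ge0//.
by apply: ler_pM => //; rewrite ?exprn_ge0 ?expR_ge0// lerXn2r ?nnegrE ?(le_trans (W0 s t)).
Qed.

Lemma tilted_moment_integrable k s z :
  P.-integrable setT (EFin \o (fun t => W s t ^+ k * expR (z * W s t))).
Proof.
by apply: (bounded_integrable measurableT PT (mint k s z)) => t _; exact: bint.
Qed.

Lemma tilted_moment_ge0 k s z : 0 <= tilted_moment k s z.
Proof.
by apply: Rintegral_ge0 => t _; rewrite mulr_ge0 ?exprn_ge0 ?expR_ge0.
Qed.

Let cst_int (c : R) : P.-integrable setT (EFin \o cst c).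
Proof. by apply: (bounded_integrable (K := `|c|) measurableT PT). Qed.

Lemma tilted_moment0_gt0 s z : 0 < tilted_moment 0 s z.
Proof.
apply: (@lt_le_trans _ _ (\int[P]_(t in setT) expR (- (`|z| * C)))).
  by rewrite Rintegral_cst// fPT mulr1 expR_gt0.
apply: le_Rintegral => //; first exact: cst_int.
  exact: tilted_moment_integrable.
by move=> t _; rewrite expr0 mul1r.
Qed.

Lemma tilted_moment_le k s z : tilted_moment k s z <= C ^+ k * tilted_moment 0 s z.
Proof.
rewrite /tilted_moment -RintegralZl//; last exact: tilted_moment_integrable.
apply: le_Rintegral => //; first exact: tilted_moment_integrable.
  have mm : measurable_fun [set: T] (fun t => C ^+ k * (W s t ^+ 0 * expR (z * W s t))).
    by apply: measurable_funM => //; exact: (mint 0).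
  apply: (bounded_integrable (K := `|C ^+ k| * (C ^+ 0 * expR (`|z| * C))) measurableT PT mm).
  by move=> t _; rewrite normrM ler_wpM2l//; exact: bint.
move=> t _; rewrite expr0 mul1r ler_wpM2r ?expR_ge0//.
by rewrite lerXn2r ?nnegrE ?(le_trans (W0 s t)).
Qed.

Lemma tilted_moment_derive k s (z : R) :
  is_derive z 1 (tilted_moment k s) (tilted_moment k.+1 s z).
Proof.
apply: (is_derive_Rintegral measurableT PT
  (f := fun z t => W s t ^+ k * expR (z * W s t))
  (df := fun z t => W s t ^+ k.+1 * expR (z * W s t))
  (K := `|C| ^+ k.+1 * expR ((`|z| + 1) * `|C|))).
- by move=> z'; exact: tilted_moment_integrable.
- move=> z' t _.
  have -> : (fun z => W s t ^+ k * expR (z * W s t))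
     = W s t ^+ k \*: (expR \o (fun z => W s t *: (@id R) z)).
    by apply/funext => y /=; rewrite [y * _]mulrC.
  have h := is_deriveZ (W s t) (is_derive_id z' (1 : R)).
  apply: is_derive_eq (is_deriveZ (W s t ^+ k) (is_derive1_comp (is_derive_expR _) h)) _.
  by rewrite /GRing.scale /= mulr1 exprSr [z' * _]mulrC; ring.
- move=> z' t _ zz; apply: (le_trans (bint _ _ _ _)).
  have C0 : 0 <= C by exact: le_trans (W0 s t) (WC s t).
  rewrite (ger0_norm C0) ler_wpM2l ?exprn_ge0// ler_expR ler_wpM2r//.
  have := ler_normD (z' - z) z; rewrite subrK; lra.
Qed.

Lemma tilted_moment_measurable k (D : set X) (zz : X -> R) : measurable D ->
  measurable_fun D zz -> measurable_fun D (fun s => tilted_moment k s (zz s)).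
Proof.
move=> mD mz; pose zz' := zz \_ D.
have mz' : measurable_fun [set: X] zz' by apply/(measurable_restrictT _ mD).
pose f (p : X * T) := ((W p.1 p.2) ^+ k * expR (zz' p.1 * W p.1 p.2))%:E.
have mf : measurable_fun [set: X * T] f.
  apply/measurable_EFinP; apply: measurable_funM; first exact: measurable_funX.
  apply: measurableT_comp => //; apply: measurable_funM => //.
  exact: measurableT_comp.
have f0 p : (0 <= f p)%E by rewrite lee_fin mulr_ge0 ?exprn_ge0 ?expR_ge0.
have h := measurable_fun_fubini_tonelli_F (m2 := P) f mf f0.
have h2 : measurable_fun D (fun s => fine (fubini_F P f s)).
  by apply: measurableT_comp => //; exact: measurable_funTS.
apply: eq_measurable_fun h2 => s sD.
by rewrite /fubini_F /tilted_moment /Rintegral /f /zz' /= patchE sD.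
Qed.

(** The ratio [E (W^k e^(zW)) / E e^(zW)], a moment of the tilted law. *)
Definition moment_ratio (k : nat) (s : X) (z : R) : R :=
  tilted_moment k s z / tilted_moment 0 s z.

Lemma moment_ratio_bound k s z : `|moment_ratio k s z| <= C ^+ k.
Proof.
rewrite ger0_norm ?divr_ge0 ?tilted_moment_ge0//.
by rewrite ler_pdivrMr ?tilted_moment0_gt0// tilted_moment_le.
Qed.

Lemma moment_ratio_derive k s (z : R) : is_derive z 1 (moment_ratio k s)
  (moment_ratio k.+1 s z - moment_ratio k s z * moment_ratio 1 s z).
Proof.
have m0 : tilted_moment 0 s z != 0 by rewrite gt_eqF// tilted_moment0_gt0.
have dV := is_deriveV m0 (tilted_moment_derive 0 s z).
have := is_deriveM (tilted_moment_derive k s z) dV.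
move=> h; apply: is_derive_eq h _.
rewrite /moment_ratio /GRing.scale /=; field; exact: m0.
Qed.

Lemma moment_ratio_measurable k (D : set X) (zz : X -> R) : measurable D ->
  measurable_fun D zz -> measurable_fun D (fun s => moment_ratio k s (zz s)).
Proof.
move=> mD mz; apply: measurable_funM; first exact: tilted_moment_measurable.
by apply: measurable_funV; exact: tilted_moment_measurable.
Qed.

(** The cumulant generating function of [W s]. *)
Definition cumulant (s : X) (z : R) : R := ln (tilted_moment 0 s z).

Lemma cumulant_derive s (z : R) : is_derive z 1 (cumulant s) (moment_ratio 1 s z).
Proof.
have m0 := tilted_moment0_gt0 s z.
have := is_derive1_comp (is_derive1_ln m0) (tilted_moment_derive 0 s z).
by rewrite /moment_ratio mulrC.
Qed.

Lemma cumulant_measurable (D : set X) (zz : X -> R) : measurable D ->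
  measurable_fun D zz -> measurable_fun D (fun s => cumulant s (zz s)).
Proof.
move=> mD mz; apply: measurableT_comp; first exact: measurable_ln.
exact: tilted_moment_measurable.
Qed.

Lemma cumulant_at0 s : cumulant s 0 = 0.
Proof.
rewrite /cumulant /tilted_moment; under eq_Rintegral do rewrite mul0r expR0 expr0 mulr1.
by rewrite Rintegral_cst// fPT mulr1 ln1.
Qed.

(** Polynomial expressions in the moment ratios. Their values are bounded, and
   they are closed under differentiation in [z]; the derivatives of the cumulant
   are of this form. *)
Inductive ratio_expr := RMoment of nat | RAdd of ratio_expr & ratio_expr
  | ROpp of ratio_expr | RMul of ratio_expr & ratio_expr.

Fixpoint ratio_eval (e : ratio_expr) (s : X) (z : R) : R :=
  match e with
  | RMoment k => moment_ratio k s z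
  | RAdd e1 e2 => ratio_eval e1 s z + ratio_eval e2 s z
  | ROpp e1 => - ratio_eval e1 s z
  | RMul e1 e2 => ratio_eval e1 s z * ratio_eval e2 s z
  end.

(** The derivative in [z], from [r_k' = r_(k+1) - r_k r_1]. *)
Fixpoint ratio_deriv (e : ratio_expr) : ratio_expr :=
  match e with
  | RMoment k => RAdd (RMoment k.+1) (ROpp (RMul (RMoment k) (RMoment 1)))
  | RAdd e1 e2 => RAdd (ratio_deriv e1) (ratio_deriv e2)
  | ROpp e1 => ROpp (ratio_deriv e1)
  | RMul e1 e2 => RAdd (RMul (ratio_deriv e1) e2) (RMul e1 (ratio_deriv e2))
  end.

Lemma ratio_eval_derive e s (z : R) :
  is_derive z 1 (ratio_eval e s) (ratio_eval (ratio_deriv e) s z).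
Proof.
elim: e => [k|e1 h1 e2 h2|e1 h1|e1 h1 e2 h2]; first exact: moment_ratio_derive.
- exact: is_deriveD h1 h2.
- exact: is_deriveN h1.
- have h := is_deriveM h1 h2; apply: is_derive_eq h _.
  by rewrite /GRing.scale /=; ring.
Qed.

Lemma ratio_eval_bounded e : exists B, forall s z, `|ratio_eval e s z| <= B.
Proof.
elim: e => [k|e1 [B1 h1] e2 [B2 h2]|e1 [B1 h1]|e1 [B1 h1] e2 [B2 h2]] /=.
- by exists (C ^+ k) => s z; exact: moment_ratio_bound.
- exists (B1 + B2) => s z; apply: (le_trans (ler_normD _ _)); exact: lerD.
- by exists B1 => s z; rewrite normrN.
- by exists (B1 * B2) => s z; rewrite normrM ler_pM.
Qed.

Lemma ratio_eval_measurable e (D : set X) (zz : X -> R) : measurable D ->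
  measurable_fun D zz -> measurable_fun D (fun s => ratio_eval e s (zz s)).
Proof.
move=> mD mz; elim: e => [k|e1 h1 e2 h2|e1 h1|e1 h1 e2 h2] /=.
- exact: moment_ratio_measurable.
- exact: measurable_funD.
- exact: measurableT_comp.
- exact: measurable_funM.
Qed.

End Moments.

(** * Convexity and smoothness of the integrated cumulant *)

Section CumulantConvexity.
Context {R : realType} dX {X : measurableType dX} dT {T : measurableType dT}.
Variables (P : probability T R) (W : X -> T -> R) (C : R).
Hypothesis mW : measurable_fun [set: X * T] (fun p => W p.1 p.2).
Hypothesis W0 : forall s t, 0 <= W s t.
Hypothesis WC : forall s t, W s t <= C.

Lemma expR_convex (p x y : R) : 0 <= p <= 1 ->
  expR (p * x + (1 - p) * y) <= p * expR x + (1 - p) * expR y.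
Proof.
move=> p01; have hp : Itv.spec (@Itv.num_sem R) (Itv.Real `[0%Z, 1%Z]) p.
  by rewrite /= /Itv.num_sem /= num_real in_itv/=.
exact: (convex_expR (Itv.mk hp) x y).
Qed.

(** Integrating the weighted arithmetic-geometric inequality for the normalized
   exponentials [e^(xW - A)] and [e^(yW - B)] gives the logarithmic convexity of
   the moment generating function. *)
Lemma cumulant_convex (s : X) (p x y : R) : 0 <= p <= 1 ->
  cumulant P W s (p * x + (1 - p) * y)
    <= p * cumulant P W s x + (1 - p) * cumulant P W s y.
Proof.
move=> p01.
have mx := tilted_moment0_gt0 P mW W0 WC s x.
have my := tilted_moment0_gt0 P mW W0 WC s y.
rewrite -[leRHS]expRK ler_ln ?posrE ?expR_gt0//; last first.
  exact: (tilted_moment0_gt0 P mW W0 WC).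
set A := cumulant P W s x; set B := cumulant P W s y.
have eA : expR A = tilted_moment P W 0 s x by rewrite lnK.
have eB : expR B = tilted_moment P W 0 s y by rewrite lnK.
clearbody A B; set E := expR _.
have ix := tilted_moment_integrable P mW W0 WC 0 s x.
have iy := tilted_moment_integrable P mW W0 WC 0 s y.
have ixc := integrableZl measurableT (E * p / expR A) ix.
have iyc := integrableZl measurableT (E * (1 - p) / expR B) iy.
rewrite /= in ixc iyc.
have -> : E = \int[P]_t ((E * p / expR A) * (W s t ^+ 0 * expR (x * W s t))
    + (E * (1 - p) / expR B) * (W s t ^+ 0 * expR (y * W s t))).
  have zl z k : P.-integrable setT (EFin \o (fun t => W s t ^+ 0 * expR (z * W s t))) ->
      \int[P]_t (k * (W s t ^+ 0 * expR (z * W s t))) = k * tilted_moment P W 0 s z.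
    by move=> iz; apply: RintegralZl.
  rewrite RintegralD// !zl// -eA -eB.
  rewrite (divfK (lt0r_neq0 (expR_gt0 A))) (divfK (lt0r_neq0 (expR_gt0 B))).
  by rewrite -mulrDr [p + _]addrC subrK mulr1.
apply: le_Rintegral => //.
- exact: (tilted_moment_integrable P mW W0 WC).
- exact: (integrableD measurableT ixc iyc).
move=> t _; rewrite expr0 !mul1r.
have h := expR_convex (x * W s t - A) (y * W s t - B) p01.
have -> : (p * x + (1 - p) * y) * W s t = (p * A + (1 - p) * B)
   + (p * (x * W s t - A) + (1 - p) * (y * W s t - B)) by ring.
have -> : E * p / expR A * expR (x * W s t) + E * (1 - p) / expR B * expR (y * W s t)
    = E * (p * expR (x * W s t - A) + (1 - p) * expR (y * W s t - B)).
  by rewrite !expRD !expRN; ring.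
by rewrite expRD -/E ler_wpM2l ?expR_ge0.
Qed.

End CumulantConvexity.

Section IntegratedCumulant.
Context {R : realType} {n : nat} dX {X : measurableType dX} dT {T : measurableType dT}.
Variables (mu : {measure set X -> \bar R}) (D : set X).
Hypothesis mD : measurable D.
Hypothesis Dfin : (mu D < +oo)%E.
Variables (P : probability T R) (W : X -> T -> R) (C : R).
Hypothesis mW : measurable_fun [set: X * T] (fun p => W p.1 p.2).
Hypothesis W0 : forall s t, 0 <= W s t.
Hypothesis WC : forall s t, W s t <= C.
Variables (H : X -> 'rV[R]_n.+1) (CH : R).
Hypothesis mH : forall i, measurable_fun D (fun s => H s 0 i).
Hypothesis HC : forall s i, D s -> `|H s 0 i| <= CH.

(** The integral over [D] of the cumulant of [W s] at [lam . H(s)]. *)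
Definition integrated_cumulant (lam : 'rV[R]_n.+1) : R :=
  \int[mu]_(s in D) cumulant P W s (dotv lam (H s)).

(** The derivatives of the integrated cumulant are of this form. *)
Let Phi (e : ratio_expr) (h : X -> R) (lam : 'rV[R]_n.+1) : R :=
  \int[mu]_(s in D) (h s * ratio_eval P W e s (dotv lam (H s))).

Let Phi_derive e (h : X -> R) (Ch : R) lam i :
  measurable_fun D h -> (forall s, D s -> `|h s| <= Ch) ->
  is_derive lam (delta_mx 0 i : 'rV[R]_n.+1) (Phi e h)
    (Phi (ratio_deriv e) (fun s => h s * H s 0 i) lam).
Proof.
move=> mh hC.
have [B hB] := ratio_eval_bounded P mW W0 WC (ratio_deriv e).
have [B0 hB0] := ratio_eval_bounded P mW W0 WC e.
apply: (directed_integral_is_derive mD Dfin (B := B) (B0 := B0) (CH := CH) (Ch := Ch)) => //.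
- by move=> s z; exact: (ratio_eval_derive P mW W0 WC).
- by move=> zz mz; exact: (ratio_eval_measurable P mW W0).
Qed.

Let Phi_continuous e (h : X -> R) (Ch : R) :
  measurable_fun D h -> (forall s, D s -> `|h s| <= Ch) ->
  continuous (Phi e h).
Proof.
move=> mh hC.
have [B hB] := ratio_eval_bounded P mW W0 WC (ratio_deriv e).
have [B0 hB0] := ratio_eval_bounded P mW W0 WC e.
apply: (directed_integral_continuous mD Dfin (B := B) (B0 := B0) (CH := CH) (Ch := Ch)
  (dphi := ratio_eval P W (ratio_deriv e))) => //.
- by move=> s z; exact: (ratio_eval_derive P mW W0 WC).
- by move=> zz mz; exact: (ratio_eval_measurable P mW W0).
Qed.

Let Phi_class_C k e (h : X -> R) (Ch : R) :
  measurable_fun D h -> (forall s, D s -> `|h s| <= Ch) ->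
  class_C k (Phi e h).
Proof.
elim: k e h Ch => [|k ih] e h Ch mh hC; first by split => //; exact: Phi_continuous hC.
split; first exact: Phi_continuous hC.
move=> i ei; have der z := Phi_derive e z i mh hC.
split; first by move=> z; have [] := der z.
have -> : (fun z => 'D_ei (Phi e h) z)
    = Phi (ratio_deriv e) (fun s => h s * H s 0 i).
  by apply/funext => z; have [_ ->] := der z.
apply: (ih _ _ (Ch * CH)); first exact: measurable_funM.
by move=> s Ds; rewrite normrM ler_pM//; [exact: hC|exact: HC].
Qed.

Let int1E : integrated_cumulant
  = (fun lam => \int[mu]_(s in D) (1 * cumulant P W s (dotv lam (H s)))).
Proof.
by apply/funext => lam; apply: eq_Rintegral => s _; rewrite mul1r.
Qed.

Lemma integrated_cumulant_derive lam i :
  is_derive lam (delta_mx 0 i : 'rV[R]_n.+1) integrated_cumulant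
    (Phi (RMoment 1) (fun s => 1 * H s 0 i) lam).
Proof.
rewrite int1E.
apply: (directed_integral_is_derive mD Dfin (B := C ^+ 1) (B0 := 0) (CH := CH) (Ch := 1)
  (phi := cumulant P W) (h := cst 1)) => //.
- by move=> s z; exact: (cumulant_derive P mW W0 WC).
- by move=> s z; exact: (moment_ratio_bound P mW W0 WC).
- by move=> s; rewrite (cumulant_at0 P) normr0.
- by move=> zz mz; exact: (cumulant_measurable P mW W0).
- by move=> s _; rewrite normr1.
Qed.

Lemma integrated_cumulant_continuous : continuous integrated_cumulant.
Proof.
rewrite int1E.
apply: (directed_integral_continuous mD Dfin (B := C ^+ 1) (B0 := 0) (CH := CH) (Ch := 1)
  (phi := cumulant P W) (h := cst 1) (dphi := moment_ratio P W 1)) => //.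
- by move=> s z; exact: (cumulant_derive P mW W0 WC).
- by move=> s z; exact: (moment_ratio_bound P mW W0 WC).
- by move=> s; rewrite (cumulant_at0 P) normr0.
- by move=> zz mz; exact: (cumulant_measurable P mW W0).
- by move=> s _; rewrite normr1.
Qed.

Lemma integrated_cumulant_smooth : class_Coo integrated_cumulant.
Proof.
case=> [|k]; split => //; try exact: integrated_cumulant_continuous.
move=> i ei; split; first by move=> z; have [] := integrated_cumulant_derive z i.
have -> : (fun z => 'D_ei integrated_cumulant z)
    = Phi (RMoment 1) (fun s => 1 * H s 0 i).
  by apply/funext => z; have [_ ->] := integrated_cumulant_derive z i.
apply: (@Phi_class_C _ _ _ CH); first exact: measurable_funM.
by move=> s Ds; rewrite mul1r; exact: HC.
Qed.

Lemma cumulant_bound s z : `|cumulant P W s z| <= C * `|z|.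
Proof.
have := lipschitz_of_derive (cumulant_derive P mW W0 WC s)
  (moment_ratio_bound P mW W0 WC 1 s) z 0.
by rewrite (cumulant_at0 P) !subr0.
Qed.

Lemma cumulant_integrable lam :
  mu.-integrable D (EFin \o (fun s => cumulant P W s (dotv lam (H s)))).
Proof.
apply: (bounded_integrable mD Dfin (K := `|C| * (\sum_i `|lam 0 i| * CH))).
  by apply: (cumulant_measurable P mW W0) => //; exact: measurable_dotv.
move=> s Ds; apply: (le_trans (cumulant_bound _ _)).
apply: (@le_trans _ _ (`|C| * `|dotv lam (H s)|)).
  by rewrite ler_wpM2r// ler_norm.
by rewrite ler_wpM2l//; exact: (dotv_bound HC).
Qed.

Lemma integrated_cumulant_convex :
  convex_function (setT : set (convex_lmodType 'rV[R]_n.+1)) integrated_cumulant.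
Proof.
move=> t x y _ _.
set p : R := t%:num.
have p01 : 0 <= p <= 1 by rewrite /p ge0 le1.
rewrite -[leLHS]/(integrated_cumulant (p *: x + (1 - p) *: y)).
rewrite -[leRHS]/(p * integrated_cumulant x + (1 - p) * integrated_cumulant y).
rewrite /integrated_cumulant -!RintegralZl//; try exact: cumulant_integrable.
have iz k l := integrableZl mD k (cumulant_integrable l).
rewrite -RintegralD//; [|exact: iz|exact: iz].
apply: le_Rintegral => //; first exact: cumulant_integrable.
  exact: (integrableD mD (iz _ _) (iz _ _)).
by move=> s _; rewrite dotvDl !dotvZl; exact: (cumulant_convex P mW W0 WC).
Qed.

End IntegratedCumulant.

(** * The cell decomposition of the exponential moments *)

Section LogMgf.
Context {R : realType} d {T : measurableType d} (P : probability T R).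

(** The logarithm of [E e^phi]; it is 1-Lipschitz for the uniform norm. *)
Definition log_mean_exp (phi : T -> R) : R := ln (\int[P]_t expR (phi t)).

Let PT : (P setT < +oo)%E.
Proof. by rewrite probability_setT ltry. Qed.

Let fPT : fine (P setT) = 1.
Proof. by rewrite probability_setT. Qed.

Lemma expR_bounded_integrable (phi : T -> R) (K : R) : measurable_fun [set: T] phi ->
  (forall t, `|phi t| <= K) -> P.-integrable setT (EFin \o (expR \o phi)).
Proof.
move=> mphi phiK; have me : measurable_fun [set: T] (expR \o phi) by exact: measurableT_comp.
apply: (bounded_integrable (K := expR K) measurableT PT me) => t _ /=.
by rewrite ger0_norm ?expR_ge0// ler_expR (le_trans (ler_norm _)).
Qed.

Lemma mean_exp_gt0 (phi : T -> R) (K : R) : measurable_fun [set: T] phi ->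
  (forall t, `|phi t| <= K) -> 0 < \int[P]_t expR (phi t).
Proof.
move=> mphi phiK; apply: (@lt_le_trans _ _ (\int[P]_(t in setT) expR (- K))).
  by rewrite Rintegral_cst// fPT mulr1 expR_gt0.
apply: le_Rintegral => //.
- by apply: (bounded_integrable (K := `|expR (- K)|) measurableT PT).
- exact: expR_bounded_integrable phiK.
- by move=> t _; rewrite ler_expR; have := phiK t; rewrite ler_norml => /andP[].
Qed.

Lemma log_mean_exp_cst (c : R) : log_mean_exp (cst c) = c.
Proof.
by rewrite /log_mean_exp (@Rintegral_cst _ _ _ P setT measurableT (expR c)) fPT mulr1 expRK.
Qed.

Lemma log_mean_exp_le (phi psi : T -> R) (c K1 K2 : R) :
  measurable_fun [set: T] phi -> (forall t, `|phi t| <= K1) ->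
  measurable_fun [set: T] psi -> (forall t, `|psi t| <= K2) ->
  (forall t, phi t <= psi t + c) -> log_mean_exp phi <= log_mean_exp psi + c.
Proof.
move=> m1 b1 m2 b2 h.
rewrite /log_mean_exp -[leRHS]expRK ler_ln ?posrE ?expR_gt0 ?(mean_exp_gt0 m1 b1)//.
rewrite expRD lnK ?posrE ?(mean_exp_gt0 m2 b2)//.
have i2 := expR_bounded_integrable m2 b2.
rewrite mulrC -RintegralZl//; apply: le_Rintegral => //.
- exact: expR_bounded_integrable b1.
- exact: (integrableZl measurableT (expR c) i2).
- by move=> t _; rewrite /= mulrC -expRD ler_expR.
Qed.

Lemma log_mean_exp_dist (phi psi : T -> R) (c K1 K2 : R) :
  measurable_fun [set: T] phi -> (forall t, `|phi t| <= K1) ->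
  measurable_fun [set: T] psi -> (forall t, `|psi t| <= K2) ->
  (forall t, `|phi t - psi t| <= c) -> `|log_mean_exp phi - log_mean_exp psi| <= c.
Proof.
move=> m1 b1 m2 b2 h; rewrite ler_distl; apply/andP; split.
  rewrite lerBlDr; apply: (log_mean_exp_le m2 b2 m1 b1) => t.
  by have := h t; rewrite ler_distl => /andP[]; rewrite lerBlDr.
apply: (log_mean_exp_le m1 b1 m2 b2) => t.
by have := h t; rewrite ler_distl => /andP[].
Qed.

End LogMgf.

Section MeasurableParam.
Context {R : realType} dX {X : measurableType dX} dT {T : measurableType dT}.
Variables (mu : {sigma_finite_measure set X -> \bar R}) (D : set X).
Hypothesis mD : measurable D.

(** No integrability is required: the positive and negative parts are treated
   separately, and [fine] is measurable. *)
Lemma measurable_Rintegral_param (g : X -> T -> R) :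
  measurable_fun [set: X * T] (fun p => g p.1 p.2) ->
  measurable_fun [set: T] (fun t => \int[mu]_(s in D) g s t).
Proof.
move=> mg.
pose f (p : X * T) : \bar R := (g p.1 p.2 * \1_D p.1)%:E.
have mf : measurable_fun [set: X * T] f.
  apply/measurable_EFinP; apply: measurable_funM => //.
  have m1 : measurable_fun [set: X] (\1_D : X -> R) by exact: measurable_indic.
  exact: (measurableT_comp m1 measurable_fst).
have hp := measurable_fun_fubini_tonelli_G (m1 := mu) _ (measurable_funepos mf)
  (fun p => funepos_ge0 f p).
have hn := measurable_fun_fubini_tonelli_G (m1 := mu) _ (measurable_funeneg mf)
  (fun p => funeneg_ge0 f p).
have h : measurable_fun [set: T] (fun t => fine (fubini_G mu f^\+ t - fubini_G mu f^\- t)%E).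
  by apply: measurableT_comp => //; exact: emeasurable_funB.
apply: eq_measurable_fun h => t _; congr fine.
rewrite integral_mkcond.
have -> : ((fun s => (g s t)%:E) \_ D) = (fun s => f (s, t)).
  by apply/funext => s; rewrite /f patchE /= indicE; case: ifPn; rewrite ?mulr1 ?mulr0.
rewrite integralE; congr (_ - _)%E; apply: eq_integral => s _.
- by rewrite !funeposE.
- by rewrite !funenegE.
Qed.

End MeasurableParam.

Section Cells.
Context {R : realType}.
Local Notation mu := (@lebesgue_measure R).
Local Notation MR := (measurableTypeR R).

Definition unit_itv : set R := `[0, 1]%classic.

(** The part in [[0, 1]] of the [j]-th cell of length [eps]. *)
Definition cell (eps : R) (j : nat) : set R :=
  unit_itv `&` `[j%:R * eps, j.+1%:R * eps[%classic.

(** Cells with a smaller index cover [[0, 1]]; the last one may be truncated. *)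
Definition ncells (eps : R) : nat := (Num.truncn eps^-1).+1.

Lemma measurable_unit_itv : measurable (unit_itv : set MR).
Proof. exact: measurable_itv. Qed.

Lemma measurable_cell eps j : measurable (cell eps j : set MR).
Proof. by apply: measurableI; exact: measurable_itv. Qed.

Lemma lebesgue_unit_itv : mu unit_itv = 1%E.
Proof. by rewrite /unit_itv lebesgue_measure_itv/= lte_fin ltr01 oppr0 adde0. Qed.

Lemma cell_lt eps j s : 0 < eps -> cell eps j s -> Num.truncn (s / eps) = j.
Proof.
move=> e0 [_ /=]; rewrite in_itv/= => /andP[h1 h2]; apply: truncn_def.
by rewrite ler_pdivlMr// ltr_pdivrMr// h1.
Qed.

Lemma truncn_cell eps s : 0 < eps -> unit_itv s -> cell eps (Num.truncn (s / eps)) s.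
Proof.
move=> e0 us; split => //; move: us; rewrite /unit_itv /= !in_itv/= => /andP[s0 s1].
have := truncn_itv (divr_ge0 s0 (ltW e0)).
by rewrite ler_pdivlMr// ltr_pdivrMr.
Qed.

Lemma truncn_ncells eps s : 0 < eps -> unit_itv s -> (Num.truncn (s / eps) < ncells eps)%N.
Proof.
move=> e0; rewrite /unit_itv /= in_itv/= => /andP[s0 s1].
rewrite ltnS; apply: le_truncn; rewrite ler_pdivrMr// mulVf// gt_eqF//.
Qed.

Lemma ncells_le eps : 0 < eps -> (ncells eps)%:R * eps <= 1 + eps.
Proof.
move=> e0; have e1 : 0 < eps^-1 by rewrite invr_gt0.
have /andP[h _] := truncn_itv (ltW e1).
rewrite /ncells -addn1 natrD mulrDl mul1r lerD2r.
by rewrite -ler_pdivlMr// div1r.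
Qed.

Lemma cell_cover eps : 0 < eps ->
  unit_itv = \big[setU/set0]_(j < ncells eps) cell eps j.
Proof.
move=> e0; apply/seteqP; split => s.
  move=> us; rewrite -bigcup_mkord; exists (Num.truncn (s / eps)).
    exact: truncn_ncells.
  exact: truncn_cell.
by rewrite -bigcup_mkord => -[j _ []].
Qed.

Lemma trivIset_cell eps (A : set nat) : 0 < eps -> trivIset A (cell eps).
Proof.
move=> e0 i j _ _ [s [si sj]].
by rewrite -(cell_lt e0 si) (cell_lt e0 sj).
Qed.

Lemma cell_full eps j : 0 < eps -> (j < (ncells eps).-1)%N ->
  cell eps j = `[j%:R * eps, j.+1%:R * eps[%classic.
Proof.
move=> e0 jn; apply/seteqP; split => s; first by case.
move=> hs; split => //; move: hs; rewrite /unit_itv /= !in_itv/= => /andP[h1 h2].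
apply/andP; split; first by apply: le_trans h1; rewrite mulr_ge0// ltW.
apply: (le_trans (ltW h2)); rewrite -ler_pdivlMr// div1r.
have e1 : 0 < eps^-1 by rewrite invr_gt0.
have /andP[h _] := truncn_itv (ltW e1).
by apply: le_trans h; rewrite ler_nat.
Qed.

Lemma lebesgue_cell_le eps j : 0 < eps -> fine (mu (cell eps j)) <= eps.
Proof.
move=> e0.
have h : (mu (cell eps j) <= eps%:E)%E.
  apply: (@le_trans _ _ (mu `[j%:R * eps, j.+1%:R * eps[%classic)).
    apply: le_measure; rewrite ?inE; [exact: measurable_cell|exact: measurable_itv|].
    by move=> s [].
  rewrite lebesgue_measure_itv/= lte_fin ltr_pM2r// ltr_nat ltnSn -EFinB lee_fin.
  by rewrite -mulrBl -natrB// subSnn mul1r.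
rewrite -lee_fin fineK//; rewrite ge0_fin_numE//; exact: le_lt_trans h (ltry _).
Qed.

Lemma lebesgue_cell eps j : 0 < eps -> (j < (ncells eps).-1)%N ->
  fine (mu (cell eps j)) = eps.
Proof.
move=> e0 jn; rewrite cell_full// lebesgue_measure_itv/= lte_fin ltr_pM2r//.
by rewrite ltr_nat ltnSn /= -mulrBl -natrB// subSnn mul1r.
Qed.

Lemma lebesgue_cell_fin eps j : (mu (cell eps j) < +oo)%E.
Proof.
apply: (@le_lt_trans _ _ (mu unit_itv)); last by rewrite lebesgue_unit_itv ltry.
apply: le_measure; rewrite ?inE; [exact: measurable_cell|exact: measurable_unit_itv|].
by move=> s [].
Qed.

Lemma Rintegral_cells (eps : R) (f : R -> R) : 0 < eps ->
  mu.-integrable unit_itv (EFin \o f) ->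
  \int[mu]_(s in unit_itv) f s = \sum_(j < ncells eps) \int[mu]_(s in cell eps j) f s.
Proof.
move=> e0 fi.
have mf : measurable_fun unit_itv (EFin \o f) by case/integrableP : fi.
transitivity (fine (\sum_(j <- iota 0 (ncells eps)) \int[mu]_(s in cell eps j) (f s)%:E)%E).
  rewrite /Rintegral; congr fine.
  have uE : unit_itv = \big[setU/set0]_(j <- iota 0 (ncells eps)) cell eps j.
    by rewrite {1}(cell_cover e0) -(big_mkord xpredT (cell eps)) /index_iota subn0.
  rewrite {1}uE; apply: integral_bigsetU_EFin.
  - exact: measurable_cell.
  - exact: iota_uniq.
  - exact: trivIset_cell.
  - by rewrite -uE.
rewrite -(big_mkord xpredT (fun j => \int[mu]_(s in cell eps j) f s)) /index_iota subn0.
rewrite -sum_fine// => j _; apply: integrable_fin_num; first exact: measurable_cell.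
by apply: (integrableS measurable_unit_itv (measurable_cell eps j) _ fi) => s [].
Qed.

End Cells.

Section CellError.
Context {R : realType}.
Local Notation mu := (@lebesgue_measure R).
Local Notation MR := (measurableTypeR R).
Variables (P : probability MR R) (W : R -> R -> R) (C : R).
Hypothesis mW : measurable_fun [set: MR * MR] (fun p => W p.1 p.2).
Hypothesis W0 : forall s t, 0 <= W s t.
Hypothesis WC : forall s t, W s t <= C.
Variables (zz : R -> R) (Z x0 : R).
Hypothesis mz : measurable_fun unit_itv zz.
Hypothesis zZ : forall s, unit_itv s -> `|zz s| <= Z.
(* The integrand is uniformly continuous away from [0] and [x0]. *)
Hypothesis zW_modulus : forall eta : R, 0 < eta -> exists2 del : R, 0 < del &
  forall s s', unit_itv s -> unit_itv s' -> 0 < s -> 0 < s' -> `|s - s'| < del ->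
    (s < x0) = (s' < x0) -> forall t, `|zz s * W s t - zz s' * W s' t| <= eta.

Let G s := cumulant P (W : MR -> MR -> R) s (zz s).
Let M := Z * C.

(** The contribution of the [j]-th cell when the random variable of that
   cell takes the value [t]. *)
Definition cell_integral (eps : R) (j : nat) (t : R) : R :=
  \int[mu]_(s in cell eps j) (zz s * W s t).

Let C0 : 0 <= C. Proof. exact: le_trans (W0 0 0) (WC 0 0). Qed.

Let Z0 : 0 <= Z.
Proof.
apply: le_trans (normr_ge0 _) (@zZ 0 _).
by rewrite /unit_itv /= in_itv/= lexx ler01.
Qed.

Let M0 : 0 <= M. Proof. exact: mulr_ge0. Qed.

Let zW_bound s t : unit_itv s -> `|zz s * W s t| <= M.
Proof.
move=> us; rewrite normrM ler_pM//; first exact: zZ.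
by rewrite ger0_norm.
Qed.

Let zz' := zz \_ unit_itv.

Let mz' : measurable_fun [set: MR] zz'.
Proof. by apply/(measurable_restrictT _ measurable_unit_itv). Qed.

Let mzW : measurable_fun [set: MR * MR] (fun p => zz' p.1 * W p.1 p.2).
Proof.
apply: measurable_funM => //.
exact: (measurableT_comp mz' measurable_fst).
Qed.

Let zz'E s : unit_itv s -> zz' s = zz s.
Proof. by move=> us; rewrite /zz' patchE mem_set. Qed.

Let cell_sub (eps : R) j (s : R) : cell eps j s -> unit_itv s. Proof. by case. Qed.

Let mzWs eps j t : measurable_fun (cell eps j) (fun s => zz s * W s t).
Proof.
have := measurable_fun_pair1 t mzW => h.
have : measurable_fun (cell eps j) (fun s => zz' s * W s t) by exact: measurable_funTS.
by apply: eq_measurable_fun => s /set_mem /cell_sub us /=; rewrite zz'E.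
Qed.

Lemma measurable_cell_integral eps j : measurable_fun [set: MR] (cell_integral eps j).
Proof.
have h := measurable_Rintegral_param mu (measurable_cell eps j)
  (g := fun (s t : MR) => zz' s * W s t : R)
  mzW.
have -> : cell_integral eps j = (fun t => \int[mu]_(s in cell eps j) (zz' s * W s t)).
  apply/funext => t; apply: eq_Rintegral => s /set_mem /cell_sub us; by rewrite zz'E.
exact: h.
Qed.

Lemma cell_integral_bound eps j t : 0 < eps -> `|cell_integral eps j t| <= M * eps.
Proof.
move=> e0.
have h : `|cell_integral eps j t| <= M * fine (mu (cell eps j)).
  apply: (Rintegral_bound (measurable_cell eps j) (lebesgue_cell_fin eps j) (@mzWs eps j t)).
  by move=> s /cell_sub us; exact: zW_bound.
apply: (le_trans h); by rewrite ler_wpM2l// lebesgue_cell_le.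
Qed.

Let log_cell eps j := log_mean_exp P (fun t : MR => cell_integral eps j t / eps).

Let mlog eps j : measurable_fun [set: MR] (fun t : MR => cell_integral eps j t / eps).
Proof. by apply: measurable_funM => //; exact: measurable_cell_integral. Qed.

Let blog eps j t : 0 < eps -> `|cell_integral eps j t / eps| <= M.
Proof.
move=> e0; rewrite normrM normfV (gtr0_norm e0) ler_pdivrMr//.
exact: cell_integral_bound.
Qed.

Let mG : measurable_fun unit_itv G.
Proof.
exact: (cumulant_measurable P (W := W : MR -> MR -> R) mW W0 measurable_unit_itv mz).
Qed.

Let G_bound s : unit_itv s -> `|G s| <= M.
Proof.
move=> us; apply: (le_trans (cumulant_bound P (W := W : MR -> MR -> R) mW W0 WC _ _)).
by rewrite /M mulrC ler_wpM2r//; exact: zZ.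
Qed.

Let GE s : G s = log_mean_exp P (fun t : MR => zz s * W s t).
Proof.
rewrite /G /cumulant /tilted_moment /log_mean_exp; congr ln.
by apply: eq_Rintegral => t _; rewrite expr0 mul1r.
Qed.

Let mzs s : measurable_fun [set: MR] (fun t : MR => zz s * W s t).
Proof. by apply: measurable_funM => //; exact: (measurable_fun_pair2 s mW). Qed.

Lemma integrable_cumulant_unit : mu.-integrable unit_itv (EFin \o G).
Proof.
have fin1 : (mu (unit_itv : set MR) < +oo)%E by rewrite lebesgue_unit_itv ltry.
exact: (bounded_integrable measurable_unit_itv fin1 mG G_bound).
Qed.

(** Trivial estimate, used on the few exceptional cells. *)
Lemma cell_error_any (eps : R) j : 0 < eps ->
  `|eps * log_cell eps j - \int[mu]_(s in cell eps j) G s| <= 2 * M * eps.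
Proof.
move=> e0; apply: (le_trans (ler_normB _ _)).
have -> : 2 * M * eps = eps * M + M * eps by ring.
apply: lerD.
  rewrite normrM (gtr0_norm e0) ler_wpM2l ?(ltW e0)//.
  rewrite -[log_cell eps j]subr0 -(log_mean_exp_cst P 0).
  apply: (@log_mean_exp_dist _ _ _ P _ _ _ M 0) => //.
  - by move=> t; exact: blog.
  - by move=> t; rewrite normr0.
  - by move=> t; rewrite subr0; exact: blog.
have h : `|\int[mu]_(s in cell eps j) G s| <= M * fine (mu (cell eps j)).
  apply: (Rintegral_bound (measurable_cell eps j) (lebesgue_cell_fin eps j)).
    by apply: (measurable_funS measurable_unit_itv _ mG) => s; exact: cell_sub.
  by move=> s /cell_sub us; exact: G_bound.
by apply: (le_trans h); rewrite ler_wpM2l// lebesgue_cell_le.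
Qed.

(** On a cell of full length where the integrand oscillates by at most [eta],
   both terms are within [eta * eps] of [eps * G s0]. *)
Lemma cell_error_good (eps : R) j (eta s0 : R) : 0 < eps -> fine (mu (cell eps j)) = eps ->
  cell eps j s0 ->
  (forall s, cell eps j s -> forall t, `|zz s * W s t - zz s0 * W s0 t| <= eta) ->
  `|eps * log_cell eps j - \int[mu]_(s in cell eps j) G s| <= 2 * eta * eps.
Proof.
move=> e0 me cs0 osc; have us0 := cell_sub cs0.
have i1 t : mu.-integrable (cell eps j) (EFin \o (fun s => zz s * W s t)).
  apply: (bounded_integrable (measurable_cell eps j) (lebesgue_cell_fin eps j) (@mzWs eps j t)).
  by move=> s /cell_sub us; exact: zW_bound.
have ic (c : R) : mu.-integrable (cell eps j) (EFin \o (fun=> c)).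
  by apply: (bounded_integrable (K := `|c|) (measurable_cell eps j) (lebesgue_cell_fin eps j)).
have mGc : measurable_fun (cell eps j) G.
  by apply: (measurable_funS measurable_unit_itv _ mG) => s; exact: cell_sub.
have iG : mu.-integrable (cell eps j) (EFin \o G).
  apply: (bounded_integrable (measurable_cell eps j) (lebesgue_cell_fin eps j) mGc).
  by move=> s /cell_sub us; exact: G_bound.
have h1 : `|eps * log_cell eps j - eps * G s0| <= eps * eta.
  rewrite -mulrBr normrM (gtr0_norm e0) ler_wpM2l ?(ltW e0)// GE.
  apply: (@log_mean_exp_dist _ _ _ P _ _ _ M M) => //.
  - by move=> t; exact: blog.
  - by move=> t; exact: zW_bound.
  move=> t.
  have -> : cell_integral eps j t / eps - zz s0 * W s0 t
     = (\int[mu]_(s in cell eps j) (zz s * W s t - zz s0 * W s0 t)) / eps.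
    rewrite (RintegralB (measurable_cell eps j) (i1 t) (ic _)).
    by rewrite (Rintegral_cst mu (measurable_cell eps j)) me mulrBl mulfK// gt_eqF.
  rewrite normrM normfV (gtr0_norm e0) ler_pdivrMr// -{2}me.
  apply: (Rintegral_bound (measurable_cell eps j) (lebesgue_cell_fin eps j)).
    exact: (measurable_funB (@mzWs eps j t) (measurable_cst _)).
  by move=> s cs; exact: osc.
have h2 : `|eps * G s0 - \int[mu]_(s in cell eps j) G s| <= eta * eps.
  have -> : eps * G s0 - \int[mu]_(s in cell eps j) G s
     = \int[mu]_(s in cell eps j) (G s0 - G s).
    rewrite (RintegralB (measurable_cell eps j) (ic _) iG).
    by rewrite (Rintegral_cst mu (measurable_cell eps j)) me mulrC.
  rewrite -{2}me.
  apply: (Rintegral_bound (measurable_cell eps j) (lebesgue_cell_fin eps j)).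
    exact: (measurable_funB (measurable_cst _) mGc).
  move=> s cs; rewrite distrC !GE.
  apply: (@log_mean_exp_dist _ _ _ P _ _ _ M M) => //.
  - by move=> t; apply: zW_bound; exact: cell_sub cs.
  - by move=> t; exact: zW_bound.
  - by move=> t; exact: osc.
have := ler_normD (eps * log_cell eps j - eps * G s0)
   (eps * G s0 - \int[mu]_(s in cell eps j) G s).
rewrite addrA subrK => /le_trans; apply.
have -> : 2 * eta * eps = eps * eta + eta * eps by ring.
exact: lerD.
Qed.

(** The sum over cells of the scaled log-moments approximates the integrated
   cumulant: only the first cell, the cell of [x0] and the last cell may fail
   to have small oscillation. *)
Lemma cell_sum_cvg :
  eps * \sum_(j < ncells eps) log_cell eps j @[eps --> 0^'+] --> \int[mu]_(s in unit_itv) G s.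
Proof.
apply/cvgrPdist_le => e e0.
have eta0 : 0 < e / 8 by rewrite divr_gt0.
have [del del0 hdel] := zW_modulus eta0.
near=> eps.
have eps0 : 0 < eps by near: eps; exact: nbhs_right_gt.
have epsdel : eps < del by near: eps; exact: nbhs_right_lt.
have eps1 : eps < 1 by near: eps; exact: nbhs_right_lt.
have epsM : eps < e / (12 * (M + 1)).
  by near: eps; apply: nbhs_right_lt; rewrite divr_gt0// mulr_gt0// ltr_wpDl.
rewrite (Rintegral_cells eps0 integrable_cumulant_unit) mulr_sumr -sumrB.
apply: (le_trans (ler_norm_sum _ _ _)).
pose jx := Num.truncn (x0 / eps).
(* The number of reasons for which cell [j] is exceptional. *)
pose bad j : R := (j == 0%N)%:R + (j == jx)%:R + (j == (ncells eps).-1)%:R.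
apply: (@le_trans _ _ (\sum_(j < ncells eps) (e / 4 * eps + 2 * M * eps * bad j))).
  apply: ler_sum => j _; rewrite distrC.
  have Me0 : 0 <= 2 * M * eps by rewrite !mulr_ge0// ltW.
  have ee0 : 0 <= e / 4 * eps by rewrite mulr_ge0 ?divr_ge0 ?(ltW e0)// ltW.
  have [bj|] := boolP [|| j == 0%N :> nat, j == jx :> nat | j == (ncells eps).-1 :> nat].
    apply: (le_trans (cell_error_any j eps0)).
    have : 1 <= bad j.
      rewrite /bad; case/or3P: bj => /eqP ->; rewrite eqxx.
      + by rewrite -addrA lerDl addr_ge0.
      + by rewrite addrAC lerDr addr_ge0.
      + by rewrite lerDr addr_ge0.
    move=> h; nra.
  rewrite !negb_or => /and3P[j0 jjx jn].
  have jn' : (j < (ncells eps).-1)%N by rewrite ltn_neqAle jn /= -ltnS; exact: ltn_ord.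
  have cpos s : cell eps j s -> 0 < s.
    case=> _; rewrite /= in_itv/= => /andP[h _]; apply: lt_le_trans h.
    by rewrite mulr_gt0// ltr0n lt0n.
  have cx s : cell eps j s -> (s < x0) = (j < jx)%N.
    move=> cs; have us := cell_sub cs.
    have jE := cell_lt eps0 cs.
    apply/idP/idP => [sx|].
      rewrite ltn_neqAle jjx /= -jE; apply: le_truncn.
      by rewrite ler_pM2r ?invr_gt0// ltW.
    move=> jlt; rewrite ltNge; apply/negP => xs; move: jlt; rewrite ltnNge -jE.
    by rewrite le_truncn// ler_pM2r ?invr_gt0.
  have cs0 : cell eps j (j%:R * eps).
    rewrite (cell_full eps0 jn') /= in_itv/= lexx ltr_pM2r// ltr_nat ltnSn//.
  apply: (@le_trans _ _ (2 * (e / 8) * eps)).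
    apply: (cell_error_good (s0 := j%:R * eps) eps0 (lebesgue_cell eps0 jn') cs0).
    move=> s cs t; apply: hdel.
    - exact: cell_sub cs.
    - exact: cell_sub cs0.
    - exact: cpos.
    - exact: cpos.
    - case: cs => _; rewrite /= in_itv/= => /andP[h1 h2].
      rewrite ger0_norm ?subr_ge0//; apply: lt_trans epsdel.
      by rewrite ltrBlDr; move: h2; rewrite -natr1 mulrDl mul1r addrC.
    - by rewrite !cx.
  have : 0 <= bad j by rewrite /bad !addr_ge0.
  move=> b0; nra.
rewrite big_split /= sumr_const card_ord -mulr_sumr.
have b1 k : \sum_(j < ncells eps) (nat_of_ord j == k)%:R <= 1 :> R.
  have [kn|nk] := ltnP k (ncells eps).
    rewrite (bigD1 (Ordinal kn))//= eqxx big1 ?addr0// => j jk.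
    by rewrite (_ : (nat_of_ord j == k) = false)//; apply/negbTE.
  rewrite big1// => j _; rewrite (_ : (nat_of_ord j == k) = false)//.
  by apply/negbTE; rewrite neq_ltn (leq_trans (ltn_ord j) nk).
have b3 : \sum_(j < ncells eps) bad j <= 3.
  rewrite /bad !big_split /=.
  have := b1 0%N; have := b1 jx; have := b1 (ncells eps).-1; lra.
have hn := ncells_le eps0.
rewrite -mulr_natl.
have h1 : (ncells eps)%:R * (e / 4 * eps) <= e / 2.
  have -> : (ncells eps)%:R * (e / 4 * eps) = e / 4 * ((ncells eps)%:R * eps) by ring.
  have : (ncells eps)%:R * eps <= 2 by lra.
  move=> /(ler_wpM2l (_ : 0 <= e / 4)) => /(_ (ltW _)); lra.
have h2 : 2 * M * eps * \sum_(j < ncells eps) bad j <= e / 2.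
  apply: (@le_trans _ _ (2 * M * eps * 3)).
    by rewrite ler_wpM2l// !mulr_ge0// ltW.
  move: epsM; rewrite ltr_pdivlMr ?mulr_gt0 ?ltr_wpDl// => h; nra.
lra.
Unshelve. all: by end_near. Qed.

End CellError.

Section IidCells.
Context {R : realType}.
Local Notation mu := (@lebesgue_measure R).
Local Notation MR := (measurableTypeR R).
Context d {T : measurableType d} (Q : probability T R) (X : nat -> T -> R).
Variable P : probability MR R.
Hypothesis mX : forall j, measurable_fun [set: T] (X j : T -> MR).
Hypothesis XP : is_iid Q X P.

Lemma iid_integral j (f : R -> R) : measurable_fun [set: MR] (f : MR -> R) ->
  (forall t, 0 <= f t) ->
  (\int[Q]_w (f (X j w))%:E = \int[P]_t (f t)%:E)%E.
Proof.
move=> mf f0.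
have h := ge0_integral_pushforward (mX j) Q (D := setT) (f := fun t : MR => (f t)%:E)
  measurableT.
rewrite preimage_setT in h; rewrite -h; first last.
- by move=> y _; rewrite lee_fin.
- exact/measurable_EFinP.
apply: eq_measure_integral => B mB _.
by have [_ h2] := XP; exact: (h2 j B mB).
Qed.

Variables (W : R -> R -> R) (C : R).
Hypothesis mW : measurable_fun [set: MR * MR] (fun p => W p.1 p.2).
Hypothesis W0 : forall s t, 0 <= W s t.
Hypothesis WC : forall s t, W s t <= C.
Variables (zz : R -> R) (Z : R).
Hypothesis mz : measurable_fun (unit_itv : set MR) (zz : MR -> R).
Hypothesis zZ : forall s, unit_itv s -> `|zz s| <= Z.

(** The cell integrals are independent, so their exponential moment is a
   product. *)
Lemma mgf_cells eps : 0 < eps ->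
  (\int[Q]_w (expR ((\sum_(j < ncells eps) cell_integral W zz eps j (X j w)) / eps))%:E
   = (expR (\sum_(j < ncells eps)
       log_mean_exp P (fun t : MR => cell_integral W zz eps j t / eps)))%:E)%E.
Proof.
move=> e0.
pose f j (t : R) := expR (cell_integral W zz eps j t / eps).
have mc j : measurable_fun [set: MR] (fun t : MR => cell_integral W zz eps j t / eps).
  by apply: measurable_funM => //; exact: (measurable_cell_integral mW mz).
have mf j : measurable_fun [set: MR] (f j : MR -> R) by exact: measurableT_comp.
have f0 j t : 0 <= f j t by exact: expR_ge0.
have bc j t : `|cell_integral W zz eps j t / eps| <= Z * C.
  rewrite normrM normfV (gtr0_norm e0) ler_pdivrMr//.
  exact: (cell_integral_bound mW W0 WC mz zZ).
have If j : (\int[Q]_w (f j (X j w))%:E = (\int[P]_t f j t)%:E)%E.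
  rewrite iid_integral// fineK//; apply: integrable_fin_num => //.
  exact: (expR_bounded_integrable P (mc j) (bc j)).
transitivity (\int[Q]_w (\prod_(j < ncells eps) f j (X j w))%:E)%E.
  apply: eq_integral => w _; congr EFin.
  by rewrite mulr_suml expR_sum.
rewrite (@independent_integral_prod _ _ _ Q X f)//.
- congr EFin; rewrite expR_sum; apply: eq_bigr => j _.
  by rewrite If /= lnK// posrE; exact: (mean_exp_gt0 P (mc j) (bc j)).
- by have [] := XP.
- by move=> j; rewrite If ltry.
Qed.

End IidCells.

(** * The loading vector and its primitive *)

Section UniformContinuity.
Context {R : realType}.

(** Heine's theorem on the unit interval. *)
Lemma unit_itv_heine (f : R -> R) : {within unit_itv, continuous f} ->
  forall eta : R, 0 < eta -> exists2 del : R, 0 < del &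
  forall s s', unit_itv s -> unit_itv s' ->
  `|s - s'| < del -> `|f s - f s'| <= eta.
Proof.
move=> cf eta e0.
have cU : compact (@unit_itv R) by exact: segment_compact.
have e20 : 0 < eta / 2 by rewrite divr_gt0.
have loc (y : R) : unit_itv y -> exists2 r : R, 0 < r &
    forall s, unit_itv s -> `|y - s| < r -> `|f y - f s| <= eta / 2.
  move=> Uy; have := (proj1 (subspace_continuousP unit_itv f)) cf y Uy.
  move=> /cvgrPdist_le/(_ _ e20) /nbhs_ballP[r /= r0 hr].
  by exists r => // s Us ys; apply: hr.
pose P (del s : R) := unit_itv s -> forall s', unit_itv s' -> `|s - s'| < del ->
  `|f s - f s'| <= eta.
have [] := proj1 (compact_near_coveringP (@unit_itv R)) cU R ((0:R)^'+) P _.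
  move=> y Uy; have [r r0 hr] := loc y Uy.
  have r20 : 0 < r / 2 by rewrite divr_gt0.
  exists (ball y (r / 2), [set del | del < r / 2]) => /=.
    by split; [exact: nbhsx_ballx|exact: nbhs_right_lt].
  move=> [s del] /= [ys dr] Us s' Us' ss'.
  have h1 : `|f y - f s| <= eta / 2.
    by apply: hr => //; apply: (lt_trans ys); lra.
  have h2 : `|f y - f s'| <= eta / 2.
    apply: hr => //; have := ler_distD s y s'; move: ys; rewrite /ball /=; lra.
  have := ler_distD (f y) (f s) (f s'); rewrite [ `|f s - f y|]distrC; lra.
move=> del0 /= del00 h.
have d2 : 0 < del0 / 2 by rewrite divr_gt0.
exists (del0 / 2) => // s s' Us Us' ss'.
apply: (h (del0 / 2)) => //=.
by rewrite /ball /= sub0r normrN gtr0_norm//; lra.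
Qed.

End UniformContinuity.

Section Loading.
Context {R : realType}.
Local Notation mu := (@lebesgue_measure R).
Local Notation MR := (measurableTypeR R).

Lemma lebesgue_unit_fin : (mu (@unit_itv R : set MR) < +oo)%E.
Proof. by rewrite lebesgue_unit_itv ltry. Qed.

Lemma L2_integrable (f : R -> R) : is_L2_01 f -> mu.-integrable unit_itv (EFin \o f).
Proof.
move=> [mf intf].
have i1 : mu.-integrable (unit_itv : set MR) (EFin \o (fun=> 1)).
  by apply: (bounded_integrable (K := 1) measurable_unit_itv lebesgue_unit_fin) => // s _; rewrite normr1.
apply: (le_integrable measurable_unit_itv _ _ (integrableD measurable_unit_itv i1 intf)).
  exact/measurable_EFinP.
move=> s _; rewrite lee_fin [leRHS]ger0_norm ?addr_ge0 ?sqr_ge0//.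
rewrite -(real_normK (num_real (f s))) expr2.
have := normr_ge0 (f s); move: `|f s| => q q0; nra.
Qed.

Variables (f : R -> R) (x : R).
Hypothesis hf : is_L2_01 f.

Lemma primitive_continuous : {within unit_itv, continuous (primitive f)}.
Proof. exact: (parameterized_integral_continuous ler01 (L2_integrable hf)). Qed.

Lemma primitive_measurable : measurable_fun (unit_itv : set MR) (primitive f : MR -> R).
Proof.
apply: subspace_continuous_measurable_fun; first exact: measurable_unit_itv.
exact: primitive_continuous.
Qed.

Lemma primitive_bounded : exists2 CF, 0 <= CF & forall s, unit_itv s -> `|primitive f s| <= CF.
Proof.
have cU : compact (@unit_itv R) by exact: segment_compact.
have [M [_ hM]] := compact_bounded (continuous_compact primitive_continuous cU).
exists (`|M| + 1) => [|s Us]; first by rewrite addr_ge0.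
apply: (hM (`|M| + 1)); last by exists s.
by rewrite (le_lt_trans (ler_norm M))// ltrDl.
Qed.

Lemma H_vec_measurable (i : 'I_4) :
  measurable_fun (unit_itv : set MR) (fun s : MR => H_vec f x s 0 i).
Proof.
have m1 : measurable_fun (unit_itv : set MR) (fun s : MR => \1_(`]0, x[%classic : set R) s : R).
  by apply: measurable_funTS; apply: measurable_indic; exact: measurable_itv.
case: i => -[|[|[|[|//]]]] i4; under eq_fun do rewrite mxE /=.
- by apply: measurable_funM => //; exact: primitive_measurable.
- exact: primitive_measurable.
- exact: m1.
- exact: measurable_cst.
Qed.

Lemma indic01 s : 0 <= (\1_(`]0, x[%classic : set R) s : R) <= 1.
Proof. by rewrite indicE; case: (_ \in _); rewrite ?lexx ler01. Qed.

Lemma H_vec_bounded : exists2 CH, 0 <= CH &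
  forall s (i : 'I_4), unit_itv s -> `|H_vec f x s 0 i| <= CH.
Proof.
have [CF CF0 hF] := primitive_bounded.
exists (CF + 1) => [|s i Us]; first exact: addr_ge0.
have /andP[i0 i1] := indic01 s; have hs := hF s Us.
case: i => -[|[|[|[|//]]]] i4; rewrite mxE /=.
- rewrite normrM (ger0_norm i0); have := normr_ge0 (primitive f s); nra.
- lra.
- rewrite ger0_norm//; lra.
- rewrite normr1; lra.
Qed.

(** Away from [0] and [x], the components of [H] vary like [F]. *)
Lemma H_vec_oscillation s s' (i : 'I_4) : 0 < s -> 0 < s' -> (s < x) = (s' < x) ->
  `|H_vec f x s 0 i - H_vec f x s' 0 i| <= `|primitive f s - primitive f s'|.
Proof.
move=> s0 s'0 ss'.
have E : \1_(`]0, x[%classic : set R) s = \1_(`]0, x[%classic : set R) s' :> R.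
  rewrite !indicE; congr (nat_of_bool _)%:R.
  by apply/idP/idP; rewrite !inE /= !in_itv /= s0 s'0 ss'.
have /andP[i0 i1] := indic01 s'.
case: i => -[|[|[|[|//]]]] i4; rewrite !mxE /= ?E.
- rewrite -mulrBl normrM (ger0_norm i0); have := normr_ge0 (primitive f s - primitive f s'); nra.
- by [].
- by rewrite subrr normr0.
- by rewrite subrr normr0.
Qed.

End Loading.

(** * The medium *)

Section ClampedInverse.
Context {R : realType}.
Local Notation MR := (measurableTypeR R).
Variables (a : R -> R) (nub nu1 nu2 : R).
Hypothesis nu10 : 0 < nu1.

(** [1 / (a s + nub t)] with the denominator forced into [[nu1, nu2]]; it agrees
   with the inverse of the medium almost surely and is bounded for every [t]. *)
Definition clamped_inv (s t : R) : R :=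
  (Num.max nu1 (Num.min nu2 ((a \_ unit_itv) s + nub * t)))^-1.

Let cl (y : R) := Num.max nu1 (Num.min nu2 y).

Let cl_ge y : nu1 <= cl y. Proof. by rewrite le_max lexx. Qed.

Let cl_gt0 y : 0 < cl y. Proof. exact: lt_le_trans (cl_ge y). Qed.

Lemma clamped_inv_ge0 s t : 0 <= clamped_inv s t.
Proof. by rewrite invr_ge0 ltW//; exact: cl_gt0. Qed.

Lemma clamped_inv_le s t : clamped_inv s t <= nu1^-1.
Proof. by rewrite lef_pV2 ?posrE//; [exact: cl_ge|exact: cl_gt0]. Qed.

Let cl_lip y y' : `|cl y - cl y'| <= `|y - y'|.
Proof.
wlog yy : y y' / y <= y'.
  move=> h; have [/h//|/ltW/h] := leP y y'.
  by rewrite distrC [leRHS]distrC.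
rewrite [ `|cl y - _|]distrC [leRHS]distrC [leRHS]ger0_norm ?subr_ge0//.
have mono : cl y <= cl y'.
  by rewrite /cl !ge_max !le_max !lexx /= !le_min !ge_min !lexx yy ?orbT /= ?orbT.
rewrite ger0_norm ?subr_ge0// /cl lerBlDr.
have e0 : 0 <= y' - y by rewrite subr_ge0.
rewrite ge_max; apply/andP; split; first by rewrite (le_trans (_ : _ <= cl y))// lerDr.
have : Num.min nu2 y' <= Num.min nu2 y + (y' - y).
  by rewrite addr_minl le_min !ge_min lerDl e0 /= addrC subrK lexx orbT.
by move=> /le_trans; apply; rewrite addrC lerD2l le_max lexx orbT.
Qed.

Lemma clamped_inv_lipschitz s s' t :
  `|clamped_inv s t - clamped_inv s' t|
    <= nu1^-1 ^+ 2 * `|(a \_ unit_itv) s - (a \_ unit_itv) s'|.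
Proof.
rewrite /clamped_inv.
set y := (a \_ unit_itv) s + nub * t; set y' := (a \_ unit_itv) s' + nub * t.
rewrite -/(cl y) -/(cl y').
have -> : (cl y)^-1 - (cl y')^-1 = (cl y)^-1 * (cl y')^-1 * (cl y' - cl y).
  by field; rewrite !gt_eqF.
have -> : (a \_ unit_itv) s - (a \_ unit_itv) s' = y - y' by rewrite /y /y'; ring.
rewrite !normrM !normfV !(gtr0_norm (cl_gt0 _)) expr2; apply: ler_pM => //.
- by rewrite mulr_ge0// invr_ge0 ltW.
- by apply: ler_pM; rewrite ?invr_ge0 ?(ltW (cl_gt0 _))// lef_pV2 ?posrE.
- by rewrite distrC.
Qed.

Lemma clamped_invE s t : unit_itv s -> nu1 <= a s + nub * t <= nu2 ->
  clamped_inv s t = (a s + nub * t)^-1.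
Proof.
move=> us /andP[h1 h2]; rewrite /clamped_inv patchE mem_set// min_r//.
by rewrite max_r.
Qed.

Hypothesis ha : {within unit_itv, continuous a}.

Lemma coefficient_measurable : measurable_fun [set: MR] (a \_ unit_itv : MR -> R).
Proof.
apply/(measurable_restrictT _ measurable_unit_itv).
by apply: subspace_continuous_measurable_fun; first exact: measurable_unit_itv.
Qed.

Lemma clamped_inv_measurable :
  measurable_fun [set: MR * MR] (fun p => clamped_inv p.1 p.2).
Proof.
apply: measurable_funV; apply: measurable_maxr => //; apply: measurable_minr => //.
apply: measurable_funD; first exact: (measurableT_comp coefficient_measurable measurable_fst).
by apply: measurable_funM.
Qed.

End ClampedInverse.

Section Medium.
Context {R : realType}.
Local Notation mu := (@lebesgue_measure R).
Local Notation MR := (measurableTypeR R).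

Lemma b_mediumE (nub : R) (th : nat -> R) (y : R) : 0 <= y ->
  b_medium nub th y = nub * th (Num.truncn y).
Proof.
move=> y0; rewrite /b_medium; congr (_ * _).
have /andP[h1 h2] := truncn_itv y0; set k := Num.truncn y.
apply: lim_near_cst => //; near=> n.
have kn : (k < n)%N by near: n; exists k.+1.
rewrite seriesEnat /= big_mkord (bigD1 (Ordinal kn))//=.
rewrite indicE mem_set ?mulr1; last by rewrite /= in_itv/= h1 h2.
rewrite big1 ?addr0// => j jk; rewrite indicE memNset ?mulr0//= in_itv/= => /andP[j1 j2].
move/eqP: jk; apply; apply/val_inj => /=.
by rewrite -(@truncn_def _ y j)// j1 j2.
Unshelve. all: by end_near. Qed.

Lemma A_epsE (a : R -> R) nub (th : nat -> R) (eps s : R) : 0 < eps -> 0 <= s ->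
  A_eps a nub th eps s = a s + nub * th (Num.truncn (s / eps)).
Proof.
by move=> e0 s0; rewrite /A_eps /A_medium b_mediumE// divr_ge0// ltW.
Qed.

Context d {T : measurableType d} (X : nat -> T -> R).
Hypothesis mX : forall j, measurable_fun [set: T] (X j).
Variables (a : R -> R) (nub nu1 nu2 : R) (f : R -> R) (x : R).
Hypothesis nu10 : 0 < nu1.
Hypothesis ha : {within unit_itv, continuous a}.
Hypothesis hf : is_L2_01 f.

Let Z eps w := Z_vec a nub (X ^~ w) f x eps.
Let W := clamped_inv a nub nu1 nu2.
Let zz (lam : 'rV[R]_4) s := dotv lam (H_vec f x s).

(** The value of the random sequence in the cell of [s]. *)
Let Xcell (eps s : R) (w : T) : R := \sum_(j < ncells eps) X j w * \1_(cell eps j) s.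

Let XcellE eps s w : 0 < eps -> unit_itv s -> Xcell eps s w = X (Num.truncn (s / eps)) w.
Proof.
move=> e0 us; rewrite /Xcell (bigD1 (Ordinal (truncn_ncells e0 us)))//=.
rewrite indicE mem_set ?mulr1; last exact: truncn_cell.
rewrite big1 ?addr0// => j jk; rewrite indicE memNset ?mulr0// => js.
by move/eqP: jk; apply; apply/val_inj => /=; rewrite (cell_lt e0 js).
Qed.

Let Xcell_measurable eps : measurable_fun [set: MR * T] (fun p => Xcell eps p.1 p.2).
Proof.
apply: measurable_sum => j; apply: measurable_funM.
  exact: (measurableT_comp (mX j) measurable_snd).
have m1 : measurable_fun [set: MR] (\1_(cell eps j) : MR -> R).
  by apply: measurable_indic; exact: measurable_cell.
exact: (measurableT_comp m1 measurable_fst).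
Qed.

(** Measurability holds without any ellipticity, the inverse being measurable on
   the whole line. *)
Lemma Z_coordinate_measurable eps (i : 'I_4) : 0 < eps ->
  measurable_fun [set: T] (fun w => Z eps w 0 i).
Proof.
move=> e0.
pose h := (fun s : MR => H_vec f x s 0 i : R) \_ unit_itv.
have mh : measurable_fun [set: MR] h.
  by apply/(measurable_restrictT _ measurable_unit_itv); exact: H_vec_measurable.
pose g (s : MR) (w : T) := h s * ((a \_ unit_itv) s + nub * Xcell eps s w)^-1.
have mg : measurable_fun [set: MR * T] (fun p => g p.1 p.2).
  apply: measurable_funM; first exact: (measurableT_comp mh measurable_fst).
  apply: measurable_funV; apply: measurable_funD.
    exact: (measurableT_comp (coefficient_measurable ha) measurable_fst).
  by apply: measurable_funM => //; exact: Xcell_measurable.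
have := measurable_Rintegral_param mu (measurable_unit_itv) (g := g) mg.
apply: eq_measurable_fun => w _; rewrite /Z /Z_vec mxE; apply: eq_Rintegral => s /set_mem us.
have s0 : 0 <= s by move: us; rewrite /unit_itv /= in_itv/= => /andP[].
by rewrite /g /h !patchE mem_set// A_epsE// XcellE.
Qed.

(** The outcomes for which the ellipticity bounds hold in every cell. *)
Definition elliptic (w : T) :=
  forall (j : nat) s, unit_itv s -> nu1 <= a s + nub * X j w <= nu2.

Let A_inv eps w s : 0 < eps -> elliptic w -> unit_itv s ->
  (A_eps a nub (X ^~ w) eps s)^-1 = W s (Xcell eps s w).
Proof.
move=> e0 ew us; have s0 : 0 <= s by move: us; rewrite /unit_itv /= in_itv/= => /andP[].
by rewrite XcellE// A_epsE// /W clamped_invE//; exact: ew.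
Qed.

Let WX_measurable eps w : measurable_fun (unit_itv : set MR) (fun s : MR => W s (Xcell eps s w)).
Proof.
have h := measurable_fun_pair1 w (Xcell_measurable eps).
have h2 : measurable_fun [set: MR] (fun s : MR => (s, Xcell eps s w) : MR * MR).
  exact: measurable_fun_pair.
apply: measurable_funTS.
exact: (measurableT_comp (clamped_inv_measurable nub nu1 nu2 ha) h2).
Qed.

Let W0 s t : 0 <= W s t. Proof. exact: clamped_inv_ge0. Qed.
Let WC s t : W s t <= nu1^-1. Proof. exact: clamped_inv_le. Qed.

(** [h / A_eps] is integrable for bounded [h]. *)
Lemma integrable_over_medium (h : R -> R) (K : R) eps w : 0 < eps -> elliptic w ->
  measurable_fun (unit_itv : set MR) (h : MR -> R) ->
  (forall s, unit_itv s -> `|h s| <= K) ->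
  mu.-integrable unit_itv (EFin \o (fun s => h s / A_eps a nub (X ^~ w) eps s)).
Proof.
move=> e0 ew mh hK.
apply: (bounded_integrable (K := K * nu1^-1) measurable_unit_itv lebesgue_unit_fin).
  have : measurable_fun (unit_itv : set MR) (fun s : MR => h s * W s (Xcell eps s w)).
    exact: measurable_funM.
  by apply: eq_measurable_fun => s /set_mem us; rewrite A_inv.
move=> s us; rewrite A_inv// normrM; apply: ler_pM => //; first exact: hK.
by rewrite ger0_norm.
Qed.

Let mzz lam : measurable_fun (unit_itv : set MR) (zz lam : MR -> R).
Proof. by apply: measurable_dotv => i; exact: H_vec_measurable. Qed.

(** The random term of the medium is constant on each cell, so [lam . Z] is a
   sum of cell integrals. *)
Lemma dotv_Z lam eps w : 0 < eps -> elliptic w ->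
  dotv lam (Z eps w) = \sum_(j < ncells eps) cell_integral W (zz lam) eps j (X j w).
Proof.
move=> e0 ew; have [CH CH0 hCH] := H_vec_bounded x hf.
have iH i : mu.-integrable unit_itv
    (EFin \o (fun s => H_vec f x s 0 i / A_eps a nub (X ^~ w) eps s)).
  by apply: (integrable_over_medium (K := CH)) => //;
    [exact: H_vec_measurable | move=> s us; exact: hCH].
have izz : mu.-integrable unit_itv
    (EFin \o (fun s => zz lam s / A_eps a nub (X ^~ w) eps s)).
  apply: (integrable_over_medium (K := \sum_i `|lam 0 i| * CH)) => //.
  by move=> s us; exact: (dotv_bound hCH).
transitivity (\int[mu]_(s in unit_itv) (zz lam s / A_eps a nub (X ^~ w) eps s)).
  rewrite /dotv; under eq_bigr do rewrite mxE.
  have E i : lam 0 i * \int[mu]_(s in `[0, 1]) (H_vec f x s 0 i / A_eps a nub (X ^~ w) eps s)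
    = \int[mu]_(s in unit_itv) (lam 0 i * (H_vec f x s 0 i / A_eps a nub (X ^~ w) eps s)).
    by rewrite (RintegralZl _ measurable_unit_itv (iH i)).
  under eq_bigr do rewrite E.
  have iZ i := integrableZl measurable_unit_itv (lam 0 i) (iH i).
  rewrite /= in iZ.
  rewrite -(Rintegral_sum measurable_unit_itv iZ).
  apply: eq_Rintegral => s _.
  by rewrite /zz /dotv mulr_suml; apply: eq_bigr => i _; rewrite mulrA.
rewrite (Rintegral_cells e0 izz); apply: eq_bigr => j _.
apply: eq_Rintegral => s /set_mem sj; have us : unit_itv s by case: sj.
by rewrite A_inv// XcellE// (cell_lt e0 sj).
Qed.

End Medium.

(** * Almost sure properties of the medium *)

Section BorelVector.
Context {R : realType} d {T : measurableType d}.

Lemma borel_measurable_of_open {E : topologicalType} (Y : T -> E) :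
  (forall U, open U -> measurable (Y @^-1` U)) -> borel_measurable Y.
Proof.
move=> hU Gamma bG.
have : [set A | measurable (Y @^-1` A)] Gamma.
  move: Gamma bG; apply: smallest_sub; last by move=> U /= oU; exact: hU.
  split => /=.
  - by rewrite preimage_set0.
  - move=> A mA; rewrite setTD -preimage_setC; exact: measurableC.
  - by move=> F mF; rewrite preimage_bigcup; exact: bigcupT_measurable.
by [].
Qed.

(** An open set of vectors is a countable union of rational boxes. *)
Lemma borel_measurable_coordinates n (Y : T -> 'rV[R]_n) :
  (forall i, measurable_fun [set: T] (fun w => Y w 0 i)) -> borel_measurable Y.
Proof.
move=> mY; apply: borel_measurable_of_open => U oU.
pose ctr (q : 'rV[rat]_n) : 'rV[R]_n := map_mx ratr q.
pose F (p : 'rV[rat]_n * nat) : set T :=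
  if `[< ball (ctr p.1) p.2.+1%:R^-1 `<=` U >] then
    Y @^-1` ball (ctr p.1) p.2.+1%:R^-1 else set0.
have -> : Y @^-1` U = \bigcup_p F p.
  apply/seteqP; split => w /=; last first.
    by move=> [p _]; rewrite /F; case: asboolP => // pU /= /pU.
  move=> Uw; have /nbhs_ballP[e /= e0 he] : nbhs (Y w) U by exact: open_nbhs_nbhs.
  have [k hk] : exists k, k.+1%:R^-1 < e / 2 :> R.
    have [k] := ltr_add_invr (divr_gt0 e0 (ltr0n R 2)).
    by rewrite add0r => hk; exists k.
  have kp : 0 < k.+1%:R^-1 :> R by rewrite invr_gt0.
  pose r : R := k.+1%:R^-1; rewrite -/r in hk kp.
  have qex i : exists q : rat, `|ratr q - Y w 0 i| < r.
    have lt : Y w 0 i - r < Y w 0 i + r by move: r kp {hk} => r kp; lra.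
    have [q] := rat_in_itvoo lt; rewrite in_itv/= => /andP[q1 q2].
    exists q; rewrite ltr_norml; move: r q1 q2 {hk kp lt} => r q1 q2.
    by apply/andP; split; lra.
  pose q : 'rV[rat]_n := \row_i projT1 (cid (qex i)).
  have hq i : `|ctr q 0 i - Y w 0 i| < r.
    by rewrite !mxE; exact: (projT2 (cid (qex i))).
  exists (q, k) => //; rewrite /F /= asboolT.
    by split => // i j; rewrite ord1; exact: hq.
  move=> z [_ hz]; apply: he; split => // i j; rewrite ord1 /ball /=.
  have := hz 0 j; have := hq j; rewrite /ball /= => h1 h2.
  apply: (le_lt_trans (ler_distD (ctr q 0 j) _ _)); rewrite distrC in h1.
  apply: (lt_trans (ltrD h1 h2)); rewrite (splitr e); exact: ltrD.
apply: countable_bigcupT_measurable; first exact: countableP.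
move=> p; rewrite /F; case: asboolP => // _.
set r := _^-1; set c := ctr _.
have r0 : 0 < r by rewrite invr_gt0.
have -> : Y @^-1` ball c r = \bigcap_(i in [set: 'I_n])
    (fun w => `|c 0 i - Y w 0 i|) @^-1` `]-oo, r[%classic.
  apply/seteqP; split => w /=.
    by move=> [_ h] i _; rewrite /= in_itv/=; exact: h.
  by move=> h; split => // i j; rewrite ord1; have := h j I; rewrite /= in_itv.
apply: fin_bigcap_measurable; first exact: finite_finset.
move=> i _; rewrite -[X in measurable X]setTI.
have mf : measurable_fun [set: T] (fun w => `|c 0 i - Y w 0 i|).
  by apply: measurableT_comp => //; exact: measurable_funB.
by apply: mf => //; exact: measurable_itv.
Qed.

End BorelVector.

Section AlmostSure.
Context {R : realType}.
Local Notation mu := (@lebesgue_measure R).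
Local Notation MR := (measurableTypeR R).
Context d {T : measurableType d} (Q : probability T R) (X : nat -> T -> R).
Variable P : probability MR R.
Hypothesis mX : forall j, measurable_fun [set: T] (X j : T -> MR).
Hypothesis XP : is_iid Q X P.
Variables (a : R -> R) (nub nu1 nu2 : R) (f : R -> R) (x : R).
Hypothesis nu10 : 0 < nu1.
Hypothesis ha : {within unit_itv, continuous a}.
Hypothesis hA : {ae Q, forall w, forall s y : R, s \in `[0, 1] -> 0 <= y ->
           nu1 <= A_medium a nub (X ^~ w) s y <= nu2}.

Let W := clamped_inv a nub nu1 nu2.

Lemma ae_elliptic : {ae Q, forall w, elliptic X a nub nu1 nu2 w}.
Proof.
apply: filterS hA => w h j s us.
have := h s j%:R us (ler0n _ _); rewrite /A_medium b_mediumE//.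
by rewrite (@truncn_def _ j%:R j)// lexx ltr_nat ltnSn.
Qed.

Lemma elliptic_exists : exists w, elliptic X a nub nu1 nu2 w.
Proof.
apply: contrapT => h.
have [N [mN N0 sub]] := ae_elliptic.
have : Q N = 1%E.
  have -> : N = setT.
    by apply/seteqP; split => // w _; apply: sub => /= hw; apply: h; exists w.
  exact: probability_setT.
by move: N0 => /= ->; move/eqP; rewrite eq_sym onee_eq0.
Qed.

Lemma nu1_le_nu2 : nu1 <= nu2.
Proof.
have [w hw] := elliptic_exists.
have /andP[h1 h2] : nu1 <= a 0 + nub * X 0%N w <= nu2.
  by apply: hw; rewrite /unit_itv /= in_itv/= lexx ler01.
exact: le_trans h1 h2.
Qed.

Let nu20 : 0 < nu2. Proof. exact: lt_le_trans nu1_le_nu2. Qed.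

(** Almost surely under the common law, the clamping is inactive. *)
Lemma ae_clamped_inv s : unit_itv s ->
  {ae P, forall t, clamped_inv a nub nu1 nu2 s t = V_var nub (a s) t}.
Proof.
move=> us.
pose B : set MR := [set t | nu1 <= a s + nub * t <= nu2].
have mB : measurable B.
  have mf : measurable_fun [set: MR] (fun t : MR => a s + nub * t : R).
    by apply: measurable_funD => //; apply: measurable_funM.
  have -> : B = (fun t : MR => a s + nub * t) @^-1` `[nu1, nu2]%classic.
    by apply/seteqP; split => t /=; rewrite in_itv.
  by rewrite -[X in measurable X]setTI; apply: mf => //; exact: measurable_itv.
exists (~` B); split; first exact: measurableC.
  have [_ hP] := XP; rewrite -(hP 0%N _ (measurableC mB)).
  have [N [mN N0 sub]] := ae_elliptic.
  apply: (@subset_measure0 _ _ _ Q _ N) => //.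
    by rewrite -[X in measurable X]setTI; apply: mX => //; exact: measurableC.
  by move=> w /= nB; apply: sub => /= ew; apply: nB; exact: ew.
by move=> t /= h Bt; apply: h; rewrite clamped_invE.
Qed.

Let W0 s t : 0 <= W s t. Proof. exact: clamped_inv_ge0. Qed.
Let WC s t : W s t <= nu1^-1. Proof. exact: clamped_inv_le. Qed.
Let mW : measurable_fun [set: MR * MR] (fun p => W p.1 p.2).
Proof. exact: clamped_inv_measurable. Qed.

(** The clamping changes nothing in the limiting cumulant. *)
Lemma LambdaE lam : Lambda P a nub f x lam
  = integrated_cumulant mu unit_itv P (W : MR -> MR -> R) (H_vec f x) lam.
Proof.
apply: eq_Rintegral => s /set_mem us.
rewrite /log_mgf /mmt_gen_fun unlock.
set z := dotv lam _.
have -> : (\int[P]_t ((expR \o z \o* V_var nub (a s)) t)%:E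
   = (tilted_moment P (W : MR -> MR -> R) 0 s z)%:E)%E.
  rewrite /tilted_moment fineK; last first.
    apply: integrable_fin_num => //.
    exact: (tilted_moment_integrable P mW W0 WC 0 s z).
  apply: ge0_ae_eq_integral => //.
  - apply/measurable_EFinP; apply: measurableT_comp => //; apply: measurable_funM => //.
    apply: measurable_funV; apply: measurable_funD => //; exact: measurable_funM.
  - apply/measurable_EFinP; apply: measurable_funM.
      by apply: measurable_funX; exact: (measurable_fun_pair2 s mW).
    apply: measurableT_comp => //; apply: measurable_funM => //.
    exact: (measurable_fun_pair2 s mW).
  - by move=> t _; rewrite lee_fin expR_ge0.
  - by move=> t _; rewrite lee_fin mulr_ge0 ?expR_ge0 ?exprn_ge0.
  - have [N [mN N0 sub]] := ae_clamped_inv us; exists N; split => // t /= h.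
    by apply: sub => /= Wt; apply: h => _; rewrite /W Wt expr0 mul1r mulrC.
by rewrite lne_EFin//; exact: (tilted_moment0_gt0 P mW W0 WC).
Qed.

End AlmostSure.

(** * Bounds on the random vector and limit of its cumulants *)

Section MediumLimit.
Context {R : realType}.
Local Notation mu := (@lebesgue_measure R).
Local Notation MR := (measurableTypeR R).
Context d {T : measurableType d} (Q : probability T R) (X : nat -> T -> R).
Variable P : probability MR R.
Hypothesis mX : forall j, measurable_fun [set: T] (X j : T -> MR).
Hypothesis XP : is_iid Q X P.
Variables (a : R -> R) (nub nu1 nu2 : R) (f : R -> R) (x : R).
Hypothesis nu10 : 0 < nu1.
Hypothesis ha : {within unit_itv, continuous a}.
Hypothesis hf : is_L2_01 f.
Hypothesis hx : 0 < x < 1.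
Hypothesis hA : {ae Q, forall w, forall s y : R, s \in `[0, 1] -> 0 <= y ->
           nu1 <= A_medium a nub (X ^~ w) s y <= nu2}.

Let Z eps w := Z_vec a nub (X ^~ w) f x eps.
Let W := clamped_inv a nub nu1 nu2.
Let zz (lam : 'rV[R]_4) s := dotv lam (H_vec f x s).
Let nu12 : nu1 <= nu2 := nu1_le_nu2 hA.
Let nu20 : 0 < nu2. Proof. exact: lt_le_trans nu12. Qed.
Let W0 s t : 0 <= W s t. Proof. exact: clamped_inv_ge0. Qed.
Let WC s t : W s t <= nu1^-1. Proof. exact: clamped_inv_le. Qed.
Let mW : measurable_fun [set: MR * MR] (fun p => W p.1 p.2).
Proof. exact: clamped_inv_measurable. Qed.

Lemma medium_inv_bounds eps w s : 0 < eps -> elliptic X a nub nu1 nu2 w -> unit_itv s ->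
  nu2^-1 <= (A_eps a nub (X ^~ w) eps s)^-1 <= nu1^-1.
Proof.
move=> e0 ew us; have s0 : 0 <= s by move: us; rewrite /unit_itv /= in_itv/= => /andP[].
rewrite A_epsE//; have /andP[h1 h2] := ew (Num.truncn (s / eps)) s us.
have p := lt_le_trans nu10 h1.
by rewrite !lef_pV2 ?posrE// h1 h2.
Qed.

(** Lower bounds for the coordinates of [Z]; the last two are positive. *)
Definition Z_lower (C : R) (i : 'I_4) : R := nth 0 [:: - C; - C; x / nu2; nu2^-1] i.

(** A compact box, contained in the domain of [g], where [Z] lives almost
   surely. *)
Definition Z_box (C : R) : set 'rV[R]_4 :=
  [set z | forall i, `[Z_lower C i, C]%classic (z ord0 i)].

Lemma Z_box_compact C : compact (Z_box C).
Proof.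
by apply: (@rV_compact R 4 (fun i => `[Z_lower C i, C]%classic)) => i; exact: segment_compact.
Qed.

Lemma Z_box_dom C : Z_box C `<=` @g_dom R.
Proof.
have /andP[x0 _] := hx.
move=> z hz; split.
- have := hz 2; rewrite /= in_itv/= => /andP[h _]; apply: lt_le_trans h.
  by rewrite /Z_lower /= divr_gt0.
- have := hz 3; rewrite /= in_itv/= => /andP[h _]; apply: lt_le_trans h.
  by rewrite /Z_lower /= invr_gt0.
Qed.

Lemma Z_in_box : exists C, forall eps w, 0 < eps -> elliptic X a nub nu1 nu2 w ->
  Z_box C (Z eps w).
Proof.
have [CH CH0 hCH] := H_vec_bounded x hf.
exists (CH / nu1) => eps w e0 ew i.
have iH := integrable_over_medium (K := CH) mX nu10 ha e0 ew (H_vec_measurable x hf i)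
  (fun s us => hCH s i us).
have mH : measurable_fun (unit_itv : set MR)
    (fun s : MR => H_vec f x s 0 i / A_eps a nub (X ^~ w) eps s).
  by case/integrableP : iH => /measurable_EFinP.
have up : `|Z eps w 0 i| <= CH / nu1.
  rewrite /Z /Z_vec mxE -[CH / nu1]mulr1.
  have f1 : fine (mu (unit_itv : set MR)) = 1 by rewrite lebesgue_unit_itv.
  rewrite -[X in _ <= _ * X]f1.
  apply: (Rintegral_bound measurable_unit_itv lebesgue_unit_fin mH) => s us.
  have /andP[h1 h2] := medium_inv_bounds e0 ew us.
  rewrite normrM; apply: ler_pM => //; first exact: hCH.
  by rewrite ger0_norm//; apply: le_trans h1; rewrite invr_ge0 ltW.
have /andP[x0 x1] := hx.
have lower (D : set MR) : measurable D -> D `<=` unit_itv ->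
    (forall s, unit_itv s -> H_vec f x s 0 i = \1_D s) ->
    nu2^-1 * fine (mu D) <= Z eps w 0 i.
  move=> mD DU HD.
  have i1 : mu.-integrable (unit_itv : set MR) (EFin \o (fun s => nu2^-1 * \1_D s)).
    apply: (bounded_integrable (K := nu2^-1) measurable_unit_itv lebesgue_unit_fin).
      by apply: measurable_funM => //; exact: measurable_indic.
    move=> s _; rewrite indicE; case: (s \in D); rewrite ?mulr1 ?mulr0 ?normr0 ?invr_ge0 ?(ltW nu20)//.
    by rewrite ger0_norm// invr_ge0 ltW.
  have i0 : mu.-integrable (unit_itv : set MR) (EFin \o (\1_D : MR -> R)).
    apply: (bounded_integrable (K := 1) measurable_unit_itv lebesgue_unit_fin).
      exact: measurable_indic.
    by move=> s _; rewrite indicE; case: (s \in D); rewrite ?normr1 ?normr0 ?ler01.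
  have -> : nu2^-1 * fine (mu D) = \int[mu]_(s in unit_itv) (nu2^-1 * \1_D s).
    rewrite (RintegralZl _ measurable_unit_itv i0).
    congr (_ * _); rewrite /Rintegral integral_indic//; last exact: measurable_unit_itv.
    by rewrite setIidl.
  rewrite /Z /Z_vec mxE; apply: le_Rintegral => //; first exact: measurable_unit_itv.
  move=> s us; rewrite HD// mulrC ler_wpM2l//.
  by have /andP[] := medium_inv_bounds e0 ew us.
rewrite /= in_itv/=; move: (up); rewrite ler_norml => /andP[h1 ->]; rewrite andbT.
case: i lower h1 {iH mH up} => -[|[|[|[|//]]]] i4 lower h1; rewrite /Z_lower /= //.
- have := lower `]0, x[%classic; rewrite lebesgue_measure_itv/= lte_fin x0 oppr0 adde0 /=.
  rewrite [x / nu2]mulrC; apply.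
  + exact: measurable_itv.
  + move=> s; rewrite /unit_itv /= !in_itv/= => /andP[s0 sx].
    by rewrite (ltW s0) (ltW (lt_trans sx x1)).
  + by move=> s _; rewrite mxE.
- have := lower unit_itv; rewrite [X in nu2^-1 * fine X]lebesgue_unit_itv /= mulr1; apply.
  + exact: measurable_unit_itv.
  + by [].
  + by move=> s us; rewrite mxE /= indicE mem_set.
Qed.

Lemma Z_borel eps : 0 < eps -> borel_measurable (Z eps).
Proof.
by move=> e0; apply: borel_measurable_coordinates => i; exact: Z_coordinate_measurable.
Qed.

Let zz_bound lam : exists2 Zb, 0 <= Zb & forall s, unit_itv s -> `|zz lam s| <= Zb.
Proof.
have [CH CH0 hCH] := H_vec_bounded x hf.
exists (\sum_i `|lam 0 i| * CH); last by move=> s us; exact: (dotv_bound hCH).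
by apply: sumr_ge0 => i _; exact: mulr_ge0.
Qed.

(** Uniform continuity of [s -> lam . H(s) W(s, t)], uniformly in [t], on either
   side of [x]. *)
Let zW_modulus lam (eta : R) : 0 < eta -> exists2 del : R, 0 < del &
  forall s s', unit_itv s -> unit_itv s' -> 0 < s -> 0 < s' -> `|s - s'| < del ->
    (s < x) = (s' < x) -> forall t, `|zz lam s * W s t - zz lam s' * W s' t| <= eta.
Proof.
move=> eta0; have [Zb Zb0 hZb] := zz_bound lam.
pose S := \sum_i `|lam 0 i|; have S0 : 0 <= S by exact: sumr_ge0.
pose c := nu1^-1; have c0 : 0 < c by rewrite invr_gt0.
have p1 : 0 < eta / (2 * (S * c + 1)).
  by rewrite divr_gt0// mulr_gt0// ltr_wpDl// mulr_ge0// ltW.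
have p2 : 0 < eta / (2 * (Zb * c ^+ 2 + 1)).
  by rewrite divr_gt0// mulr_gt0// ltr_wpDl// mulr_ge0// exprn_ge0// ltW.
have [d1 d10 h1] := unit_itv_heine (primitive_continuous hf) p1.
have [d2 d20 h2] := unit_itv_heine ha p2.
exists (Num.min d1 d2); first by rewrite lt_min d10.
move=> s s' us us' s0 s'0; rewrite lt_min => /andP[ss1 ss2] sx t.
have hz : `|zz lam s - zz lam s'| <= S * `|primitive f s - primitive f s'|.
  rewrite /zz /dotv -sumrB mulr_suml; apply: (le_trans (ler_norm_sum _ _ _)).
  by apply: ler_sum => i _; rewrite -mulrBr normrM ler_wpM2l//; exact: H_vec_oscillation.
have hw : `|W s t - W s' t| <= c ^+ 2 * `|a s - a s'|.
  have := clamped_inv_lipschitz a nub nu2 nu10 s s' t.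
  by rewrite !patchE !mem_set.
have -> : zz lam s * W s t - zz lam s' * W s' t
  = (zz lam s - zz lam s') * W s t + zz lam s' * (W s t - W s' t) by ring.
apply: (le_trans (ler_normD _ _)); rewrite !normrM (splitr eta); apply: lerD.
  apply: (@le_trans _ _ (S * (eta / (2 * (S * c + 1))) * c)).
    apply: ler_pM => //; last by rewrite ger0_norm.
    by apply: (le_trans hz); rewrite ler_wpM2l//; exact: h1.
  have q0 : 0 < S * c + 1 by rewrite ltr_wpDl// mulr_ge0// ltW.
  rewrite mulrAC mulrA ler_pdivrMr ?mulr_gt0//.
  nra.
apply: (@le_trans _ _ (Zb * (c ^+ 2 * (eta / (2 * (Zb * c ^+ 2 + 1)))))).
  apply: ler_pM => //; first exact: hZb.
  by apply: (le_trans hw); rewrite ler_wpM2l ?exprn_ge0 ?(ltW c0)//; exact: h2.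
have q0 : 0 < Zb * c ^+ 2 + 1 by rewrite ltr_wpDl// mulr_ge0// exprn_ge0// ltW.
rewrite mulrA mulrA ler_pdivrMr ?mulr_gt0//.
move: (c ^+ 2) q0 => cc q0; nra.
Qed.

(** The scaled cumulants of [Z] converge to the integrated cumulant: the
   cells contribute independent factors, whose logarithms form a Riemann sum. *)
Lemma Z_mgf_cvg lam :
  (eps%:E * log_mgf Q (fun w => dotv lam (Z eps w)) eps^-1)%E @[eps --> 0^'+]
    --> (Lambda P a nub f x lam)%:E.
Proof.
have [Zb Zb0 hZb] := zz_bound lam.
have mzz : measurable_fun (unit_itv : set MR) (zz lam : MR -> R).
  by apply: measurable_dotv => i; exact: H_vec_measurable.
rewrite (LambdaE mX XP f x nu10 ha hA).
have lim := @cell_sum_cvg R P W nu1^-1 mW W0 WC (zz lam) Zb x mzz hZb (@zW_modulus lam).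
have e0n : \forall eps \near (0:R)^'+, 0 < eps by exact: nbhs_right_gt.
have lim' : (eps * \sum_(j < ncells eps)
    log_mean_exp P (fun t : MR => cell_integral W (zz lam) eps j t / eps))%:E
    @[eps --> 0^'+]
  --> (integrated_cumulant mu unit_itv P (W : MR -> MR -> R) (H_vec f x) lam)%:E.
  by apply/fine_cvgP; split; [exact: nearW|exact: lim].
apply: cvg_trans lim'.
apply: near_eq_cvg; near=> eps.
have e0 : 0 < eps by near: eps.
rewrite scaled_mgfE /scaled_mgf.
have -> : (\int[Q]_w (expR (dotv lam (Z eps w) / eps))%:E =
   \int[Q]_w (expR ((\sum_(j < ncells eps) cell_integral W (zz lam) eps j (X j w)) / eps))%:E)%E.
  apply: ge0_ae_eq_integral => //.
  - apply/measurable_EFinP; apply: measurableT_comp => //; apply: measurable_funM => //.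
    exact: (borel_measurable_comp (Z_borel e0) (@dotv_continuous _ _ lam)).
  - apply/measurable_EFinP; apply: measurableT_comp => //; apply: measurable_funM => //.
    apply: measurable_sum => j; apply: (measurableT_comp (measurable_cell_integral mW mzz _ _)).
    exact: mX.
  - have [N [mN N0 sub]] := ae_elliptic hA; exists N; split => // w /= h.
    by apply: sub => /= ew; apply: h => _; rewrite -(dotv_Z mX x nu10 ha hf lam e0 ew).
by rewrite (mgf_cells mX XP mW W0 WC mzz hZb e0) lne_EFin ?expR_gt0// expRK.
Unshelve. all: by end_near. Qed.

End MediumLimit.

(** * The weak solution *)

Section PrimitiveSwap.
Context {R : realType}.
Local Notation mu := (@lebesgue_measure R).
Local Notation MR := (measurableTypeR R).

Lemma integrable_subitv (g : R -> R) (i : interval R) : [set` i] `<=` unit_itv ->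
  mu.-integrable unit_itv (EFin \o g) -> mu.-integrable [set` i] (EFin \o g).
Proof.
move=> iU ig; apply: (integrableS measurable_unit_itv _ iU ig).
exact: measurable_itv.
Qed.

Lemma primitive_complement (f : R -> R) (r : R) :
  mu.-integrable unit_itv (EFin \o f) -> unit_itv r ->
  \int[mu]_(s in `[r, 1]) f s = primitive f 1 - primitive f r.
Proof.
move=> iF; rewrite /unit_itv /= in_itv/= => /andP[r0 r1].
rewrite /primitive (Rintegral_itvB (a := BLeft 0)) ?bnd_simp//.
rewrite Rintegral_itv_obnd_cbnd//; apply: integrable_subitv => // s.
by rewrite /unit_itv /= !in_itv/= => /andP[h ->]; rewrite (le_trans r0 (ltW h)).
Qed.

(** Integration by parts for primitives, from Fubini on the triangle
   [r <= s]. *)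
Lemma primitive_swap (f g : R -> R) :
  mu.-integrable unit_itv (EFin \o f) -> mu.-integrable unit_itv (EFin \o g) ->
  \int[mu]_(s in unit_itv) (f s * primitive g s)
    = \int[mu]_(r in unit_itv) ((primitive f 1 - primitive f r) * g r).
Proof.
move=> iF iG.
pose tri : set (MR * MR) := [set p | p.2 <= p.1].
have mtri : measurable tri.
  rewrite -[X in measurable X]setTI.
  exact: (measurable_fun_le measurableT
    (measurable_snd : measurable_fun _ (snd : MR * MR -> MR)) measurable_fst).
pose fU := f \_ unit_itv; pose gU := g \_ unit_itv.
have ifU : mu.-integrable [set: MR] (EFin \o fU).
  by rewrite -restrict_EFin; apply/(integrable_mkcond _ measurable_unit_itv).
have igU : mu.-integrable [set: MR] (EFin \o gU).
  by rewrite -restrict_EFin; apply/(integrable_mkcond _ measurable_unit_itv).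
have mfU : measurable_fun [set: MR] (fU : MR -> R) by case/integrableP : ifU => /measurable_EFinP.
have mgU : measurable_fun [set: MR] (gU : MR -> R) by case/integrableP : igU => /measurable_EFinP.
pose k (p : MR * MR) : R := fU p.1 * gU p.2 * \1_tri p.
have mk : measurable_fun [set: MR * MR] k.
  apply: measurable_funM; last exact: measurable_indic.
  apply: measurable_funM.
    exact: (measurableT_comp mfU measurable_fst).
  exact: (measurableT_comp mgU measurable_snd).
have ik : (mu \x mu)%E.-integrable [set: MR * MR] (EFin \o k).
  apply/integrable12ltyP; first exact/measurable_EFinP.
  pose B := (\int[mu]_r `|gU r|%:E)%E.
  have /integrableP[_ Boo] := igU.
  have Bfin : B \is a fin_num.
    rewrite ge0_fin_numE//; exact: integral_ge0.
  apply: (@le_lt_trans _ _ (\int[mu]_s (`|fU s|%:E * B))%E).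
    apply: ge0_le_integral => //=.
    - by move=> s _; apply: integral_ge0 => r _; rewrite lee_fin.
    - have mk1 : measurable_fun [set: MR * MR] (fun p : MR * MR => `|k p|%:E).
        by apply/measurable_EFinP; exact: measurableT_comp.
      by apply: (measurable_fun_fubini_tonelli_F (m2 := mu) _ mk1) => p; rewrite lee_fin.
    - apply: emeasurable_funM => //.
      by apply/measurable_EFinP; exact: measurableT_comp.
    move=> s _; rewrite -ge0_integralZl//=; last by apply/measurable_EFinP; exact: measurableT_comp.
    apply: ge0_le_integral => //=.
    - apply/measurable_EFinP; apply: measurableT_comp => //.
      exact: (@measurable_fun_pair2 _ _ _ _ _ _ k s mk).
    - by apply/measurable_EFinP; apply: measurable_funM => //; exact: measurableT_comp.
    move=> r _; rewrite lee_fin /k /= !normrM indicE.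
    by case: (_ \in _); rewrite ?normr1 ?normr0 ?mulr1 ?mulr0// mulr_ge0.
  rewrite ge0_integralZr//=; last first.
  - exact: integral_ge0.
  - by apply/measurable_EFinP; exact: measurableT_comp.
  rewrite lte_mul_pinfty//; first exact: integral_ge0.
  - by rewrite ge0_fin_numE//; [case/integrableP : ifU | exact: integral_ge0].
have := Fubini ik.
have inner1 (s : MR) : (\int[mu]_r (k (s, r))%:E = (((f \* primitive g) \_ unit_itv) s)%:E)%E.
  rewrite patchE; case: ifPn => us; last first.
    by apply: integral0_eq => r _; rewrite /k /fU patchE (negbTE us) !mul0r.
  have {}us := set_mem us.
  have us' : `[0, s]%classic `<=` unit_itv.
    move: us; rewrite /unit_itv /= in_itv/= => /andP[_ s1] r /=.
    by rewrite !in_itv/= => /andP[-> h]; exact: le_trans h s1.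
  have mI : measurable (`[0, s]%classic : set MR) by exact: measurable_itv.
  have ig := integrable_subitv us' iG.
  rewrite /= /primitive -(RintegralZl _ mI ig).
  have ig2 := integrableZl mI (f s) ig.
  rewrite fineK; last exact: (integrable_fin_num mI ig2).
  rewrite [RHS]integral_mkcond; apply: eq_integral => r _.
  rewrite /k /fU /gU !patchE /= mem_set// indicE.
  case: (boolP (r \in (`[0, s]%classic : set R))) => [|nr].
    rewrite inE => rs; rewrite (mem_set (us' _ rs)) mem_set ?mulr1//.
    by move: rs; rewrite /= in_itv/= => /andP[].
  case: ifPn => ur; last by rewrite mulr0 mul0r.
  rewrite memNset ?mulr0// /tri /= => rs; move: nr; rewrite notin_setE; apply.
  by move: ur; rewrite inE /unit_itv /= !in_itv/= rs => /andP[->].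
have inner2 (r : MR) : (\int[mu]_s (k (s, r))%:E
    = (((fun r => (primitive f 1 - primitive f r) * g r) \_ unit_itv) r)%:E)%E.
  rewrite patchE; case: ifPn => ur; last first.
    by apply: integral0_eq => s _; rewrite /k /gU patchE (negbTE ur) mulr0 mul0r.
  have {}ur := set_mem ur.
  have ur' : `[r, 1]%classic `<=` unit_itv.
    move: ur; rewrite /unit_itv /= in_itv/= => /andP[r0 _] s /=.
    by rewrite !in_itv/= => /andP[h ->]; rewrite (le_trans r0 h).
  have mI : measurable (`[r, 1]%classic : set MR) by exact: measurable_itv.
  have jf := integrable_subitv ur' iF.
  rewrite -(primitive_complement iF ur) mulrC -(RintegralZl _ mI jf).
  have jf2 := integrableZl mI (g r) jf.
  rewrite fineK; last exact: (integrable_fin_num mI jf2).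
  rewrite [RHS]integral_mkcond; apply: eq_integral => s _.
  rewrite /k /fU /gU !patchE /= [r \in _]mem_set// indicE.
  case: (boolP (s \in (`[r, 1]%classic : set R))) => [|nr].
    rewrite inE => rs; rewrite (mem_set (ur' _ rs)) mem_set ?mulr1 1?mulrC//.
    by move: rs; rewrite /= in_itv/= => /andP[].
  case: ifPn => us; last by rewrite !mul0r.
  rewrite memNset ?mulr0// /tri /= => rs; move: nr; rewrite notin_setE; apply.
  by move: us; rewrite inE /unit_itv /= !in_itv/= rs => /andP[_ ->].
under eq_integral do rewrite /= inner1.
under [in RHS]eq_integral do rewrite /= inner2.
move=> /(congr1 fine) h.
rewrite [LHS]Rintegral_mkcond [RHS]Rintegral_mkcond.
exact: h.
Qed.

End PrimitiveSwap.

Section WeakSolution.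
Context {R : realType}.
Local Notation mu := (@lebesgue_measure R).
Local Notation MR := (measurableTypeR R).
Variables (A f u : R -> R) (x c1 c2 : R).
Hypothesis hf : is_L2_01 f.
Hypothesis hx : 0 < x < 1.
Hypothesis mA : measurable_fun (unit_itv : set MR) (fun s : MR => (A s)^-1).
Hypothesis c10 : 0 < c1.
Hypothesis A12 : forall s, unit_itv s -> c1 <= (A s)^-1 <= c2.

Let Zi (i : 'I_4) := \int[mu]_(s in unit_itv) (H_vec f x s 0 i / A s).

Let iH (i : 'I_4) : mu.-integrable unit_itv (EFin \o (fun s => H_vec f x s 0 i / A s)).
Proof.
have [CH CH0 hCH] := H_vec_bounded x hf.
apply: (bounded_integrable (K := CH * c2) measurable_unit_itv lebesgue_unit_fin).
  by apply: measurable_funM => //; exact: H_vec_measurable.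
move=> s us; have /andP[h1 h2] := A12 us.
rewrite normrM; apply: ler_pM => //; first exact: hCH.
by rewrite ger0_norm// (le_trans (ltW c10)).
Qed.

Let Z3_gt0 : 0 < Zi 3.
Proof.
apply: (lt_le_trans c10).
have f1 : fine (mu (unit_itv : set MR)) = 1 by rewrite lebesgue_unit_itv.
have ic : mu.-integrable (unit_itv : set MR) (EFin \o (cst c1)).
  apply: (bounded_integrable (K := `|c1|) measurable_unit_itv lebesgue_unit_fin) => //.
rewrite -[c1]mulr1 -[X in _ * X]f1 -(Rintegral_cst _ measurable_unit_itv).
apply: le_Rintegral => //; first exact: measurable_unit_itv.
by move=> s us; rewrite mxE /= mul1r; have /andP[] := A12 us.
Qed.

Let c := Zi 2 / Zi 3.

Let psi s := (H_vec f x s 0 2 - c * H_vec f x s 0 3) / A s.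

Let psiE s : psi s = H_vec f x s 0 2 / A s - c * (H_vec f x s 0 3 / A s).
Proof. by rewrite /psi mulrBl mulrA. Qed.

Let psi_L2 : is_L2_01 psi.
Proof.
have mpsi : measurable_fun (unit_itv : set MR) (psi : MR -> R).
  apply: measurable_funM => //; apply: measurable_funB; first exact: H_vec_measurable.
  by apply: measurable_funM => //; exact: H_vec_measurable.
have [CH CH0 hCH] := H_vec_bounded x hf.
split=> //.
apply: (bounded_integrable (K := ((CH + `|c| * CH) * c2) ^+ 2) measurable_unit_itv lebesgue_unit_fin).
  exact: measurable_funX.
move=> s us; rewrite normrX lerXn2r ?nnegrE//.
  have /andP[h1 h2] := A12 us.
  by rewrite !mulr_ge0// ?addr_ge0 ?mulr_ge0// (le_trans (ltW c10))// (le_trans h1).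
have /andP[h1 h2] := A12 us.
rewrite normrM; apply: ler_pM => //; last by rewrite ger0_norm// (le_trans (ltW c10)).
apply: (le_trans (ler_normB _ _)); apply: lerD; first exact: hCH.
by rewrite normrM ler_wpM2l//; exact: hCH.
Qed.

Let psi_integral : \int[mu]_(s in unit_itv) psi s = 0.
Proof.
have i3 := integrableZl measurable_unit_itv c (iH 3).
under eq_Rintegral do rewrite psiE.
rewrite (RintegralB measurable_unit_itv (iH 2) i3) (RintegralZl _ measurable_unit_itv (iH 3)).
by rewrite -/(Zi 2) -/(Zi 3) /c divfK ?subrr// gt_eqF.
Qed.

(** Test the equation against the primitive [phi] of [psi]. The constant [c] is
   such that [phi] vanishes at [1]. On the left, [A v psi = v (1_(0,x) - c)]
   integrates to [u x]; on the right, integration by parts produces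
   [- int F psi], which is [g(Z)]. *)
Lemma weak_solution_formula : is_weak_solution A f u ->
  u x = g_fun (\row_i Zi i).
Proof.
move=> [u0 u1 [v [v2 uv] weak]].
have iv := L2_integrable v2; have ipsi := L2_integrable psi_L2.
have /andP[x0 x1] := hx.
have ux : u x = \int[mu]_(s in `[0, x]) v s.
  by rewrite uv ?u0 ?add0r// in_itv/= !ltW.
have v1 : \int[mu]_(s in unit_itv) v s = 0.
  by rewrite -u1 uv ?u0 ?add0r// in_itv/= lexx ler01.
have p0 : primitive psi 0 = 0 by rewrite /primitive set_itv1 Rintegral_set1.
have hphi : has_L2_derivative (primitive psi) psi.
  by split => // s _; rewrite p0 add0r.
have := weak _ _ hphi p0 psi_integral.
have -> : \int[mu]_(s in `[0, 1]) (A s * v s * psi s) = u x.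
  have ind : forall s, H_vec f x s 0 2 = \1_(`]0, x[%classic : set R) s by move=> s; rewrite mxE.
  have xU : `]0, x[%classic `<=` unit_itv.
    move=> s; rewrite /unit_itv /= !in_itv/= => /andP[s0 sx].
    by rewrite (ltW s0) (ltW (lt_trans sx x1)).
  have xU' : `[0, x[%classic `<=` unit_itv.
    move=> s; rewrite /unit_itv /= !in_itv/= => /andP[s0 sx].
    by rewrite s0 (ltW (lt_trans sx x1)).
  have mx : measurable (`]0, x[%classic : set MR) by exact: measurable_itv.
  transitivity (\int[mu]_(s in unit_itv) ((v \_ `]0, x[%classic) s - c * v s)).
    apply: eq_Rintegral => s /set_mem us.
    have As : A s != 0.
      by rewrite -invr_eq0 gt_eqF//; apply: (lt_le_trans c10); have /andP[] := A12 us.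
    rewrite /psi ind mxE /= patchE indicE.
    have -> : (point : R) = 0 by [].
    by case: (s \in _); rewrite ?mulr1n ?mulr0n; field.
  have iv' : mu.-integrable unit_itv (EFin \o (v \_ `]0, x[%classic)).
    rewrite -restrict_EFin.
    apply/(integrable_restrict mu mx measurable_unit_itv).
    by rewrite setIidr//; exact: integrable_subitv.
  rewrite (RintegralB measurable_unit_itv iv' (integrableZl measurable_unit_itv c iv)).
  rewrite (RintegralZl _ measurable_unit_itv iv) v1 mulr0 subr0.
  rewrite -Rintegral_mkcondr setIidr// ux.
  rewrite Rintegral_itv_obnd_cbnd; last exact: integrable_subitv.
  by rewrite Rintegral_itv_bndo_bndc//; exact: integrable_subitv.
move=> ->.
transitivity (\int[mu]_(s in unit_itv) (f s * primitive psi s)); first by [].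
rewrite (primitive_swap (L2_integrable hf) ipsi).
transitivity (\int[mu]_(s in unit_itv) (primitive f 1 * psi s
   - (H_vec f x s 0 0 / A s - c * (H_vec f x s 0 1 / A s)))).
  by apply: eq_Rintegral => s _; rewrite /psi !mxE /=; ring.
have i1 := integrableZl measurable_unit_itv c (iH 1).
have i01 := integrableB measurable_unit_itv (iH 0) i1.
rewrite (RintegralB measurable_unit_itv (integrableZl measurable_unit_itv _ ipsi) i01).
rewrite (RintegralZl _ measurable_unit_itv ipsi) psi_integral mulr0 sub0r.
rewrite (RintegralB measurable_unit_itv (iH 0) i1) (RintegralZl _ measurable_unit_itv (iH 1)).
by rewrite -/(Zi 0) -/(Zi 1) /g_fun !mxE -/c /c; ring.
Qed.

End WeakSolution.

(** * Large deviations of the random vector and of the solution *)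

Section ContractionMap.
Context {R : realType}.

Lemma g_dom_open : open (@g_dom R).
Proof.
have h (i : 'I_4) : open [set z : 'rV[R]_4 | 0 < z 0 i].
  apply: (@open_comp _ _ (fun z : 'rV[R]_4 => z 0 i) [set y | 0 < y]).
    by move=> z _; exact: coord_continuous.
  exact: open_gt.
exact: (openI (h 2) (h 3)).
Qed.

Lemma g_fun_continuous (z : 'rV[R]_4) : g_dom z -> {for z, continuous (@g_fun R)}.
Proof.
move=> [z2 z3].
have cc (i : 'I_4) : {for z, continuous (fun z : 'rV[R]_4 => z 0 i)}.
  exact: coord_continuous.
have c23 : {for z, continuous (fun z : 'rV[R]_4 => z 0 2 * (z 0 3)^-1)}.
  apply: continuousM; first exact: cc.
  by apply: continuousV; [rewrite gt_eqF|exact: cc].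
have c1 : {for z, continuous (fun z : 'rV[R]_4 => z 0 1 * (z 0 2 * (z 0 3)^-1))}.
  by apply: continuousM; [exact: cc|exact: c23].
apply: (@continuousD _ _ _ (fun z : 'rV[R]_4 => - z 0 0) _ z _ c1).
by apply: continuousN; exact: cc.
Qed.

Lemma rV_norm_le n (z : 'rV[R]_n) (C : R) : 0 <= C -> (forall i, `|z 0 i| <= C) -> `|z| <= C.
Proof.
move=> C0 h; rewrite -[ `|z|]/(mx_norm z) mx_normrE; apply: bigmax_le => // -[i j] _.
by rewrite /= ord1.
Qed.

End ContractionMap.

Section LargeDeviationsOfZ.
Context {R : realType}.
Local Notation mu := (@lebesgue_measure R).
Local Notation MR := (measurableTypeR R).
Context d {T : measurableType d} (Q : probability T R) (X : nat -> T -> R).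
Variable P : probability MR R.
Hypothesis mX : forall j, measurable_fun [set: T] (X j : T -> MR).
Hypothesis XP : is_iid Q X P.
Variables (a : R -> R) (nub nu1 nu2 : R) (f : R -> R) (x : R).
Hypothesis nu10 : 0 < nu1.
Hypothesis ha : {within unit_itv, continuous a}.
Hypothesis hf : is_L2_01 f.
Hypothesis hx : 0 < x < 1.
Hypothesis hA : {ae Q, forall w, forall s y : R, s \in `[0, 1] -> 0 <= y ->
           nu1 <= A_medium a nub (X ^~ w) s y <= nu2}.

Let Z eps w := Z_vec a nub (X ^~ w) f x eps.
Let Lam := Lambda P a nub f x.
Let W := clamped_inv a nub nu1 nu2.
Let W0 s t : 0 <= W s t. Proof. exact: clamped_inv_ge0. Qed.
Let WC s t : W s t <= nu1^-1. Proof. exact: clamped_inv_le. Qed.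
Let mW : measurable_fun [set: MR * MR] (fun p => W p.1 p.2).
Proof. exact: clamped_inv_measurable. Qed.

Let LamE : Lam = integrated_cumulant mu unit_itv P (W : MR -> MR -> R) (H_vec f x).
Proof. by apply/funext => lam; exact: (LambdaE mX XP f x nu10 ha hA). Qed.

Let mH i := H_vec_measurable x hf i.

Lemma Lambda_smooth : class_Coo Lam.
Proof.
have [CH _ hCH] := H_vec_bounded x hf.
rewrite LamE.
exact: (integrated_cumulant_smooth measurable_unit_itv lebesgue_unit_fin P mW W0 WC mH hCH).
Qed.

Lemma Lambda_convex : convex_function (setT : set (convex_lmodType 'rV[R]_4)) Lam.
Proof.
have [CH _ hCH] := H_vec_bounded x hf.
rewrite LamE.
exact: (integrated_cumulant_convex measurable_unit_itv lebesgue_unit_fin P mW W0 WC mH hCH).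
Qed.

Let Zmgf lam :
  (eps%:E * log_mgf Q (fun w => dotv lam (Z eps w)) eps^-1)%E @[eps --> 0^'+]
    --> (Lam lam)%:E.
Proof. exact: (Z_mgf_cvg mX XP nu10 ha hf hA). Qed.

Let mZ eps : 0 < eps -> borel_measurable (Z eps). Proof. exact: Z_borel. Qed.

Let nu20 : 0 < nu2. Proof. exact: lt_le_trans (nu1_le_nu2 hA). Qed.

Let Z_box_norm C z : Z_box nu2 x C z -> `|z| <= C.
Proof.
move=> hz; have /andP[x0 _] := hx.
have C0 : 0 < C.
  have := hz 3; rewrite /= in_itv/= => /andP[h1 h2].
  by apply: (lt_le_trans _ (le_trans h1 h2)); rewrite /Z_lower /= invr_gt0.
apply: rV_norm_le => [|i]; first exact: ltW.
have := hz i; rewrite /= in_itv/= ler_norml => /andP[h ->]; rewrite andbT.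
apply: le_trans h; have NC : - C <= 0 by rewrite oppr_le0 ltW.
case: i => -[|[|[|[|//]]]] i4; rewrite /Z_lower //=; apply: (le_trans NC).
  by rewrite divr_ge0// ltW.
by rewrite invr_ge0 ltW.
Qed.

Let Z_ae_box : exists C, forall eps, 0 < eps -> {ae Q, forall w, Z_box nu2 x C (Z eps w)}.
Proof.
have [C hC] := Z_in_box mX nu10 ha hf hx hA.
exists C => eps e0; apply: filterS (ae_elliptic hA) => w; exact: hC.
Qed.

Let Z_upper_bound : ldp_upper Q Z (fenchel_legendre Lam).
Proof.
have [C hC] := Z_ae_box.
apply: (@ldp_upper_gartner_ellis R d T Q 3 Z Lam mZ Zmgf C) => eps e0.
by apply: filterS (hC _ e0) => w; exact: Z_box_norm.
Qed.

Let Z_lower_bound : ldp_lower Q Z (fenchel_legendre Lam).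
Proof.
have [cL dL] := Lambda_smooth 1.
apply: (@ldp_lower_gartner_ellis R d T Q 3 Z Lam mZ Zmgf
  (fun lam i => 'D_(delta_mx 0 i) Lam lam)).
  by move=> lam i; apply: derivableP; exact: (dL i).1.
exact: cL.
Qed.

Let Lam_good : is_good_rate_function (fenchel_legendre Lam).
Proof. exact: (fenchel_legendre_good (cumulant0 Zmgf)). Qed.

Theorem Z_ldp : [/\ is_good_rate_function (fenchel_legendre Lam),
  is_convex_ereal (fenchel_legendre Lam) & satisfies_LDP Q Z (fenchel_legendre Lam)].
Proof.
split; [exact: Lam_good|exact: fenchel_legendre_convex|].
exact: ldp_of_bounds.
Qed.

(** Each face of the box bounds a half-space containing [Z] almost surely. *)
Let rate_box C : (forall eps, 0 < eps -> {ae Q, forall w, Z_box nu2 x C (Z eps w)}) ->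
  forall z, (fenchel_legendre Lam z < +oo)%E -> Z_box nu2 x C z.
Proof.
move=> hC z zoo i; rewrite /= in_itv/=; apply/andP; split.
- rewrite -lerN2 -mulN1r -dotv_deltal -dotvZl.
  apply: (fenchel_legendre_domain mZ Zmgf _ zoo) => eps e0.
  apply: filterS (hC _ e0) => w /(_ i); rewrite /= in_itv/= => /andP[h _].
  by rewrite dotvZl dotv_deltal mulN1r lerN2.
- rewrite -dotv_deltal.
  apply: (fenchel_legendre_domain mZ Zmgf _ zoo) => eps e0.
  apply: filterS (hC _ e0) => w /(_ i); rewrite /= in_itv/= => /andP[_ h].
  by rewrite dotv_deltal.
Qed.

Variable u : R -> T -> R -> R.
Hypothesis hu : forall eps : R, 0 < eps -> {ae Q, forall w,
          is_weak_solution (A_eps a nub (X ^~ w) eps) f (u eps w)}.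
Hypothesis hum : forall eps : R, 0 < eps ->
           measurable_fun [set: T] (fun w => u eps w x).

Lemma weak_solutionE eps : 0 < eps -> {ae Q, forall w, u eps w x = g_fun (Z eps w)}.
Proof.
move=> e0; apply: filterS2 (ae_elliptic hA) (hu e0) => w ew sol.
have mA : measurable_fun (unit_itv : set MR)
    (fun s : MR => (A_eps a nub (X ^~ w) eps s)^-1).
  have one1 s : unit_itv s -> `|(cst 1 : R -> R) s| <= 1 by rewrite normr1.
  have := integrable_over_medium mX nu10 ha e0 ew (measurable_cst (1 : R)) one1.
  by move=> /integrableP[/measurable_EFinP]; under eq_fun do rewrite div1r.
have n0 : 0 < nu2^-1 by rewrite invr_gt0.
have bA s (us : unit_itv s) := medium_inv_bounds nu10 hA e0 ew us.
exact: (weak_solution_formula hf hx mA n0 bA sol).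
Qed.

Theorem solution_ldp : is_good_rate_function (rate_u Lam) /\
  satisfies_LDP Q (fun eps w => u eps w x) (rate_u Lam).
Proof.
have [C hC] := Z_ae_box.
have cK : compact (Z_box nu2 x C) by exact: Z_box_compact.
have KD : Z_box nu2 x C `<=` @g_dom R by exact: (Z_box_dom nu10 hx hA).
have IK := rate_box hC.
split; first exact: (contracted_rate_good cK KD g_fun_continuous Lam_good IK).
have UE := weak_solutionE.
exact: (contraction_principle g_dom_open cK KD g_fun_continuous mZ
  Z_upper_bound Z_lower_bound hC hum UE).
Qed.

End LargeDeviationsOfZ.

Theorem theorem4p4 (R : realType)
  (d : measure_display) (Omega : measurableType d) (P : probability Omega R)
  (* the random vector xi, its conditional laws, and the fixed value v of xi *)
  (m : nat) (xi : {RV P >-> m.-tuple (measurableTypeR R)})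
  (Pxi : m.-tuple (measurableTypeR R) -> probability Omega R)
  (hPxi : is_conditional_probability P xi Pxi)
  (v : m.-tuple (measurableTypeR R))
  (* the medium *)
  (a : R -> m.-tuple (measurableTypeR R) -> R)
  (ha : {within `[0, 1], continuous (a ^~ v)})
  (nub : R) (hnub : 0 < nub)
  (theta : nat -> {RV P >-> measurableTypeR R})
  (pitheta : probability (measurableTypeR R) R)
  (hiid : is_iid (Pxi v) theta pitheta)
  (htheta : {ae Pxi v, forall w, forall j, `|theta j w| <= 1})
  (nu1 nu2 : R) (hnu1 : 0 < nu1)
  (hA : {ae Pxi v, forall w, forall s y : R, s \in `[0, 1] -> 0 <= y ->
           nu1 <= A_medium (a ^~ v) nub (theta ^~ w) s y <= nu2})
  (* the equation *)
  (f : R -> R) (hf : is_L2_01 f)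
  (x : R) (hx : 0 < x < 1)
  (u : R -> Omega -> R -> R)
  (hu : forall eps : R, 0 < eps -> {ae Pxi v, forall w,
          is_weak_solution (A_eps (a ^~ v) nub (theta ^~ w) eps) f (u eps w)})
  (hum : forall eps : R, 0 < eps ->
           measurable_fun [set: Omega] (fun w => u eps w x)) :
  let Lam := Lambda pitheta (a ^~ v) nub f x in
  let Z eps w := Z_vec (a ^~ v) nub (theta ^~ w) f x eps in
  [/\ class_Coo Lam,
      convex_function (setT : set (convex_lmodType 'rV[R]_4)) Lam,
      forall lam : 'rV[R]_4,
        (eps%:E * log_mgf (Pxi v) (fun w => dotv lam (Z eps w)) eps^-1)%E
          @[eps --> 0^'+] --> (Lam lam)%:E,
      [/\ is_good_rate_function (fenchel_legendre Lam),
          is_convex_ereal (fenchel_legendre Lam)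
        & satisfies_LDP (Pxi v) Z (fenchel_legendre Lam)]
    & is_good_rate_function (rate_u Lam) /\
      satisfies_LDP (Pxi v) (fun eps w => u eps w x) (rate_u Lam)].
Proof.
have mX j : measurable_fun [set: Omega] (theta j : Omega -> measurableTypeR R).
  exact: measurable_funPT.
pose X j w : R := theta j w.
split.
- exact: (@Lambda_smooth R d Omega (Pxi v) X pitheta mX hiid (a ^~ v)
    nub nu1 nu2 f x hnu1 ha hf hA).
- exact: (@Lambda_convex R d Omega (Pxi v) X pitheta mX hiid (a ^~ v)
    nub nu1 nu2 f x hnu1 ha hf hA).
- exact: (@Z_mgf_cvg R d Omega (Pxi v) X pitheta mX hiid (a ^~ v)
    nub nu1 nu2 f x hnu1 ha hf hA).
- exact: (@Z_ldp R d Omega (Pxi v) X pitheta mX hiid (a ^~ v)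
    nub nu1 nu2 f x hnu1 ha hf hx hA).
- exact: (@solution_ldp R d Omega (Pxi v) X pitheta mX hiid (a ^~ v)
    nub nu1 nu2 f x hnu1 ha hf hx hA u hu hum).
Qed.
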